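(* If $\mathcal{E} \in \mathfrak{E}_1$ is non-resonant, then there exists a unique normal form $\mathcal{N} \in \mathfrak{D}_1$ such that $\mathrm{Hom}(\mathcal{N}, \mathcal{E}) \neq \emptyset$. Indeed, in that case, there is a unique normalizing transformation: $|\mathrm{Hom}(\mathcal{N}, \mathcal{E})| =1$. If $\mathcal{E}$ is convergent, so is $\mathcal{N}$ and the normalizing transformation.
   Context: Fix $m=1$. The category $\mathfrak{E}_1$ has as objects the (formal or holomorphic) singular second order ODEs $w''=w\,\Phi\left(z,w,\frac{w'}{w}\right)$, where $\Phi(z,w,\zeta)=\sum_{a,b\ge 0,\,c\ge 2}\Phi_{a,b,c}z^aw^b\zeta^c$ is a power series in $\mathbb C[[z,w,\zeta]]$ with $\Phi=O(\zeta^2)$ (such an ODE is called convergent if $\Phi$ is a convergent power series). For $\mathcal E_1,\mathcal E_2\in\mathfrak E_1$, a morphism $H\in\mathrm{Hom}(\mathcal E_1,\mathcal E_2)$ is an invertible formal map $H(z,w)=(F(z,w),G(z,w))$, $F,G\in\mathbb C[[z,w]]$, transforming graphs of solutions of $\mathcal E_1$ into graphs of solutions of $\mathcal E_2$ and of the form $F=z+f(z,w)$, $G=w+wg_0(w)+w\,g(z,w)$ with $f_z(0,0)=0$, $g_0(0)=0$, $g(z,w)=O(zw)$. The subcategory $\mathfrak{D}_1\subset\mathfrak E_1$ (ODEs in normal form) consists of those ODEs whose $\Phi$ satisfies in addition $\Phi_{0,j,2}=\Phi_{1,j,2}=\Phi_{0,j,3}=\Phi_{1,j,3}=0$ for all $j>0$.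 Non-resonance: write $\Phi(z,w,\zeta)=\sum_k\Phi_k(z,w)\zeta^k$, $\Phi_2=\sum_j A_j(w)z^j$, $\Phi_3=\sum_jB_j(w)z^j$, $\Phi_4=\sum_jC_j(w)z^j$, and $\alpha_j=A_j(0)$, $\beta_j=B_j(0)$, $\gamma_j=C_j(0)$. The ODE is non-resonant if the linearization matrix at the origin of the first order Briot–Bouquet system satisfied by the Cauchy data $(g_0,g_1,f_0,f_1)$ of a transformation (with $f_0(w)=f(0,w)$, $f_1(w)=f_z(0,w)$, $g_1(w)=g_z(0,w)/w$) has no positive integer eigenvalues; equivalently, for every integer $k\ge 1$ the linear system with matrix $\begin{pmatrix} k(k+1-\alpha_0) & -3\beta_0 & -\alpha_1 & -2k\\ \alpha_1k & 3k(k+1-\alpha_0)+3\beta_1 & 2\alpha_2 & \alpha_1\\ 2k\beta_0 & 4\gamma_0 & k(k-1+\alpha_0)+\beta_1 & -\beta_0\\ 2k\beta_1 & 2\beta_0(\alpha_0-1)+4\gamma_1 & k\alpha_1+2\beta_2 & k(k-1+\alpha_0)\end{pmatrix}h_k=0$ has only the trivial solution $h_k=0$. *)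

(* Defs.v *)
From mathcomp Require Import all_boot all_algebra.
From mathcomp Require Export complex reals.

Set Implicit Arguments.
Unset Strict Implicit.
Unset Printing Implicit Defensive.
Import GRing.Theory Num.Theory.
Local Open Scope ring_scope.

(* The complex numbers are R[i] for a realType R (any realType is the real
   line, so R[i] is the field C).

   A formal power series in the three variables (z, w, zeta) over R[i] is
   represented by its coefficient function: A a b c is the coefficient of
   z^a w^b zeta^c.  Power series in (z, w) only are those whose coefficients
   with c > 0 vanish. *)
Definition fps (R : realType) := nat -> nat -> nat -> R[i].

Section FPS.
Variable R : realType.
Local Notation C := (R[i]).
Implicit Types A B P Phi : fps R.

Definition fps_const (x : C) : fps R :=
  fun a b c => if [&& a == 0%N, b == 0%N & c == 0%N] then x else 0.
Definition fps_z : fps R := fun a b c => if [&& a == 1%N, b == 0%N & c == 0%N] then 1 else 0.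
Definition fps_w : fps R := fun a b c => if [&& a == 0%N, b == 1%N & c == 0%N] then 1 else 0.
Definition fps_zeta : fps R := fun a b c => if [&& a == 0%N, b == 0%N & c == 1%N] then 1 else 0.

Definition fps_add A B : fps R := fun a b c => A a b c + B a b c.
Definition fps_opp A : fps R := fun a b c => - A a b c.
Definition fps_sub A B : fps R := fps_add A (fps_opp B).

Definition fps_mul A B : fps R := fun a b c =>
  \sum_(i < a.+1) \sum_(j < b.+1) \sum_(k < c.+1)
     A i j k * B (a - i)%N (b - j)%N (c - k)%N.

Fixpoint fps_exp A (n : nat) : fps R :=
  if n is n'.+1 then fps_mul A (fps_exp A n') else fps_const 1.

Definition fps_dz A : fps R := fun a b c => A a.+1 b c *+ a.+1.
Definition fps_dw A : fps R := fun a b c => A a b.+1 c *+ b.+1.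
Definition fps_dzeta A : fps R := fun a b c => A a b c.+1 *+ c.+1.

(* Substitution Phi(A, B, P) for series A, B, P without constant term:
   the coefficient of z^i w^j zeta^k only involves the terms
   Phi_{a,b,c} A^a B^b P^c with a + b + c <= i + j + k. *)
Definition fps_comp Phi A B P : fps R := fun i j k =>
  let N := (i + j + k).+1 in
  \sum_(a < N) \sum_(b < N) \sum_(c < N)
     Phi a b c * fps_mul (fps_exp A a) (fps_mul (fps_exp B b) (fps_exp P c)) i j k.

Definition fps_convergent A : Prop :=
  exists M r : C, 0 < r /\ forall a b c, `|A a b c| <= M * r ^+ (a + b + c).

Definition fps_zw A : Prop := forall a b c, (0 < c)%N -> A a b c = 0.
Definition fps_wonly A : Prop := forall a b c, (0 < a)%N || (0 < c)%N -> A a b c = 0.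

(* The category E_1.  An object is the ODE  w'' = w Phi(z, w, w'/w),
   given by Phi in C[[z,w,zeta]] with Phi = O(zeta^2). *)
Definition in_E1 Phi : Prop := forall a b c, (c < 2)%N -> Phi a b c = 0.

Definition ode_convergent Phi : Prop := fps_convergent Phi.

Definition in_D1 Phi : Prop :=
  in_E1 Phi /\
  forall j, (0 < j)%N ->
    [/\ Phi 0%N j 2%N = 0, Phi 1%N j 2%N = 0, Phi 0%N j 3%N = 0 & Phi 1%N j 3%N = 0].

(* With zeta = w'/w the ODE w'' = w Phi(z,w,w'/w) is the first order system
   w' = w zeta,  zeta' = Phi(z,w,zeta) - zeta^2, i.e. the formal vector field
   X_Phi = d/dz + w zeta d/dw + (Phi - zeta^2) d/dzeta, whose integral curves
   are the (prolonged) graphs of solutions. *)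
Definition ode_field Phi A : fps R :=
  fps_add (fps_dz A)
    (fps_add (fps_mul (fps_mul fps_w fps_zeta) (fps_dw A))
             (fps_mul (fps_sub Phi (fps_mul fps_zeta fps_zeta)) (fps_dzeta A))).

(* Normalisation of the maps H = (F, G) allowed as morphisms:
   F = z + f(z,w), G = w + w g0(w) + w g(z,w), with f_z(0,0) = 0,
   g0(0) = 0, g = O(zw); moreover H is a formal map of (C^2,0), so
   f(0,0) = 0.  (Such H is automatically invertible: its Jacobian at 0 is
   unipotent upper triangular.) *)
Definition admissible_map (F G : fps R) : Prop :=
  fps_zw F /\ fps_zw G /\
  exists f g0 g : fps R,
    [/\ fps_zw f /\ fps_wonly g0 /\ fps_zw g,
        F = fps_add fps_z f,
        G = fps_add fps_w (fps_add (fps_mul fps_w g0) (fps_mul fps_w g)),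
        (f 0%N 0%N 0%N = 0 /\ f 1%N 0%N 0%N = 0 /\ g0 0%N 0%N 0%N = 0)
      & forall a b c, (a == 0%N) || (b == 0%N) -> g a b c = 0].

(* H = (F, G) transforms graphs of solutions of E1 (given by Phi1) into
   graphs of solutions of E2 (given by Phi2).  Along a solution w(z) of E1,
   put Z = F(z,w(z)), W = G(z,w(z)); the new unknown zeta~ = (dW/dZ)/W is the
   series P determined by  X(F) * G * P = X(G)  (X = X_Phi1), and W(Z) solves
   E2 iff  d zeta~/dZ = Phi2(Z, W, zeta~) - zeta~^2, i.e.
   X(P) = X(F) * (Phi2(F, G, P) - P^2). *)
Definition transforms (Phi1 Phi2 F G : fps R) : Prop :=
  exists P : fps R,
    [/\ P 0%N 0%N 0%N = 0,
        fps_mul (ode_field Phi1 F) (fps_mul G P) = ode_field Phi1 G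
      & ode_field Phi1 P =
        fps_mul (ode_field Phi1 F) (fps_sub (fps_comp Phi2 F G P) (fps_mul P P))].

Definition ode_Hom (Phi1 Phi2 F G : fps R) : Prop :=
  admissible_map F G /\ transforms Phi1 Phi2 F G.

Definition res_matrix Phi (k : nat) : 'M[C]_4 :=
  let a0 := Phi 0%N 0%N 2%N in let a1 := Phi 1%N 0%N 2%N in
  let a2 := Phi 2%N 0%N 2%N in
  let b0 := Phi 0%N 0%N 3%N in let b1 := Phi 1%N 0%N 3%N in
  let b2 := Phi 2%N 0%N 3%N in
  let c0 := Phi 0%N 0%N 4%N in let c1 := Phi 1%N 0%N 4%N in
  let K : C := k%:R in
  let rows : seq (seq C) :=
    [:: [:: K * (K + 1 - a0); - (3 * b0); - a1; - (2 * K)];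
        [:: a1 * K; 3 * K * (K + 1 - a0) + 3 * b1; 2 * a2; a1];
        [:: 2 * K * b0; 4 * c0; K * (K - 1 + a0) + b1; - b0];
        [:: 2 * K * b1; 2 * b0 * (a0 - 1) + 4 * c1; K * a1 + 2 * b2;
            K * (K - 1 + a0)]] in
  \matrix_(i < 4, j < 4) nth 0 (nth [::] rows i) j.

Definition nonresonant Phi : Prop :=
  forall k : nat, (1 <= k)%N ->
    forall h : 'cV[C]_4, res_matrix Phi k *m h = 0 -> h = 0.

End FPS.

(* Main.v *)
Require Import Defs.
From HB Require Import structures.
From mathcomp Require Import all_boot all_order all_algebra.
From mathcomp Require Import complex reals boolp.
From mathcomp Require Import ring zify.
Set Implicit Arguments.
Unset Strict Implicit.
Unset Printing Implicit Defensive.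
Import Order.TTheory GRing.Theory Num.Theory.
Local Open Scope ring_scope.

(* Write F = z + f, G = w (1 + h), P = zeta + p for the prolonged map and
   N = zeta^2 + mu + m for the normal form, where mu = (E - zeta^2)(z, 0, zeta);
   f, h, p, m are divisible by w.  The equations of a morphism N -> E say that a
   linear operator applied to (f, h, p, m) equals a remainder which is quadratic
   in (w, f, h, p, m).  Since N = O(zeta^2), the zeta^0 and zeta^1 parts of the
   linear problem give h_zz and f_zz; since N is in normal form, the zeta^2 and
   zeta^3 parts at z^0 and z^1 give, for each power w^k, a linear system with the
   matrix [res_matrix E k] for the Cauchy data (h, h_z, f, f_z) at z = 0, and the
   rest gives p and m.  So a morphism is a fixed point of a map that gains one
   order in w: it exists and is unique as a formal series.

   For convergence, the fixed point map is shown to preserve a small ball of series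
   whose coefficients of z^a w^b zeta^c are at most
   'C(a + b, a) p^a q^b l^c / ((a + b + 1)^s (c + 1)^t) times the radius.  This
   family of norms is multiplicative up to a constant; d/dz and w d/dw cost one unit
   of s and d/dzeta one unit of t, while solving the linear problem gains back two
   units of s.  Taking q large makes the terms explicit in w small, and remainders are
   quadratic in the radius.  Starting the iteration at 0 gives a limit in the
   ball. *)

(** * Formal power series *)

(** The linear operator is taken at w = 0, so its coefficients depend on z and zeta only and it
    never mixes powers of w. The obstacle to convergence is a loss of derivatives: passing from f, h
    to p and from p to m costs two of them, possibly w d/dw twice, whereas the equations can only be
    integrated in z. Two facts restore the balance. Division by (a + 1)(a + 2) acts on the binomial
    weights like division by (a + b + 1)(a + b + 2). The inverse of the resonance matrix gains k^2
    on h, f and k on h_z, f_z, uniformly in k. So f and h are measured with s = 5, p with s = 4, m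
    and the total remainder with s = 3. Derivatives in zeta are harmless: f and h do not depend on
    zeta, hence are bounded for t = 3 whatever the t of the remainder. The radius b of the ball and
    q are tied by 1/q <= b^2, which makes an explicit w as small as a product of two unknowns. *)

Definition ser (K : Type) := nat -> K.

HB.instance Definition _ (K : Type) := gen_eqMixin (ser K).
HB.instance Definition _ (K : Type) := gen_choiceMixin (ser K).

Section SerRing.
Variable K : comNzRingType.
Implicit Types A B C : ser K.

Definition ser_zero : ser K := fun=> 0.
Definition ser_add A B : ser K := fun n => A n + B n.
Definition ser_opp A : ser K := fun n => - A n.

Fact ser_addA : associative ser_add.
Proof. by move=> A B C; apply: funext => n; rewrite /ser_add addrA. Qed.
Fact ser_addC : commutative ser_add.
Proof. by move=> A B; apply: funext => n; rewrite /ser_add addrC. Qed.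
Fact ser_add0 : left_id ser_zero ser_add.
Proof. by move=> A; apply: funext => n; rewrite /ser_add add0r. Qed.
Fact ser_addN : left_inverse ser_zero ser_opp ser_add.
Proof. by move=> A; apply: funext => n; rewrite /ser_add addNr. Qed.

HB.instance Definition _ :=
  GRing.isZmodule.Build (ser K) ser_addA ser_addC ser_add0 ser_addN.

Definition ser_one : ser K := fun n => if n == 0 then 1 else 0.
Definition ser_mul A B : ser K := fun n => \sum_(i < n.+1) A i * B (n - i)%N.

(** A coefficient of a product only sees finitely many coefficients of the factors, so commutativity
    and associativity are inherited from polynomials. *)
Definition trunc_poly (N : nat) A : {poly K} := \poly_(i < N) A i.

Fact coef_trunc_mul N A B n : (n < N)%N ->
  (trunc_poly N A * trunc_poly N B)`_n = ser_mul A B n.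
Proof.
move=> ltnN; rewrite coefM; apply: eq_bigr => i _; rewrite !coef_poly.
have -> : (i < N)%N by apply: leq_ltn_trans ltnN; rewrite -ltnS.
by have -> : (n - i < N)%N by apply: leq_ltn_trans ltnN; apply: leq_subr.
Qed.

Fact ser_mulC : commutative ser_mul.
Proof.
move=> A B; apply: funext => n.
by rewrite -!(@coef_trunc_mul n.+1) // mulrC.
Qed.

Fact ser_mulA : associative ser_mul.
Proof.
have mul_trunc A B C n : ser_mul (ser_mul A B) C n =
    (trunc_poly n.+1 A * trunc_poly n.+1 B * trunc_poly n.+1 C)`_n.
  rewrite coefM; apply: eq_bigr => i _.
  by rewrite coef_trunc_mul // coef_poly ltnS leq_subr.
move=> A B C; apply: funext => n.
by rewrite (ser_mulC A) !mul_trunc -[in RHS]mulrA mulrC.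
Qed.

Fact ser_mul1 : left_id ser_one ser_mul.
Proof.
move=> A; apply: funext => n; rewrite /ser_mul big_ord_recl /= mul1r subn0.
by rewrite big1 ?addr0 // => i _; rewrite /ser_one mul0r.
Qed.

Fact ser_mulDl : left_distributive ser_mul ser_add.
Proof.
move=> A B C; apply: funext => n; rewrite /ser_mul /ser_add -big_split.
by apply: eq_bigr => i _; rewrite mulrDl.
Qed.

Fact ser_1neq0 : ser_one != 0 :> ser K.
Proof.
by apply/eqP => /(congr1 (fun A : ser K => A 0%N))/eqP; rewrite oner_eq0.
Qed.

HB.instance Definition _ := GRing.Zmodule_isComNzRing.Build (ser K)
  ser_mulA ser_mulC ser_mul1 ser_mulDl ser_1neq0.

Lemma serDE A B n : (A + B) n = A n + B n. Proof. by []. Qed.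
Lemma serME A B n : (A * B) n = \sum_(i < n.+1) A i * B (n - i)%N.
Proof. by []. Qed.
Lemma ser_sumE I (r : seq I) (P : pred I) (F : I -> ser K) n :
  (\sum_(i <- r | P i) F i) n = \sum_(i <- r | P i) F i n.
Proof. exact: (big_morph (fun A : ser K => A n)). Qed.
Lemma serMnE A k n : (A *+ k) n = A n *+ k.
Proof. by elim: k => [|k IH]; rewrite ?mulr0n // !mulrS serDE IH. Qed.

End SerRing.

Section SerShift.
Variable K : comNzRingType.

Definition sX : ser K := fun n => (n == 1)%:R.
Definition sC (x : K) : ser K := fun n => if n == 0 then x else 0.

Lemma sXM (A : ser K) n : (sX * A) n = if n is m.+1 then A m else 0.
Proof.
rewrite serME big_ord_recl mul0r add0r; case: n => [|n]; first by rewrite big_ord0.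
rewrite big_ord_recl big1 => [|i _]; first by rewrite /= mul1r subSS subn0 addr0.
by rewrite /sX mul0r.
Qed.

Lemma sCM x (A : ser K) n : (sC x * A) n = x * A n.
Proof.
by rewrite serME big_ord_recl big1 ?addr0 ?subn0 // => i _; rewrite mul0r.
Qed.

End SerShift.

Section Fps3.
Variable K : numFieldType.
Notation T := (ser (ser (ser K))).
Implicit Types A B : T.

(* Locked, so that unification never unfolds them. *)
Definition cst (x : K) : T := locked (sC (sC (sC x))).
Definition zT : T := locked (sX _).
Definition wT : T := locked (sC (sX _)).
Definition vT : T := locked (sC (sC (sX _))).

Definition dz A : T := fun a b c => A a.+1 b c *+ a.+1.
Definition dw A : T := fun a b c => A a b.+1 c *+ b.+1.
Definition dv A : T := fun a b c => A a b c.+1 *+ c.+1.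
(** The Euler operator w d/dw: it is what the vector field contains, and unlike [dw] it preserves
    the order in w. *)
Definition Dw A : T := fun a b c => A a b c *+ b.

Lemma c3P A B : (forall a b c, A a b c = B a b c) -> A = B.
Proof. by move=> e; do 3!apply: funext => ?; apply: e. Qed.

Lemma c30 a b c : (0 : T) a b c = 0. Proof. by []. Qed.
Lemma c3D A B a b c : (A + B) a b c = A a b c + B a b c. Proof. by []. Qed.
Lemma c3N A a b c : (- A) a b c = - A a b c. Proof. by []. Qed.
Lemma c3B A B a b c : (A - B) a b c = A a b c - B a b c. Proof. by []. Qed.
Lemma c3Mn A n a b c : (A *+ n) a b c = A a b c *+ n.
Proof. by rewrite !serMnE. Qed.
Lemma c3sum I (r : seq I) (P : pred I) (F : I -> T) a b c :
  (\sum_(i <- r | P i) F i) a b c = \sum_(i <- r | P i) F i a b c.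
Proof. by rewrite !ser_sumE. Qed.
Lemma c31 a b c : (1 : T) a b c = [&& a == 0, b == 0 & c == 0]%N%:R.
Proof. by case: a b c => [|a] [|b] [|c]. Qed.
Lemma c3M A B a b c : (A * B) a b c =
  \sum_(i < a.+1) \sum_(j < b.+1) \sum_(k < c.+1)
     A i j k * B (a - i)%N (b - j)%N (c - k)%N.
Proof.
rewrite serME !ser_sumE; apply: eq_bigr => i _; rewrite serME ser_sumE.
by apply: eq_bigr => j _; rewrite serME.
Qed.

Lemma c3cst x A a b c : (cst x * A) a b c = x * A a b c.
Proof. by rewrite /cst -lock !sCM. Qed.
Lemma c3z A a b c : (zT * A) a b c = if a is a'.+1 then A a' b c else 0.
Proof. by rewrite /zT -lock sXM; case: a. Qed.
Lemma c3w A a b c : (wT * A) a b c = if b is b'.+1 then A a b' c else 0.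
Proof. by rewrite /wT -lock sCM sXM; case: b. Qed.
Lemma c3v A a b c : (vT * A) a b c = if c is c'.+1 then A a b c' else 0.
Proof. by rewrite /vT -lock !sCM sXM; case: c. Qed.

Lemma zTE a b c : zT a b c = [&& a == 1, b == 0 & c == 0]%N%:R.
Proof. by rewrite -[zT]mulr1 c3z; case: a => [|a]; rewrite ?c31. Qed.
Lemma wTE a b c : wT a b c = [&& a == 0, b == 1 & c == 0]%N%:R.
Proof. by rewrite -[wT]mulr1 c3w; case: b => [|b]; rewrite ?c31; case: a. Qed.
Lemma vTE a b c : vT a b c = [&& a == 0, b == 0 & c == 1]%N%:R.
Proof. by rewrite -[vT]mulr1 c3v; case: c => [|c]; rewrite ?c31; case: a; case: b. Qed.
Lemma cstE x a b c : cst x a b c = x * [&& a == 0, b == 0 & c == 0]%N%:R.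
Proof. by rewrite -[cst x]mulr1 c3cst c31. Qed.

Lemma c3zn n A a b c : (zT ^+ n * A) a b c = if (n <= a)%N then A (a - n)%N b c else 0.
Proof.
elim: n a => [|n IH] a; first by rewrite expr0 mul1r subn0.
by rewrite exprS -mulrA c3z; case: a => // a; rewrite IH ltnS subSS.
Qed.
Lemma c3vn n A a b c : (vT ^+ n * A) a b c = if (n <= c)%N then A a b (c - n)%N else 0.
Proof.
elim: n c => [|n IH] c; first by rewrite expr0 mul1r subn0.
by rewrite exprS -mulrA c3v; case: c => // c; rewrite IH ltnS subSS.
Qed.

Lemma wT_inj A B : wT * A = wT * B -> A = B.
Proof.
move=> e; apply: c3P => a b c.
by have := congr1 (fun X : T => X a b.+1 c) e; rewrite !c3w.
Qed.

Lemma dzD A B : dz (A + B) = dz A + dz B.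
Proof. by apply: c3P => a b c; rewrite c3D /dz c3D mulrnDl. Qed.
Lemma dvD A B : dv (A + B) = dv A + dv B.
Proof. by apply: c3P => a b c; rewrite c3D /dv c3D mulrnDl. Qed.
Lemma DwD A B : Dw (A + B) = Dw A + Dw B.
Proof. by apply: c3P => a b c; rewrite c3D /Dw c3D mulrnDl. Qed.
Lemma dzN A : dz (- A) = - dz A.
Proof. by apply: c3P => a b c; rewrite c3N /dz c3N mulNrn. Qed.
Lemma dvN A : dv (- A) = - dv A.
Proof. by apply: c3P => a b c; rewrite c3N /dv c3N mulNrn. Qed.
Lemma DwN A : Dw (- A) = - Dw A.
Proof. by apply: c3P => a b c; rewrite c3N /Dw c3N mulNrn. Qed.
Lemma wT_dw A : wT * dw A = Dw A.
Proof. by apply: c3P => a [|b] c; rewrite c3w. Qed.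

(* The weight is [b] for the w-adic order and [a + b + c] for the total order. *)
Definition van (wt : nat -> nat -> nat -> nat) n A :=
  forall a b c, (wt a b c < n)%N -> A a b c = 0.
Definition additive_wt (wt : nat -> nat -> nat -> nat) :=
  forall a b c i j k, (i <= a)%N -> (j <= b)%N -> (k <= c)%N ->
    wt a b c = (wt i j k + wt (a - i) (b - j) (c - k))%N.

Section Van.
Variable wt : nat -> nat -> nat -> nat.
Hypothesis wt_add : additive_wt wt.

Lemma vanD n A B : van wt n A -> van wt n B -> van wt n (A + B).
Proof. by move=> hA hB a b c lt; rewrite c3D hA // hB // addr0. Qed.
Lemma vanN n A : van wt n A -> van wt n (- A).
Proof. by move=> hA a b c lt; rewrite c3N hA // oppr0. Qed.
Lemma vanB n A B : van wt n A -> van wt n B -> van wt n (A - B).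
Proof. by move=> hA hB; apply: vanD => //; apply: vanN. Qed.
Lemma vanMn n A k : van wt n A -> van wt n (A *+ k).
Proof. by move=> hA a b c lt; rewrite c3Mn hA // mul0rn. Qed.
Lemma vanW n m A : (m <= n)%N -> van wt n A -> van wt m A.
Proof. by move=> le hA a b c lt; apply: hA; apply: leq_trans le. Qed.
Lemma van_le0 A : van wt 0 A. Proof. by []. Qed.
Lemma vanM n m A B : van wt n A -> van wt m B -> van wt (n + m) (A * B).
Proof.
move=> hA hB a b c lt; rewrite c3M big1 // => i _; rewrite big1 // => j _.
rewrite big1 // => k _.
have := wt_add (ltn_ord i : (i <= a)%N) (ltn_ord j : (j <= b)%N) (ltn_ord k : (k <= c)%N).
case: (ltnP (wt i j k) n) => [lti _|lei e]; first by rewrite hA ?mul0r.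
by rewrite hB ?mulr0 //; move: lt; rewrite e; lia.
Qed.
Lemma vanMl n A B : van wt n A -> van wt n (A * B).
Proof. by move=> hA; rewrite -[n]addn0; apply: vanM. Qed.
Lemma vanMr n A B : van wt n B -> van wt n (A * B).
Proof. by rewrite mulrC; apply: vanMl. Qed.
Lemma vanX A n : van wt 1 A -> van wt n (A ^+ n).
Proof.
move=> hA; elim: n => // n IH; rewrite exprS -add1n; exact: vanM.
Qed.
End Van.

Definition wdeg (a b c : nat) : nat := b.
Definition tdeg (a b c : nat) : nat := (a + b + c)%N.
Lemma wdeg_add : additive_wt wdeg. Proof. by move=> *; rewrite /wdeg; lia. Qed.
Lemma tdeg_add : additive_wt tdeg. Proof. by move=> *; rewrite /tdeg; lia. Qed.

Lemma van_dz n A : van wdeg n A -> van wdeg n (dz A).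
Proof. by move=> hA a b c lt; rewrite /dz hA ?mul0rn. Qed.
Lemma van_dv n A : van wdeg n A -> van wdeg n (dv A).
Proof. by move=> hA a b c lt; rewrite /dv hA ?mul0rn. Qed.
Lemma van_Dw n A : van wdeg n A -> van wdeg n (Dw A).
Proof. by move=> hA a b c lt; rewrite /Dw hA ?mul0rn. Qed.

Lemma van_all A : (forall n, van wdeg n A) -> A = 0.
Proof. by move=> h; apply: c3P => a b c; apply: (h b.+1). Qed.

(** A product of two series divisible by w gains one order on its arguments. With the Taylor
    estimate below, this is the source of the contraction. *)
Lemma van_prod_sub k A A' B B' : van wdeg 1 A' -> van wdeg 1 B ->
  van wdeg k (A - A') -> van wdeg k (B - B') -> van wdeg k.+1 (A * B - A' * B').
Proof.
move=> hA' hB hAA hBB.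
have -> : A * B - A' * B' = (A - A') * B + A' * (B - B') by ring.
apply: vanD; first by rewrite -addn1; apply: vanM => //; apply: wdeg_add.
by rewrite -add1n; apply: vanM => //; apply: wdeg_add.
Qed.

End Fps3.

(** * Substitution and its first order expansion *)

Section Comp.
Variable K : numFieldType.
Notation T := (ser (ser (ser K))).
Notation zT := (zT K).
Notation wT := (wT K).
Notation vT := (vT K).
Implicit Types A B F G P Psi : T.

(** With a cutoff independent of the coefficient that is read, the substitution is a finite sum in
    the ring, where algebraic identities apply. By [compNE] every large enough cutoff gives the same
    coefficient. *)
Definition compN Psi N F G P : T :=
  \sum_(a < N) \sum_(b < N) \sum_(c < N)
     cst (Psi a b c) * (F ^+ a * (G ^+ b * P ^+ c)).
Definition comp Psi F G P : T :=
  fun i j k => compN Psi (i + j + k).+1 F G P i j k.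
Definition w0 Psi : T := fun a b c => if b == 0%N then Psi a 0%N c else 0.

Lemma sum_ord_trunc (V : nmodType) n N (g : nat -> V) : (n <= N)%N ->
  (forall a, (n <= a)%N -> g a = 0) -> \sum_(a < N) g a = \sum_(a < n) g a.
Proof.
move=> le g0; rewrite (big_ord_widen _ _ le) [RHS]big_mkcond /=.
by apply: eq_bigr => a _; case: ltnP => // /g0.
Qed.

Lemma compNE Psi F G P N i j k :
  van tdeg 1 F -> van tdeg 1 G -> van tdeg 1 P -> (i + j + k < N)%N ->
  compN Psi N F G P i j k = comp Psi F G P i j k.
Proof.
move=> hF hG hP lt; rewrite /comp /compN !c3sum.
have z a b c : (i + j + k < a + b + c)%N ->
    (cst (Psi a b c) * (F ^+ a * (G ^+ b * P ^+ c))) i j k = 0.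
  move=> lt'; rewrite c3cst.
  have v : van tdeg (a + (b + c)) (F ^+ a * (G ^+ b * P ^+ c)).
    by do 2?apply: (vanM tdeg_add); apply: (vanX tdeg_add).
  by rewrite v ?mulr0 // /tdeg; lia.
rewrite (sum_ord_trunc (g := fun a => (\sum_(b < N) \sum_(c < N)
     cst (Psi a b c) * (F ^+ a * (G ^+ b * P ^+ c))) i j k) lt).
  apply: eq_bigr => a _; rewrite !c3sum.
  rewrite (sum_ord_trunc (g := fun b => (\sum_(c < N)
     cst (Psi a b c) * (F ^+ a * (G ^+ b * P ^+ c))) i j k) lt).
    apply: eq_bigr => b _; rewrite !c3sum.
    rewrite (sum_ord_trunc (g := fun c =>
     (cst (Psi a b c) * (F ^+ a * (G ^+ b * P ^+ c))) i j k) lt) //.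
    by move=> c le; apply: z; lia.
  by move=> b le; rewrite c3sum big1 // => c _; apply: z; lia.
move=> a le; rewrite c3sum big1 // => b _; rewrite c3sum big1 // => c _.
by apply: z; lia.
Qed.

Lemma zvE a c i j k : (zT ^+ a * vT ^+ c) i j k = [&& i == a, j == 0 & k == c]%N%:R.
Proof.
rewrite c3zn -[vT ^+ c]mulr1; case: leqP => lei; last first.
  by rewrite ltn_eqF.
rewrite c3vn; case: leqP => lek; last first.
  by rewrite (ltn_eqF lek) !andbF.
rewrite c31; congr (nat_of_bool _)%:R.
have -> : (i - a == 0)%N = (i == a) by lia.
by have -> : (k - c == 0)%N = (k == c) by lia.
Qed.

(** The maps [ha], [hc] are the identity or the predecessor, the latter for derivatives. The
    predecessor identifies 0 and 1, which is harmless because the coefficient [g] then carries a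
    factor that vanishes at 0. *)
Lemma sum_pick3 N (g : nat -> nat -> nat -> K) (ha hc : nat -> nat) i j k i' k' :
  (i' < N)%N -> (k' < N)%N -> i = ha i' -> k = hc k' ->
  (forall a b c, i = ha a -> k = hc c -> (a != i') || (c != k') -> g a b c = 0) ->
  (\sum_(a < N) \sum_(b < N) \sum_(c < N)
     cst (g a b c) * (if b == 0%N :> nat then zT ^+ ha a * vT ^+ hc c else 0)) i j k
  = if j == 0%N then g i' 0%N k' else 0.
Proof.
move=> lti ltk ei ek g0; have N0 : (0 < N)%N by apply: leq_ltn_trans lti.
have term a b c : (cst (g a b c) *
    (if b == 0%N :> nat then zT ^+ ha a * vT ^+ hc c else 0)) i j k =
    if [&& b == 0, j == 0, a == i' & c == k']%N then g a b c else 0.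
  rewrite c3cst; case: (b == 0%N) => /=; last by rewrite mulr0.
  rewrite zvE; case: (j == 0%N) => /=; last by rewrite andbF mulr0.
  have [->|na] := eqVneq a i'; have [->|nc] := eqVneq c k' => /=.
  - by rewrite ei ek !eqxx mulr1.
  - case: eqP => [e|]; rewrite ?mulr0 //; case: eqP => [e'|]; rewrite ?mulr0 //.
    by rewrite g0 ?mul0r // nc orbT.
  - case: eqP => [e|]; rewrite ?mulr0 //; case: eqP => [e'|]; rewrite ?mulr0 //.
    by rewrite g0 ?mul0r // na.
  - case: eqP => [e|]; rewrite ?mulr0 //; case: eqP => [e'|]; rewrite ?mulr0 //.
    by rewrite g0 ?mul0r // na.
have neq m (x y : 'I_m) : x != y -> (x == y :> nat) = false.
  by move=> ne; apply: contraNF ne => /eqP e; apply/eqP/val_inj.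
rewrite c3sum (bigD1 (Ordinal lti)) //= [X in _ + X]big1 => [|a /neq ne]; last first.
  by do 2!(rewrite c3sum big1 // => ? _); rewrite term ne /= !andbF.
rewrite addr0 c3sum (bigD1 (Ordinal N0)) //= [X in _ + X]big1 => [|a /neq ne]; last first.
  by (rewrite c3sum big1 // => ? _); rewrite term ne.
rewrite addr0 c3sum (bigD1 (Ordinal ltk)) //= [X in _ + X]big1 => [|a /neq ne]; last first.
  by rewrite term ne !andbF.
by rewrite addr0 term !eqxx /= andbT.
Qed.

Lemma c3M_eq A A' B i j k :
  (forall a b c, (a <= i)%N -> (b <= j)%N -> (c <= k)%N -> A a b c = A' a b c) ->
  (A * B) i j k = (A' * B) i j k.
Proof.
move=> e; rewrite !c3M; apply: eq_bigr => a _; apply: eq_bigr => b _.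
by apply: eq_bigr => c _; rewrite e // -ltnS.
Qed.

Lemma cstMn (x : K) n : cst x *+ n = cst (x *+ n).
Proof. by apply: c3P => a b c; rewrite c3Mn !cstE mulrnAl. Qed.

(* First order part of [F ^+ a * (G ^+ b * P ^+ c)] at [F = z + A], [P = zeta + B]
   when [G] is of second order. *)
Definition linT (a b c : nat) A B : T :=
  if b == 0%N then (zT ^+ a.-1 *+ a * vT ^+ c) * A + (zT ^+ a * vT ^+ c.-1 *+ c) * B
  else 0.

(** The first order parts of the monomials add up to the differential of [Psi] at w = 0; the extra 1
    makes room for the coefficient shifted by a derivative. *)
Lemma lin_sum Psi N A B i j k : (i + j + k + 1 < N)%N ->
  (\sum_(a < N) \sum_(b < N) \sum_(c < N) cst (Psi a b c) * linT a b c A B) i j k =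
  (dz (w0 Psi) * A + dv (w0 Psi) * B) i j k.
Proof.
move=> lt.
pose X := \sum_(a < N) \sum_(b < N) \sum_(c < N) cst (Psi a b c *+ a) *
   (if b == 0%N :> nat then zT ^+ a.-1 * vT ^+ c else 0).
pose Y := \sum_(a < N) \sum_(b < N) \sum_(c < N) cst (Psi a b c *+ c) *
   (if b == 0%N :> nat then zT ^+ a * vT ^+ c.-1 else 0).
have -> : \sum_(a < N) \sum_(b < N) \sum_(c < N) cst (Psi a b c) * linT a b c A B
   = X * A + Y * B.
  rewrite /X /Y !mulr_suml -big_split; apply: eq_bigr => a _.
  rewrite /= !mulr_suml -big_split; apply: eq_bigr => b _.
  rewrite /= !mulr_suml -big_split; apply: eq_bigr => c _.
  rewrite /= /linT -!cstMn; case: ifP => _; last by rewrite !mulr0 !mul0r addr0.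
  by ring.
rewrite !c3D; congr (_ + _); apply: c3M_eq => a b c la lb lc.
  rewrite /X (@sum_pick3 N (fun a b c => Psi a b c *+ a) predn id a b c a.+1 c) //.
  - by rewrite /dz /w0; case: (b == 0%N); rewrite ?mul0rn.
  - by lia.
  - by lia.
  by move=> [|a'] b' c' /= ea ec; [rewrite mulr0n | rewrite ea ec !eqxx].
rewrite /Y (@sum_pick3 N (fun a b c => Psi a b c *+ c) id predn a b c a c.+1) //.
- by rewrite /dv /w0; case: (b == 0%N); rewrite ?mul0rn.
- by lia.
- by lia.
by move=> a' b' [|c'] /= ea ec; [rewrite mulr0n | rewrite ea ec !eqxx].
Qed.

Lemma mul_expr0 (S : comNzRingType) (x y : S) b :
  x * (0 ^+ b * y) = if b == 0%N then x * y else 0.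
Proof. by case: b => [|b]; rewrite ?expr0 ?mul1r // exprS !mul0r mulr0. Qed.

Lemma comp_w0 Psi : comp Psi zT 0 vT = w0 Psi.
Proof.
apply: c3P => i j k; rewrite /comp /compN.
set N := (i + j + k).+1.
have -> : w0 Psi i j k = if j == 0%N then Psi i 0%N k else 0 by [].
rewrite -(@sum_pick3 N Psi id id i j k i k) ?ltnS //; try (by rewrite /N; lia).
  congr (_ i j k); apply: eq_bigr => a _; apply: eq_bigr => b _; apply: eq_bigr => c _.
  by rewrite mul_expr0.
Qed.

Lemma van_pow_sub n F F' a : van wdeg n (F - F') -> van wdeg n (F ^+ a - F' ^+ a).
Proof. by move=> h; rewrite subrXX; apply: vanMl => //; apply: wdeg_add. Qed.

(** The derivative is taken at the fixed base point x, not at F'. Since F and F' agree with x modulo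
    w, the error is w times the difference F - F'. *)
Lemma pow_taylor k x F F' a : van wdeg 1 (F - x) -> van wdeg 1 (F' - x) ->
  van wdeg k (F - F') ->
  van wdeg k.+1 (F ^+ a - F' ^+ a - x ^+ a.-1 *+ a * (F - F')).
Proof.
have wa := wdeg_add.
move=> hF hF' hd; elim: a => [|a IH]; first by rewrite !expr0 mulr0n mul0r subrr subr0.
have e : x * (x ^+ a.-1 *+ a) = x ^+ a *+ a.
  by case: a {IH} => [|a]; rewrite ?mulr0n ?mulr0 // mulrnAr -exprS.
have -> : F ^+ a.+1 - F' ^+ a.+1 - x ^+ a.+1.-1 *+ a.+1 * (F - F') =
    F * (F ^+ a - F' ^+ a - x ^+ a.-1 *+ a * (F - F')) +
    (F - x) * ((x ^+ a.-1 *+ a) * (F - F')) + (F - F') * (F' ^+ a - x ^+ a).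
  by rewrite !exprS [_.-1]/= mulrS -e; ring.
apply: vanD; [apply: vanD|]; first exact: vanMr.
  by rewrite -add1n; apply: vanM => //; apply: vanMr.
by rewrite -addn1; apply: vanM => //; apply: van_pow_sub.
Qed.

(** G is required to be one order closer than F and P. Then the monomials with b > 0 contribute only
    errors, and the differential involves [Psi] at w = 0 alone. *)
Lemma comp_taylor Psi k F F' G G' P P' :
  van tdeg 1 F -> van tdeg 1 F' -> van tdeg 1 P -> van tdeg 1 P' ->
  van wdeg 1 G -> van wdeg 1 G' ->
  van wdeg 1 (F - zT) -> van wdeg 1 (F' - zT) ->
  van wdeg 1 (P - vT) -> van wdeg 1 (P' - vT) ->
  van wdeg k (F - F') -> van wdeg k.+1 (G - G') -> van wdeg k (P - P') ->
  van wdeg k.+1 (comp Psi F G P - comp Psi F' G' P' -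
     (dz (w0 Psi) * (F - F') + dv (w0 Psi) * (P - P'))).
Proof.
have wa := wdeg_add.
move=> tF tF' tP tP' wG wG' zF zF' vP vP' dF dG dP.
have dmon a b c : van wdeg k.+1 (F ^+ a * (G ^+ b * P ^+ c) -
    F' ^+ a * (G' ^+ b * P' ^+ c) - linT a b c (F - F') (P - P')).
  rewrite /linT; case: eqP => [->|/eqP b0].
    rewrite !expr0 !mul1r.
    have -> : F ^+ a * P ^+ c - F' ^+ a * P' ^+ c -
       (zT ^+ a.-1 *+ a * vT ^+ c * (F - F') + zT ^+ a * vT ^+ c.-1 *+ c * (P - P')) =
       (F ^+ a - F' ^+ a - zT ^+ a.-1 *+ a * (F - F')) * P ^+ c +
       (zT ^+ a.-1 *+ a) * ((F - F') * (P ^+ c - vT ^+ c)) +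
       F' ^+ a * (P ^+ c - P' ^+ c - vT ^+ c.-1 *+ c * (P - P')) +
       (F' ^+ a - zT ^+ a) * (vT ^+ c.-1 *+ c * (P - P')).
      by ring.
    apply: vanD; [apply: vanD; [apply: vanD|]|].
    - by apply: vanMl => //; apply: pow_taylor.
    - by apply: vanMr => //; rewrite -addn1; apply: vanM => //; apply: van_pow_sub.
    - by apply: vanMr => //; apply: pow_taylor.
    - by rewrite -add1n; apply: vanM => //; [apply: van_pow_sub | apply: vanMr].
  rewrite subr0.
  have -> : F ^+ a * (G ^+ b * P ^+ c) - F' ^+ a * (G' ^+ b * P' ^+ c) =
    (F ^+ a * P ^+ c) * (G ^+ b - G' ^+ b) +
    ((F ^+ a - F' ^+ a) * P ^+ c + F' ^+ a * (P ^+ c - P' ^+ c)) * G' ^+ b by ring.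
  apply: vanD; first by apply: vanMr => //; apply: van_pow_sub.
  rewrite -addn1; apply: vanM => //.
    by apply: vanD; [apply: vanMl|apply: vanMr] => //; apply: van_pow_sub.
  by apply: (vanW (n := b)); [rewrite lt0n | apply: vanX].
move=> i j l lt.
have tG X : van wdeg 1 X -> van tdeg 1 X.
  by move=> h a b c; rewrite /tdeg ltnS leqn0 => e0; apply: h; rewrite /wdeg; lia.
(* A common cutoff for the substitutions and for [lin_sum], which needs one more term than they
   do. *)
pose N := (i + j + l + 2)%N.
rewrite !c3B -(@lin_sum _ N); last by rewrite /N; lia.
rewrite -!(@compNE _ _ _ _ N) //; try (by apply: tG); try by rewrite /N; lia.
rewrite /compN -!c3B -!sumrB; move: i j l lt {N}(N) => i j l lt N.
rewrite c3sum big1 // => a _; rewrite -!sumrB c3sum big1 // => b _.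
rewrite -!sumrB c3sum big1 // => c _.
by rewrite -!mulrBr c3cst dmon ?mulr0.
Qed.

Lemma comp_wcongr Psi F G P : van wdeg 1 G ->
  van wdeg 1 (F - zT) -> van wdeg 1 (P - vT) ->
  van tdeg 1 F -> van tdeg 1 P ->
  van wdeg 1 (comp Psi F G P - w0 Psi).
Proof.
move=> wG zF vP tF tP; have wa := wdeg_add.
have t0 : van tdeg 1 (zT : T) /\ van tdeg 1 (vT : T).
  by split=> a b c; rewrite /tdeg ltnS leqn0 !addn_eq0 => /andP[/andP[/eqP-> /eqP->] /eqP->];
    rewrite ?zTE ?vTE.
have self (X : T) : van wdeg 1 (X - X) by move=> a b c _; rewrite c3B subrr.
have h : van wdeg 1 (comp Psi F G P - comp Psi zT 0 vT -
    (dz (w0 Psi) * (F - zT) + dv (w0 Psi) * (P - vT))).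
  apply: comp_taylor => //; first [exact: t0.1 | exact: t0.2 | exact: self |
    by move=> a b c lt; rewrite c3B subr0 wG].
rewrite comp_w0 in h.
rewrite -[X in van _ _ X](subrK (dz (w0 Psi) * (F - zT) + dv (w0 Psi) * (P - vT))).
by apply: vanD => //; apply: vanD; apply: vanMr.
Qed.

(* Weight [< 2] singles out the terms free of w and of degree < 2 in zeta. *)
Definition vwdeg (a b c : nat) : nat := (2 * b + c)%N.
Lemma vwdeg_add : additive_wt vwdeg. Proof. by move=> *; rewrite /vwdeg; lia. Qed.

Lemma comp_low Psi F G P :
  (forall a b c, (c < 2)%N -> Psi a b c = 0) -> van vwdeg 2 G -> van vwdeg 1 P ->
  van vwdeg 2 (comp Psi F G P).
Proof.
move=> Psi0 hG hP i j k lt.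
have wa := vwdeg_add.
rewrite /comp /compN c3sum big1 // => a _; rewrite c3sum big1 // => b _.
rewrite c3sum big1 // => c _; rewrite c3cst.
case: (ltnP c 2) => lec; first by rewrite Psi0 ?mul0r.
rewrite (vanMr wa (n := 2)) ?mulr0 //; apply: vanMr => //.
by apply: (vanW lec); apply: vanX.
Qed.

End Comp.

(** * The linearised equations *)

Lemma mul_mx4 (K : comNzRingType) (A : 'M[K]_4) (x : 'cV[K]_4) i : (A *m x) i 0 =
  A i 0 * x 0 0 + A i 1 * x 1 0 + A i 2%:R * x 2%:R 0 + A i 3%:R * x 3%:R 0.
Proof.
rewrite mxE !big_ord_recl big_ord0 addr0 !addrA.
by congr (_ + _ + _ + _); congr (A i _ * x _ 0); apply/val_inj.
Qed.

Section System.
Variable K : numFieldType.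
Notation T := (ser (ser (ser K))).
Notation zT := (zT K).
Notation wT := (wT K).
Notation vT := (vT K).
Implicit Types A B f h p m S : T.

Definition zeta_free A := forall a b c, (0 < c)%N -> A a b c = 0.
Definition slice n A : T := fun a b c => if c == 0%N then A a b n else 0.

Lemma slice_free n A : zeta_free (slice n A).
Proof. by move=> a b [|c]. Qed.
Lemma zfD A B : zeta_free A -> zeta_free B -> zeta_free (A + B).
Proof. by move=> hA hB a b c c0; rewrite c3D hA ?hB ?addr0. Qed.
Lemma zfN A : zeta_free A -> zeta_free (- A).
Proof. by move=> hA a b c c0; rewrite c3N hA ?oppr0. Qed.
Lemma zfMn A n : zeta_free A -> zeta_free (A *+ n).
Proof. by move=> hA a b c c0; rewrite c3Mn hA ?mul0rn. Qed.
Lemma zfM A B : zeta_free A -> zeta_free B -> zeta_free (A * B).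
Proof.
move=> hA hB a b c c0; rewrite c3M big1 // => i _; rewrite big1 // => j _.
rewrite big1 // => k _; case: (posnP k) => [->|k0]; last by rewrite hA ?mul0r.
by rewrite hB ?mulr0 ?subn0.
Qed.
Lemma zf_dz A : zeta_free A -> zeta_free (dz A).
Proof. by move=> hA a b c c0; rewrite /dz hA ?mul0rn. Qed.
Lemma zf_Dw A : zeta_free A -> zeta_free (Dw A).
Proof. by move=> hA a b c c0; rewrite /Dw hA ?mul0rn. Qed.
Lemma dv_zf A : zeta_free A -> dv A = 0.
Proof. by move=> hA; apply: c3P => a b c; rewrite /dv hA ?mul0rn. Qed.
Lemma dv_vT A : dv (vT * A) = A + vT * dv A.
Proof.
by apply: c3P => a b [|c]; rewrite c3D !c3v /dv c3v ?mulr1n ?addr0 // mulrS.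
Qed.
Lemma dz_vT A : dz (vT * A) = vT * dz A.
Proof. by apply: c3P => a b [|c]; rewrite c3v /dz c3v ?mul0rn. Qed.
Lemma Dw_vT A : Dw (vT * A) = vT * Dw A.
Proof. by apply: c3P => a b [|c]; rewrite c3v /Dw c3v ?mul0rn. Qed.
Lemma dz_Dw A : dz (Dw A) = Dw (dz A).
Proof. by apply: c3P => a b c; rewrite /dz /Dw mulrnAC. Qed.

Variable E : T.
Hypothesis E_low : forall a b c, (c < 2)%N -> E a b c = 0.

(* [Psi] is d zeta / dz along the solutions of E. *)
Definition Psi : T := E - vT * vT.
Definition mu : T := w0 Psi.
Definition mu2 := slice 2 mu.
Definition mu3 := slice 3 mu.
Definition mu4 := slice 4 mu.

Lemma Psi_low a b c : (c < 2)%N -> Psi a b c = 0.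
Proof.
by move=> c2; rewrite /Psi c3B E_low // c3v; case: c c2 => [|[|]] // _;
  rewrite ?vTE ?andbF subrr.
Qed.

(** The zeta^0 to zeta^3 parts of the linear operator see [mu] up to zeta^4 only, because [dv]
    lowers the degree by one. This is why the resonance matrix involves Phi_4 but no higher
    coefficient. *)
Lemma mu_expand : exists r,
  mu = vT ^+ 2 * mu2 + vT ^+ 3 * mu3 + vT ^+ 4 * mu4 + vT ^+ 5 * r.
Proof.
exists (fun a b c => mu a b (c + 5)%N); apply: c3P => a b c.
rewrite !c3D !c3vn /mu2 /mu3 /mu4 /slice.
case: c => [|[|[|[|[|c]]]]] //=; rewrite ?addr0 ?add0r //.
- by rewrite /mu /w0 Psi_low // if_same.
- by rewrite /mu /w0 Psi_low // if_same.
- by congr (mu a b _); lia.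
Qed.

Lemma dv_vTn n A : dv (vT ^+ n.+1 * A) = vT ^+ n *+ n.+1 * A + vT ^+ n.+1 * dv A.
Proof.
elim: n => [|n IH]; first by rewrite expr1 expr0 mul1r dv_vT.
rewrite exprS -mulrA dv_vT IH !exprS !mulrS; move: (vT ^+ n) => X; ring.
Qed.
Lemma dz_vTn n A : dz (vT ^+ n * A) = vT ^+ n * dz A.
Proof.
by elim: n => [|n IH]; rewrite ?expr0 ?mul1r // exprS -!mulrA dz_vT IH.
Qed.

(* [ell f h] is the part of [P - zeta] linear in [(f, h)]; [dl f] is
   [X (z + f) - 1]; [lin_p p - lin_f f] is the linear part of the equation
   [X P = X F * Psi (F, G, P)], apart from [m]. *)
Definition ell f h : T := dz h + vT * (Dw h - dz f - vT * Dw f).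
Definition dl f : T := dz f + vT * Dw f.
Definition lin_p p : T := mu * dv p + dz p + vT * Dw p - p * dv mu.
Definition lin_f f : T := dl f * mu + f * dz mu.

(** By [lin_expand], [lin0] to [lin3] are the coefficients of zeta^0 to zeta^3 in
    [lin_p (ell f h) - lin_f f]. *)
Definition lin0 h : T := dz (dz h).
Definition lin1 f h : T := Dw (dz h) *+ 2 - dz (dz f) - mu2 * dz h *+ 2.
Definition lin2 f h : T := Dw (Dw h) - Dw (dz f) *+ 2 - mu3 * dz h *+ 3
  - mu2 * Dw h - dz mu2 * f.
Definition lin3 f h : T := - Dw (Dw f) - mu4 * dz h *+ 4 - mu3 * Dw h *+ 2
  + mu3 * dz f - mu2 * Dw f - dz mu3 * f.

Lemma lin_expand f h : zeta_free f -> zeta_free h -> exists r,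
  lin_p (ell f h) - lin_f f =
    lin0 h + vT * lin1 f h + vT ^+ 2 * lin2 f h + vT ^+ 3 * lin3 f h + vT ^+ 4 * r.
Proof.
move=> zf zh; have [rho emu] := mu_expand.
have dvm n : dv (slice n mu) = 0 by apply/dv_zf/slice_free.
have edv : dv mu = vT * mu2 *+ 2 + vT ^+ 2 * mu3 *+ 3 + vT ^+ 3 * mu4 *+ 4
    + vT ^+ 4 * (rho *+ 5 + vT * dv rho).
  by rewrite emu !dvD !dv_vTn !dvm; ring.
have edz : dz mu = vT ^+ 2 * dz mu2 + vT ^+ 3 * dz mu3 + vT ^+ 4 * (dz mu4 + vT * dz rho).
  by rewrite emu !dzD !dz_vTn; ring.
have el : dv (ell f h) = Dw h - dz f - vT * Dw f *+ 2.
  rewrite /ell dvD dv_vT !dvD !dvN dv_vT (dv_zf (zf_dz zh)) (dv_zf (zf_dz zf)).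
  by rewrite (dv_zf (zf_Dw zh)) (dv_zf (zf_Dw zf)); ring.
have ez : dz (ell f h) = dz (dz h) + vT * (Dw (dz h) - dz (dz f) - vT * Dw (dz f)).
  by rewrite /ell !dzD dz_vT !dzD !dzN dz_vT !dz_Dw.
have eD : Dw (ell f h) = Dw (dz h) + vT * (Dw (Dw h) - Dw (dz f) - vT * Dw (Dw f)).
  by rewrite /ell !DwD Dw_vT !DwD !DwN Dw_vT.
pose tau := rho *+ 5 + vT * dv rho; pose kap := dz mu4 + vT * dz rho.
(* The witness collects what remains after the first four coefficients and is divided by zeta^4;
   only its existence is used. *)
exists ((mu4 + vT * rho) * (Dw h - dz f - vT * Dw f *+ 2) - mu3 * Dw f *+ 2
  - dz h * tau - (Dw h - dz f) * (mu4 *+ 4 + vT * tau)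
  + Dw f * (mu3 *+ 3 + vT * mu4 *+ 4 + vT ^+ 2 * tau)
  - dz f * (mu4 + vT * rho) - Dw f * (mu3 + vT * mu4 + vT ^+ 2 * rho) - f * kap).
rewrite /lin_p /lin_f el ez eD edv edz -/tau -/kap emu /ell /dl /lin0 /lin1 /lin2 /lin3.
ring.
Qed.

Lemma zf_lin0 h : zeta_free h -> zeta_free (lin0 h).
Proof. by move=> zh; do 2!apply: zf_dz. Qed.
Lemma zf_lin1 f h : zeta_free f -> zeta_free h -> zeta_free (lin1 f h).
Proof.
move=> zf zh; have s2 := slice_free 2 mu.
by do ![apply: zfD | apply: zfN | apply: zfMn | apply: zfM | apply: zf_dz | apply: zf_Dw].
Qed.
Lemma zf_lin2 f h : zeta_free f -> zeta_free h -> zeta_free (lin2 f h).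
Proof.
move=> zf zh; have s2 := slice_free 2 mu; have s3 := slice_free 3 mu.
by do ![apply: zfD | apply: zfN | apply: zfMn | apply: zfM | apply: zf_dz | apply: zf_Dw].
Qed.
Lemma zf_lin3 f h : zeta_free f -> zeta_free h -> zeta_free (lin3 f h).
Proof.
move=> zf zh; have s2 := slice_free 2 mu; have s3 := slice_free 3 mu.
have s4 := slice_free 4 mu.
by do ![apply: zfD | apply: zfN | apply: zfMn | apply: zfM | apply: zf_dz | apply: zf_Dw].
Qed.

Lemma lin_coef f h a b : zeta_free f -> zeta_free h ->
  let X := lin_p (ell f h) - lin_f f in
  [/\ X a b 0 = lin0 h a b 0, X a b 1 = lin1 f h a b 0,
      X a b 2 = lin2 f h a b 0 & X a b 3 = lin3 f h a b 0]%N.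
Proof.
move=> zf zh /=; have [r ->] := lin_expand zf zh.
have z0 c : lin0 h a b c.+1 = 0 by apply: zf_lin0.
have z1 c : lin1 f h a b c.+1 = 0 by apply: zf_lin1.
have z2 c : lin2 f h a b c.+1 = 0 by apply: zf_lin2.
have z3 c : lin3 f h a b c.+1 = 0 by apply: zf_lin3.
by split; rewrite !c3D !c3vn c3v /= ?z0 ?z1 ?z2 ?z3 ?addr0 ?add0r ?subnn.
Qed.

(** Since [mu] is free of w, multiplication by its slices leaves each power w^b alone. Hence the
    Cauchy data satisfy one finite system for each power of w. *)
Lemma muM0 n A b : (slice n mu * A) 0%N b 0%N = mu 0%N 0%N n * A 0%N b 0%N.
Proof.
rewrite c3M big_ord1 big_ord_recl big_ord1 big1 => [|j _]; first by rewrite addr0 !subn0.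
by rewrite big_ord1 /slice /mu /w0 mul0r.
Qed.
Lemma muM1 n A b : (slice n mu * A) 1%N b 0%N =
  mu 0%N 0%N n * A 1%N b 0%N + mu 1%N 0%N n * A 0%N b 0%N.
Proof.
rewrite c3M big_ord_recl big_ord1; congr (_ + _).
  rewrite big_ord_recl big_ord1 big1 => [|j _]; first by rewrite addr0 !subn0.
  by rewrite big_ord1 /slice /mu /w0 mul0r.
rewrite big_ord_recl big_ord1 big1 => [|j _]; first by rewrite addr0 !subn0.
by rewrite big_ord1 /slice /mu /w0 mul0r.
Qed.
Lemma dmuM0 n A b : (dz (slice n mu) * A) 0%N b 0%N = mu 1%N 0%N n * A 0%N b 0%N.
Proof.
rewrite c3M big_ord1 big_ord_recl big_ord1 big1 => [|j _]; first by rewrite addr0 !subn0.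
by rewrite big_ord1 /dz /slice /mu /w0 mul0rn mul0r.
Qed.
Lemma dmuM1 n A b : (dz (slice n mu) * A) 1%N b 0%N =
  mu 1%N 0%N n * A 1%N b 0%N + mu 2%N 0%N n * A 0%N b 0%N *+ 2.
Proof.
rewrite c3M big_ord_recl big_ord1; congr (_ + _).
  rewrite big_ord_recl big_ord1 big1 => [|j _]; first by rewrite addr0 !subn0.
  by rewrite big_ord1 /dz /slice /mu /w0 mul0rn mul0r.
rewrite big_ord_recl big_ord1 big1 => [|j _]; first by rewrite addr0 !subn0 /dz mulrnAl.
by rewrite big_ord1 /dz /slice /mu /w0 mul0rn mul0r.
Qed.

(* [res_matrix] over an arbitrary numeric field. *)
Definition Lm (k : nat) : 'M[K]_4 :=
  let a0 := E 0%N 0%N 2%N in let a1 := E 1%N 0%N 2%N in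
  let a2 := E 2%N 0%N 2%N in
  let b0 := E 0%N 0%N 3%N in let b1 := E 1%N 0%N 3%N in
  let b2 := E 2%N 0%N 3%N in
  let c0 := E 0%N 0%N 4%N in let c1 := E 1%N 0%N 4%N in
  let K : K := k%:R in
  let rows : seq (seq _) :=
    [:: [:: K * (K + 1 - a0); - (3 * b0); - a1; - (2 * K)];
        [:: a1 * K; 3 * K * (K + 1 - a0) + 3 * b1; 2 * a2; a1];
        [:: 2 * K * b0; 4 * c0; K * (K - 1 + a0) + b1; - b0];
        [:: 2 * K * b1; 2 * b0 * (a0 - 1) + 4 * c1; K * a1 + 2 * b2;
            K * (K - 1 + a0)]] in
  \matrix_(i < 4, j < 4) nth 0 (nth [::] rows i) j.

(* The terms in [S 0 k 0] and [S 0 k 1] come from eliminating [h_zz] and [f_zz],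
   which occur in the z-derivatives of the zeta^2 and zeta^3 equations. *)
Definition cauchy_rhs S (k : nat) : 'cV[K]_4 :=
  let b0 := E 0%N 0%N 3%N in let c0 := E 0%N 0%N 4%N in
  \col_(i < 4) nth 0 [:: S 0%N k 2%N;
    - S 1%N k 2%N - 3 * b0 * S 0%N k 0%N + 2 * k%:R * S 0%N k 1%N;
    - S 0%N k 3%N;
    - S 1%N k 3%N - 4 * c0 * S 0%N k 0%N - b0 * S 0%N k 1%N] i.

Definition cauchy f h (k : nat) : 'cV[K]_4 :=
  \col_(i < 4) nth 0 [:: h 0%N k 0%N; h 1%N k 0%N; f 0%N k 0%N; f 1%N k 0%N] i.

Lemma muE a c : mu a 0%N c = E a 0%N c - [&& a == 0 & c == 2]%N%:R.
Proof.
by rewrite /mu /w0 /Psi c3B c3v; case: c => [|c]; rewrite ?vTE ?andbF // eqSS.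
Qed.

(** The first two equations give h_zz and f_zz at z = 0. After their elimination the z^0 and z^1
    coefficients of [lin2] and [lin3] are the rows of the matrix, the last three with opposite
    sign. *)
Lemma cauchy_rows f h S k : zeta_free f -> zeta_free h ->
  let X := lin_p (ell f h) - lin_f f in
  X 0%N k 0%N = S 0%N k 0%N -> X 0%N k 1%N = S 0%N k 1%N ->
  [/\ (Lm k *m cauchy f h k) 0 0 - cauchy_rhs S k 0 0 = X 0%N k 2%N - S 0%N k 2%N,
      (Lm k *m cauchy f h k) 1 0 - cauchy_rhs S k 1 0 = - (X 1%N k 2%N - S 1%N k 2%N),
      (Lm k *m cauchy f h k) 2%:R 0 - cauchy_rhs S k 2%:R 0 = - (X 0%N k 3%N - S 0%N k 3%N) &
      (Lm k *m cauchy f h k) 3%:R 0 - cauchy_rhs S k 3%:R 0 = - (X 1%N k 3%N - S 1%N k 3%N)].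
Proof.
move=> zf zh X.
have [e00 e01 e02 e03] := lin_coef 0 k zf zh.
have [_ _ e12 e13] := lin_coef 1 k zf zh.
rewrite /X e00 e01 e02 e03 e12 e13 !mul_mx4 /lin0 /lin1 /lin2 /lin3.
rewrite !(c3D, c3N, c3Mn, muM0, muM1, dmuM0, dmuM1).
rewrite !muE /dz /Dw /= => h2 h3.
have eh : h 2%N k 0%N *+ 2 = S 0%N k 0%N by rewrite -h2; ring.
by rewrite !mxE /= -eh -h3; split; ring.
Qed.

Lemma cauchy_rhsP f h S k : zeta_free f -> zeta_free h ->
  let X := lin_p (ell f h) - lin_f f in
  X 0%N k 0%N = S 0%N k 0%N -> X 0%N k 1%N = S 0%N k 1%N ->
  Lm k *m cauchy f h k = cauchy_rhs S k <->
  [/\ X 0 k 2 = S 0 k 2, X 1 k 2 = S 1 k 2, X 0 k 3 = S 0 k 3 & X 1 k 3 = S 1 k 3]%N.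
Proof.
move=> zf zh X e0 e1; have [r0 r1 r2 r3] := cauchy_rows zf zh e0 e1.
split=> [e|[e2 e3 e4 e5]].
  move: r0 r1 r2 r3; rewrite e !subrr => r0 r1 r2 r3; split; apply/eqP.
  - by rewrite -subr_eq0 -r0.
  - by rewrite -subr_eq0 -oppr_eq0 -r1.
  - by rewrite -subr_eq0 -oppr_eq0 -r2.
  - by rewrite -subr_eq0 -oppr_eq0 -r3.
move: r0 r1 r2 r3; rewrite -/X e2 e3 e4 e5 !subrr oppr0 => r0 r1 r2 r3.
apply/matrixP => i j; rewrite ord1; apply/eqP; rewrite -subr_eq0; apply/eqP.
case: i => -[|[|[|[|//]]]] lti.
- by have -> : Ordinal lti = 0 by apply/val_inj.
- by have -> : Ordinal lti = 1 by apply/val_inj.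
- by have -> : Ordinal lti = 2%:R by apply/val_inj.
- by have -> : Ordinal lti = 3%:R by apply/val_inj.
Qed.

Hypothesis Lm_unit : forall k, (0 < k)%N -> Lm k \in unitmx.

(* The solution of [f_zz = g] with [f = x0] and [f_z = x1] at [z = 0], without its w^0 part. *)
Definition integ (x0 x1 : nat -> K) (g : T) : T := fun a b c =>
  if (c != 0) || (b == 0)%N then 0 else
  match a with
  | 0%N => x0 b
  | 1%N => x1 b
  | i.+2 => g i b 0%N / (i.+1 * i.+2)%:R
  end.

Lemma zf_integ x0 x1 g : zeta_free (integ x0 x1 g).
Proof. by move=> a b [|c]. Qed.
Lemma van_integ x0 x1 g : van wdeg 1 (integ x0 x1 g).
Proof. by move=> a [|b] c // _; rewrite /integ orbT. Qed.

Lemma mulrn_divS (x : K) i : x / (i.+1 * i.+2)%:R *+ i.+2 *+ i.+1 = x.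
Proof. by rewrite -mulrnA [(i.+2 * _)%N]mulnC -[LHS]mulr_natr divfK // pnatr_eq0. Qed.

Lemma dz2_integ x0 x1 g a b : (0 < b)%N -> dz (dz (integ x0 x1 g)) a b 0%N = g a b 0%N.
Proof. by case: b => // b _; rewrite /dz /integ /= mulrn_divS. Qed.

Lemma integ_uniq x0 x1 g f : zeta_free f -> van wdeg 1 f ->
  (forall b, (0 < b)%N -> f 0%N b 0%N = x0 b) ->
  (forall b, (0 < b)%N -> f 1%N b 0%N = x1 b) ->
  (forall a b, (0 < b)%N -> dz (dz f) a b 0%N = g a b 0%N) -> f = integ x0 x1 g.
Proof.
move=> zf v e0 e1 e2; apply: c3P => a [|b] [|c]; rewrite /integ /=; try exact: zf; try exact: v.
case: a => [|[|a]]; rewrite ?e0 ?e1 // -e2 // /dz.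
by rewrite -mulrnA [(a.+2 * _)%N]mulnC -[X in X / _]mulr_natr mulfK // pnatr_eq0.
Qed.

Definition sol_cauchy S k : 'cV[K]_4 := invmx (Lm k) *m cauchy_rhs S k.
(** The order matters: h_zz is given by S alone, while f_zz also involves h_z. *)
Definition sol_h S : T := integ (fun b => sol_cauchy S b 0 0) (fun b => sol_cauchy S b 1 0) S.
Definition sol_fzz S : T := Dw (dz (sol_h S)) *+ 2 - mu2 * dz (sol_h S) *+ 2 - slice 1 S.
Definition sol_f S : T :=
  integ (fun b => sol_cauchy S b 2%:R 0) (fun b => sol_cauchy S b 3%:R 0) (sol_fzz S).

(** This transcribes [in_D1] for N = zeta^2 + [mu] + m. Asking it for b = 0 as well is harmless,
    since m is divisible by w. *)
Definition normal_low m := (forall a b c, (c < 2)%N -> m a b c = 0) /\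
  (forall a b c, (a < 2)%N -> (2 <= c < 4)%N -> m a b c = 0).

Lemma cauchy_sol S k : (0 < k)%N -> cauchy (sol_f S) (sol_h S) k = sol_cauchy S k.
Proof.
case: k => // k _; apply/matrixP => i j; rewrite ord1 mxE.
by case: i => -[|[|[|[|//]]]] lti /=; rewrite /sol_f /sol_h /integ /=;
   congr (sol_cauchy S k.+1 _ 0); apply/val_inj.
Qed.

Lemma van_lin_p n p : van wdeg n p -> van wdeg n (lin_p p).
Proof.
have wa := wdeg_add; move=> v; apply: vanB; last exact: vanMl.
apply: vanD; last by apply: vanMr => //; apply: van_Dw.
by apply: vanD; [apply: vanMr => //; apply: van_dv | apply: van_dz].
Qed.
Lemma van_dl n f : van wdeg n f -> van wdeg n (dl f).
Proof.
have wa := wdeg_add; move=> v; apply: vanD; first exact: van_dz.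
by apply: vanMr => //; apply: van_Dw.
Qed.
Lemma van_lin_f n f : van wdeg n f -> van wdeg n (lin_f f).
Proof.
by have wa := wdeg_add; move=> v; apply: vanD; apply: vanMl => //; apply: van_dl.
Qed.
Lemma van_ell n f h : van wdeg n f -> van wdeg n h -> van wdeg n (ell f h).
Proof.
have wa := wdeg_add; move=> vf vh; apply: vanD; first exact: van_dz.
apply: vanMr => //; apply: vanB; last by apply: vanMr => //; apply: van_Dw.
by apply: vanB; [apply: van_Dw | apply: van_dz].
Qed.

(** The difference is the future m, a slack variable that absorbs every coefficient except those of
    zeta^0, zeta^1 and those of zeta^2, zeta^3 at z^0, z^1. The former fix h_zz and f_zz, the latter
    the Cauchy data. *)
Lemma linear_solP f h S : van wdeg 1 S -> van wdeg 1 f -> van wdeg 1 h ->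
  zeta_free f -> zeta_free h ->
  normal_low (S - (lin_p (ell f h) - lin_f f)) <-> f = sol_f S /\ h = sol_h S.
Proof.
move=> vS vf vh zf zh; set X := lin_p _ - _.
have vX : van wdeg 1 X by apply: vanB; [apply/van_lin_p/van_ell | apply: van_lin_f].
have c0 a b : X a b 0%N = lin0 h a b 0%N by case: (lin_coef a b zf zh).
have c1 a b : X a b 1%N = lin1 f h a b 0%N by case: (lin_coef a b zf zh).
have hB1 : lin1 f h = Dw (dz h) *+ 2 - mu2 * dz h *+ 2 - dz (dz f) by rewrite /lin1; ring.
split=> [[low0 low1]|[ef eh]].
  have eX a b c : (c < 2)%N -> X a b c = S a b c.
    by move=> /low0-/(_ a b)/eqP; rewrite c3B subr_eq0 => /eqP.
  have eX' a b c : (a < 2)%N -> (2 <= c < 4)%N -> X a b c = S a b c.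
    by move=> la lc; have /eqP := low1 a b c la lc; rewrite c3B subr_eq0 => /eqP.
  have cauchyE k : (0 < k)%N -> cauchy f h k = sol_cauchy S k.
    move=> k0; have /(cauchy_rhsP zf zh (eX 0%N k 0%N isT)) :
      X 0%N k 1%N = S 0%N k 1%N by apply: eX.
    rewrite -/X => -[_ /(_ _) e]; rewrite /sol_cauchy -e ?mulKmx ?Lm_unit //.
    by split; apply: eX'.
  have eh : h = sol_h S.
    apply: integ_uniq => // [b b0|b b0|a b b0].
    - by rewrite -cauchyE // mxE.
    - by rewrite -cauchyE // mxE.
    - by rewrite -eX // c0.
  split=> //; apply: integ_uniq => // [b b0|b b0|a b b0].
  - by rewrite -cauchyE // mxE.
  - by rewrite -cauchyE // mxE.
  - rewrite /sol_fzz c3B [slice _ _ _ _ _]/slice /= -eX // c1 hB1 [in RHS]c3B -eh.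
    by rewrite opprB addrC subrK.
have eX0 a b c : (c < 2)%N -> X a b c = S a b c.
  move=> lc; case: (posnP b) => [->|b0]; first by rewrite vX // vS.
  case: c lc => [|[|//]] _; first by rewrite c0 eh /lin0 dz2_integ.
  by rewrite c1 hB1 c3B ef dz2_integ // /sol_fzz -eh c3B /slice /= opprB addrC subrK.
split=> [a b c lc|a b c la lc]; first by rewrite c3B eX0 ?subrr.
apply/eqP; rewrite c3B subr_eq0 eq_sym; apply/eqP.
case: (posnP b) => [->|b0]; first by rewrite vX // vS.
have [|e2 e2' e3 e3'] := (cauchy_rhsP zf zh (eX0 0%N b 0%N isT) (eX0 0%N b 1%N isT)).1.
  by rewrite ef eh cauchy_sol // /sol_cauchy mulKVmx ?Lm_unit.
by case: a la => [|[|//]] _; case: c lc => [|[|[|[|//]]]].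
Qed.

(** * The fixed point map *)

(* The unknowns [F - z], [G / w - 1], [P - zeta] and [N - zeta^2 - mu]. *)
Record quad := Quad { qf : T; qh : T; qp : T; qm : T }.
Implicit Types y : quad.

Definition qcomp y : T := comp Psi (zT + qf y) (wT * (1 + qh y)) (vT + qp y).
(** Quadratic part of the equation [X F * G * P = X G] after division by w; see [solution_alg]. *)
Definition rem_p y : T :=
  - (qh y * dl (qf y) * vT + (qh y + dl (qf y) + qh y * dl (qf y)) * qp y).
(** What is left of [X P = X F * Psi (F, G, P)] after removal of its linear part; see [eq2_alg]. *)
Definition rem_m y : T := (qcomp y - mu - dz mu * qf y - dv mu * qp y)
  + dl (qf y) * (qcomp y - mu) - qm y * dv (qp y).
(** Substituting p = [ell f h + rem_p] into the second equation moves [lin_p (rem_p y)] to the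
    right, so that only f, h and m stay on the left. *)
Definition rem_tot y : T := rem_m y - lin_p (rem_p y).
Definition step y : quad :=
  let f := sol_f (rem_tot y) in let h := sol_h (rem_tot y) in
  Quad f h (ell f h + rem_p y) (rem_tot y - (lin_p (ell f h) - lin_f f)).

Definition vanq k y := [/\ van wdeg k (qf y), van wdeg k (qh y),
  van wdeg k (qp y) & van wdeg k (qm y)].
Definition close k y y' := [/\ van wdeg k (qf y - qf y'), van wdeg k (qh y - qh y'),
  van wdeg k (qp y - qp y') & van wdeg k (qm y - qm y')].

Definition solution y := [/\ vanq 1 y, zeta_free (qf y) /\ zeta_free (qh y),
  qp y = ell (qf y) (qh y) + rem_p y,
  qm y + lin_p (qp y) - lin_f (qf y) = rem_m y & normal_low (qm y)].

Lemma lin_pD A B : lin_p (A + B) = lin_p A + lin_p B.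
Proof. by rewrite /lin_p dvD dzD DwD; ring. Qed.
Lemma lin_pN A : lin_p (- A) = - lin_p A.
Proof. by rewrite /lin_p dvN dzN DwN; ring. Qed.
Lemma dlB f f' : dl (f - f') = dl f - dl f'.
Proof. by rewrite /dl !dzD !DwD dzN DwN; ring. Qed.
Lemma ellB f f' h h' : ell (f - f') (h - h') = ell f h - ell f' h'.
Proof. by rewrite /ell !dzD !DwD !dzN !DwN; ring. Qed.
Lemma lin_fB f f' : lin_f (f - f') = lin_f f - lin_f f'.
Proof. by rewrite /lin_f dlB; ring. Qed.

Lemma van_tdeg A : van wdeg 1 A -> van tdeg 1 A.
Proof.
by move=> v a b c; rewrite /tdeg ltnS leqn0 => e; apply: v; rewrite /wdeg; lia.
Qed.
Lemma tdeg_zT : van tdeg 1 zT.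
Proof.
by move=> a b c; rewrite /tdeg ltnS leqn0 !addn_eq0 => /andP[/andP[/eqP-> /eqP->] /eqP->];
  rewrite zTE.
Qed.
Lemma tdeg_vT : van tdeg 1 vT.
Proof.
by move=> a b c; rewrite /tdeg ltnS leqn0 !addn_eq0 => /andP[/andP[/eqP-> /eqP->] /eqP->];
  rewrite vTE.
Qed.
Lemma wdeg_wT : van wdeg 1 wT.
Proof. by move=> a [|b] c // _; rewrite wTE andbF. Qed.

Lemma addKl (x y : T) : x + y - x = y. Proof. by ring. Qed.

Lemma van_qcomp y : vanq 1 y -> van wdeg 1 (qcomp y - mu).
Proof.
case=> vf vh vp vm; have wa := wdeg_add; apply: comp_wcongr.
- by apply: vanMl => //; apply: wdeg_wT.
- by rewrite addKl.
- by rewrite addKl.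
- by apply: vanD; [apply: tdeg_zT | apply: van_tdeg].
- by apply: vanD; [apply: tdeg_vT | apply: van_tdeg].
Qed.

(** The explicit factor w in G provides the additional order that [comp_taylor] demands of it. *)
Lemma close_qcomp k y y' : vanq 1 y -> vanq 1 y' -> close k y y' ->
  van wdeg k.+1 (qcomp y - qcomp y' -
    (dz mu * (qf y - qf y') + dv mu * (qp y - qp y'))).
Proof.
case=> vf vh vp vm [vf' vh' vp' vm'] [cf ch cp cm]; have wa := wdeg_add.
have ez : (zT + qf y) - (zT + qf y') = qf y - qf y' by ring.
have ev : (vT + qp y) - (vT + qp y') = qp y - qp y' by ring.
have := @comp_taylor _ Psi k (zT + qf y) (zT + qf y') (wT * (1 + qh y))
  (wT * (1 + qh y')) (vT + qp y) (vT + qp y').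
rewrite ez ev; apply; rewrite ?addKl //.
- by apply: vanD; [apply: tdeg_zT | apply: van_tdeg].
- by apply: vanD; [apply: tdeg_zT | apply: van_tdeg].
- by apply: vanD; [apply: tdeg_vT | apply: van_tdeg].
- by apply: vanD; [apply: tdeg_vT | apply: van_tdeg].
- by apply: vanMl => //; apply: wdeg_wT.
- by apply: vanMl => //; apply: wdeg_wT.
have -> : wT * (1 + qh y) - wT * (1 + qh y') = wT * (qh y - qh y') by ring.
by rewrite -add1n; apply: vanM => //; apply: wdeg_wT.
Qed.

Lemma close_rem_p k y y' : vanq 1 y -> vanq 1 y' -> close k y y' ->
  van wdeg k.+1 (rem_p y - rem_p y').
Proof.
case=> vf vh vp vm [vf' vh' vp' vm'] [cf ch cp cm]; have wa := wdeg_add.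
have vd := van_dl vf; have vd' := van_dl vf'.
have cd : van wdeg k (dl (qf y) - dl (qf y')) by rewrite -dlB; apply: van_dl.
have chd : van wdeg k.+1 (qh y * dl (qf y) - qh y' * dl (qf y')) by apply: van_prod_sub.
have -> : rem_p y - rem_p y' = - ((qh y * dl (qf y) - qh y' * dl (qf y')) * vT +
   ((qh y + dl (qf y) + qh y * dl (qf y)) * qp y -
    (qh y' + dl (qf y') + qh y' * dl (qf y')) * qp y')) by rewrite /rem_p; ring.
apply: vanN; apply: vanD; first exact: vanMl.
apply: van_prod_sub => //.
  by apply: vanD; [apply: vanD | apply: vanMl].
have -> : qh y + dl (qf y) + qh y * dl (qf y) - (qh y' + dl (qf y') + qh y' * dl (qf y'))
  = (qh y - qh y') + (dl (qf y) - dl (qf y')) + (qh y * dl (qf y) - qh y' * dl (qf y')) by ring.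
by apply: vanD; [apply: vanD | apply: (vanW (leqnSn k))].
Qed.

Lemma close_rem_m k y y' : vanq 1 y -> vanq 1 y' -> close k y y' ->
  van wdeg k.+1 (rem_m y - rem_m y').
Proof.
move=> vy vy' c; have vc := close_qcomp vy vy' c; have := (van_qcomp vy, van_qcomp vy').
case: vy vy' c => vf vh vp vm [vf' vh' vp' vm'] [cf ch cp cm] [vq vq'].
have wa := wdeg_add.
have -> : rem_m y - rem_m y' =
   (qcomp y - qcomp y' - (dz mu * (qf y - qf y') + dv mu * (qp y - qp y')))
   + (dl (qf y) * (qcomp y - mu) - dl (qf y') * (qcomp y' - mu))
   - (qm y * dv (qp y) - qm y' * dv (qp y')).
  rewrite /rem_m; move: (qcomp y) (qcomp y') (dl (qf y)) (dl (qf y')) (dv (qp y)) (dv (qp y')).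
  by move: mu (dz mu) (dv mu) => *; ring.
apply: vanB; [apply: vanD => //|]; apply: van_prod_sub => //.
- exact: van_dl.
- by rewrite -dlB; apply: van_dl.
- have -> : qcomp y - mu - (qcomp y' - mu) =
    (qcomp y - qcomp y' - (dz mu * (qf y - qf y') + dv mu * (qp y - qp y'))) +
    (dz mu * (qf y - qf y') + dv mu * (qp y - qp y')).
    by move: (qcomp y) (qcomp y') mu (dz mu) (dv mu) => *; ring.
  apply: vanD; first exact: (vanW (leqnSn k)).
  by apply: vanD; apply: vanMr.
- exact: van_dv.
- by rewrite -dvN -dvD; apply: van_dv.
Qed.

Lemma close_rem_tot k y y' : vanq 1 y -> vanq 1 y' -> close k y y' ->
  van wdeg k.+1 (rem_tot y - rem_tot y').
Proof.
move=> vy vy' c.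
have -> : rem_tot y - rem_tot y' = (rem_m y - rem_m y') - lin_p (rem_p y - rem_p y').
  by rewrite lin_pD lin_pN /rem_tot; ring.
by apply: vanB; [apply: close_rem_m | apply/van_lin_p/close_rem_p].
Qed.

Definition quad0 := Quad 0 0 0 0.
Lemma vanq0 k : vanq k quad0. Proof. by split. Qed.
Lemma close0 y k : vanq k y -> close k y quad0.
Proof. by case=> vf vh vp vm; split; rewrite /= subr0. Qed.

(** At 0 the remainder is Psi(z, w, zeta) - Psi(z, 0, zeta), which is divisible by w. The case
    [k = 0] of the contraction carries this over to y. *)
Lemma van_rem_tot y : vanq 1 y -> van wdeg 1 (rem_tot y).
Proof.
move=> vy; have wa := wdeg_add.
have v0 : van wdeg 1 (rem_tot quad0).
  rewrite /rem_tot; apply: vanB.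
    rewrite /rem_m /= !mulr0 mul0r !subr0.
    apply: vanD; first exact: (van_qcomp (vanq0 1)).
    by apply: vanMl => //; apply: van_dl.
  by apply: van_lin_p; rewrite /rem_p /= !(mul0r, mulr0, addr0) oppr0.
rewrite -(subrK (rem_tot quad0) (rem_tot y)); apply: vanD => //.
by apply: (close_rem_tot (k := 0) vy (vanq0 1)); apply: close0; case: vy.
Qed.

Lemma sol_cauchy_eq S S' k : (forall a c, S a k c = S' a k c) -> sol_cauchy S k = sol_cauchy S' k.
Proof. by move=> e; rewrite /sol_cauchy /cauchy_rhs !e. Qed.

Lemma van_sol_h n S S' : van wdeg n (S - S') -> van wdeg n (sol_h S - sol_h S').
Proof.
move=> v a b c lt; have e a' c' : S a' b c' = S' a' b c'.
  by apply/eqP; rewrite -subr_eq0 -c3B v.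
rewrite c3B /sol_h /integ (sol_cauchy_eq e); case: ifP => _; first by rewrite subrr.
by case: a {lt} => [|[|a]]; rewrite ?e subrr.
Qed.
Lemma van_sol_fzz n S S' : van wdeg n (S - S') -> van wdeg n (sol_fzz S - sol_fzz S').
Proof.
move=> v; have wa := wdeg_add; have vh := van_sol_h v.
have -> : sol_fzz S - sol_fzz S' = Dw (dz (sol_h S - sol_h S')) *+ 2
  - mu2 * dz (sol_h S - sol_h S') *+ 2 - slice 1 (S - S').
  have -> : slice 1 (S - S') = slice 1 S - slice 1 S'.
    by apply: c3P => a b [|c]; rewrite c3B /slice //= subr0.
  by rewrite /sol_fzz !(dzD, DwD, dzN, DwN); ring.
apply: vanB; last by move=> a b c lt; rewrite /slice v ?if_same.
apply: vanB; apply: vanMn => //; first by apply: van_Dw; apply: van_dz.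
by apply: vanMr => //; apply: van_dz.
Qed.
Lemma van_sol_f n S S' : van wdeg n (S - S') -> van wdeg n (sol_f S - sol_f S').
Proof.
move=> v a b c lt; have e a' c' : S a' b c' = S' a' b c'.
  by apply/eqP; rewrite -subr_eq0 -c3B v.
have e' a' c' : sol_fzz S a' b c' = sol_fzz S' a' b c'.
  by apply/eqP; rewrite -subr_eq0 -c3B (van_sol_fzz v).
rewrite c3B /sol_f /integ (sol_cauchy_eq e); case: ifP => _; first by rewrite subrr.
by case: a {lt} => [|[|a]]; rewrite ?e' subrr.
Qed.

(** The linear solver works on each power of w separately and so preserves the order; the gain comes
    entirely from the remainders. *)
Lemma step_close k y y' : vanq 1 y -> vanq 1 y' -> close k y y' ->
  close k.+1 (step y) (step y').
Proof.
move=> vy vy' c; have cS := close_rem_tot vy vy' c; have cP := close_rem_p vy vy' c.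
have cf := van_sol_f cS; have ch := van_sol_h cS; have wa := wdeg_add.
have ce := van_ell cf ch; rewrite ellB in ce.
split=> //=.
  have -> : forall a b a' b' : T, a + b - (a' + b') = (a - a') + (b - b') by move=> *; ring.
  exact: vanD.
have -> : forall a b c a' b' c' : T, a - (b - c) - (a' - (b' - c')) =
   (a - a') - ((b - b') - (c - c')) by move=> *; ring.
rewrite -lin_fB -lin_pN -lin_pD; apply: vanB => //.
by apply: vanB; [apply: van_lin_p | apply: van_lin_f].
Qed.

Lemma step_van y : vanq 1 y -> vanq 1 (step y).
Proof.
move=> vy; have vS := van_rem_tot vy; have wa := wdeg_add.
have vf : van wdeg 1 (sol_f (rem_tot y)) by apply: van_integ.
have vh : van wdeg 1 (sol_h (rem_tot y)) by apply: van_integ.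
have vP : van wdeg 1 (rem_p y).
  case: vy => v1 v2 v3 v4; rewrite /rem_p; apply: vanN; apply: vanD.
    by apply: vanMl => //; apply: vanMl.
  exact: vanMr.
have ve := van_ell vf vh.
split=> //=; first exact: vanD.
by apply: vanB => //; apply: vanB; [apply: van_lin_p | apply: van_lin_f].
Qed.

Lemma solutionP y : solution y <-> vanq 1 y /\ step y = y.
Proof.
split=> [[vy [zf zh] ep em low]|[vy e]].
  split=> //; have vS := van_rem_tot vy; case: (vy) => vf vh vp vm.
  have emS : qm y = rem_tot y - (lin_p (ell (qf y) (qh y)) - lin_f (qf y)).
    by rewrite /rem_tot -em {1}ep lin_pD; ring.
  rewrite emS in low.
  have [ef eh] := (linear_solP vS vf vh zf zh).1 low.
  rewrite /step -ef -eh -emS -ep.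
  by case: (y).
have vS := van_rem_tot vy; have [vf vh _ _] := vy.
have ef : qf y = sol_f (rem_tot y) by rewrite -[in LHS]e.
have eh : qh y = sol_h (rem_tot y) by rewrite -[in LHS]e.
have ep : qp y = ell (qf y) (qh y) + rem_p y by rewrite -[in LHS]e ef eh.
have em : qm y = rem_tot y - (lin_p (ell (qf y) (qh y)) - lin_f (qf y)) by rewrite -[in LHS]e ef eh.
have zf : zeta_free (qf y) by rewrite ef; apply: zf_integ.
have zh : zeta_free (qh y) by rewrite eh; apply: zf_integ.
split=> //.
  by rewrite em ep lin_pD /rem_tot; ring.
by rewrite em; apply/(linear_solP vS vf vh zf zh).
Qed.

(** * Uniqueness and existence of the formal solution *)

Lemma close_all y y' : (forall k, close k y y') -> y = y'.
Proof.
case: y y' => [f h p m] [f' h' p' m'] c.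
have e (A B : T) : (forall k, van wdeg k (A - B)) -> A = B.
  by move=> /van_all/eqP; rewrite subr_eq0 => /eqP.
by congr Quad; apply: e => k; case: (c k).
Qed.

Lemma solution_uniq y y' : solution y -> solution y' -> y = y'.
Proof.
move=> /solutionP[vy ey] /solutionP[vy' ey']; apply: close_all.
elim=> [|k IH]; first by split; apply: van_le0.
by rewrite -ey -ey'; apply: step_close.
Qed.

Definition iterq n := iter n step quad0.
(** The coefficients of w^b no longer change from the iterate b + 1 on, so the limit is read along
    the diagonal. *)
Definition limq : quad := Quad (fun a b c => qf (iterq b.+1) a b c)
  (fun a b c => qh (iterq b.+1) a b c) (fun a b c => qp (iterq b.+1) a b c)
  (fun a b c => qm (iterq b.+1) a b c).

Lemma iterq_van n : vanq 1 (iterq n).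
Proof. by elim: n => [|n IH]; [apply: vanq0 | apply: step_van]. Qed.
Lemma iterq_close n : close n (iterq n.+1) (iterq n).
Proof.
elim: n => [|n IH]; first by split; apply: van_le0.
exact: (step_close (iterq_van n.+1) (iterq_van n) IH).
Qed.

Lemma iterq_stable (P : quad -> T) : (forall n, van wdeg n (P (iterq n.+1) - P (iterq n))) ->
  forall (n m a b c : nat), (b < n <= m)%N -> P (iterq m) a b c = P (iterq n) a b c.
Proof.
move=> cl n m a b c /andP[lt le]; rewrite -(subnK le).
elim: (m - n)%N => [|d IH]; first by rewrite add0n.
apply: etrans IH; rewrite addSn.
have /eqP := cl (d + n)%N a b c (leq_trans lt (leq_addl _ _)).
by rewrite c3B subr_eq0 => /eqP.
Qed.

Lemma limq_close n : close n limq (iterq n).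
Proof.
have cl n' := iterq_close n'.
split=> a b c lt; rewrite c3B /=.
- by rewrite (@iterq_stable qf _ b.+1 n) ?subrr ?leqnn // => k; case: (cl k).
- by rewrite (@iterq_stable qh _ b.+1 n) ?subrr ?leqnn // => k; case: (cl k).
- by rewrite (@iterq_stable qp _ b.+1 n) ?subrr ?leqnn // => k; case: (cl k).
- by rewrite (@iterq_stable qm _ b.+1 n) ?subrr ?leqnn // => k; case: (cl k).
Qed.

Lemma limq_van : vanq 1 limq.
Proof.
have [v1 v2 v3 v4] := iterq_van 1; have [c1 c2 c3 c4] := limq_close 1.
have wa := wdeg_add.
have e (A B : T) : van wdeg 1 (A - B) -> van wdeg 1 B -> van wdeg 1 A.
  by move=> vAB vB; rewrite -(subrK B A); apply: vanD.
by split; [apply: e c1 v1 | apply: e c2 v2 | apply: e c3 v3 | apply: e c4 v4].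
Qed.

Lemma limq_solution : solution limq.
Proof.
apply/solutionP; split; first exact: limq_van.
apply: close_all => -[|n]; first by split; apply: van_le0.
have c1 : close n.+1 (step limq) (iterq n.+1).
  rewrite -[iterq n.+1]/(step (iterq n)).
  exact: (step_close limq_van (iterq_van n) (limq_close n)).
have c2 := limq_close n.+1.
case: c1 c2 => a1 a2 a3 a4 [b1 b2 b3 b4].
have e (A B C : T) : van wdeg n.+1 (A - C) -> van wdeg n.+1 (B - C) -> van wdeg n.+1 (A - B).
  move=> v w; have -> : A - B = (A - C) - (B - C) by ring.
  by apply: vanB; [exact: v | exact: w].
by split; [apply: e a1 b1 | apply: e a2 b2 | apply: e a3 b3 | apply: e a4 b4].
Qed.

End System.

(** * Majorants *)

Section Weights.
Variable K : numFieldType.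

Definition wt (s n : nat) : K := (n.+1 ^ s)%:R^-1.

Lemma wt_gt0 s n : 0 < wt s n.
Proof. by rewrite invr_gt0 ltr0n expn_gt0. Qed.
Lemma wt_ge0 s n : 0 <= wt s n. Proof. exact/ltW/wt_gt0. Qed.
Lemma wt_le s s' n : (s <= s')%N -> wt s' n <= wt s n.
Proof.
by move=> le; rewrite lef_pV2 ?posrE ?ltr0n ?expn_gt0 // ler_nat leq_pexp2l.
Qed.

Lemma wt_comp s d m n : (m.+1 <= d * n.+1)%N -> wt s n <= (d ^ s)%:R * wt s m.
Proof.
move=> le; rewrite /wt -ler_pdivrMl ?ltr0n ?expn_gt0 ?muln_gt0; last first.
  by case: d le => // ; rewrite mul0n.
rewrite -invfM -natrM lef_pV2 ?posrE ?ltr0n ?muln_gt0 ?expn_gt0 //; last first.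
  by case: d le => //; rewrite mul0n.
by rewrite ler_nat -expnMn; case: s => // s; rewrite leq_exp2r.
Qed.

Lemma wt_anti s m n : (m <= n)%N -> wt s n <= wt s m.
Proof. by move=> le; have := @wt_comp s 1 m n; rewrite exp1n mul1r; apply; lia. Qed.

(** Telescoping: 1/(n + 2)^2 is at most 1/(n + 1) - 1/(n + 2). *)
Lemma wt_sum2 n : \sum_(k < n.+1) wt 2 k <= 2 - n.+1%:R^-1.
Proof.
elim: n => [|n IH]; first by rewrite big_ord1 /wt exp1n invr1 (_ : 2 = 1 + 1 :> K) ?addrK // -natrD.
rewrite big_ord_recr /=; apply: le_trans (lerD IH (lexx _)) _.
rewrite -addrA lerD2l -subr_ge0 /wt natrX expr2.
have h1 : (n.+1%:R + 1 : K) != 0 by rewrite natr1 pnatr_eq0.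
have h2 : (n.+1%:R : K) != 0 by rewrite pnatr_eq0.
have -> : (- n.+2%:R^-1 - (- n.+1%:R^-1 + (n.+2%:R * n.+2%:R)^-1) : K) =
   (n.+1%:R * n.+2%:R * n.+2%:R)^-1.
  rewrite -[n.+2%:R]natr1; move: (n.+1%:R : K) h1 h2 => x h1 h2.
  by field; rewrite h1 h2.
by rewrite invr_ge0 -!natrM ler0n.
Qed.

Lemma wt_sum s n : (2 <= s)%N -> \sum_(k < n.+1) wt s k <= 2.
Proof.
move=> s2; apply: le_trans (_ : \sum_(k < n.+1) wt 2 k <= _).
  by apply: ler_sum => k _; apply: wt_le.
by apply: le_trans (wt_sum2 n) _; rewrite lerBlDr lerDl invr_ge0 ler0n.
Qed.

(** One of k and n - k is at least about half of n, so its weight is at most 2^s times that of n.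
    The weights of the other index sum to at most 2, and the two cases together give 2^s * 4. *)
Lemma wt_conv s n : (2 <= s)%N ->
  \sum_(k < n.+1) wt s k * wt s (n - k) <= (2 ^ (s + 2))%:R * wt s n.
Proof.
move=> s2; apply: le_trans (_ : \sum_(k < n.+1)
    ((2 ^ s)%:R * wt s n) * (wt s k + wt s (n - k)) <= _).
  apply: ler_sum => k _; rewrite mulrDr.
  have [le|lt] := leqP n.+1 (2 * k.+1)%N.
    rewrite ler_wpDl ?mulr_ge0 ?ler0n ?wt_ge0 //.
    by apply: ler_wpM2r; [apply: wt_ge0 | apply: wt_comp].
  rewrite ler_wpDr ?mulr_ge0 ?ler0n ?wt_ge0 // mulrC.
  by apply: ler_wpM2r; [apply: wt_ge0 | apply: wt_comp; have := ltn_ord k; lia].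
rewrite -mulr_sumr expnD natrM mulrAC.
apply: ler_wpM2r; first exact: wt_ge0.
apply: ler_wpM2l; first exact: ler0n.
rewrite big_split /= (reindex_inj rev_ord_inj) /=.
have -> : \sum_(j < n.+1) wt s (n.+1 - j.+1) = \sum_(j < n.+1) wt s (n - j).
  by apply: eq_bigr => j _; rewrite subSS.
rewrite [X in X + _](reindex_inj rev_ord_inj) /=.
have -> : \sum_(j < n.+1) wt s (n - (n.+1 - j.+1)) = \sum_(j < n.+1) wt s j.
  by apply: eq_bigr => j _; rewrite subSS subKn // -ltnS.
rewrite [X in _ + X](reindex_inj rev_ord_inj) /=.
have -> : \sum_(j < n.+1) wt s (n - (n.+1 - j.+1)) = \sum_(j < n.+1) wt s j.
  by apply: eq_bigr => j _; rewrite subSS subKn // -ltnS.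
have := wt_sum n s2; set x := \sum_(_ < _) _ => le.
have -> : (2 ^ 2)%:R = 2 + 2 :> K by rewrite -natrD.
exact: lerD.
Qed.

(** Grouping by the total degree n = i + j produces Vandermonde sums; the indices added to complete
    them have a vanishing binomial coefficient. *)
Lemma binom_regroup (g : nat -> K) a b :
  \sum_(i < a.+1) \sum_(j < b.+1)
     ('C(i + j, i) * 'C(a - i + (b - j), a - i))%:R * g (i + j)%N
  = 'C(a + b, a)%:R * \sum_(n < (a + b).+1) g n.
Proof.
transitivity (\sum_(i < a.+1) \sum_(n < (a + b).+1)
     ('C(n, i) * 'C(a + b - n, a - i))%:R * g n).
  apply: eq_bigr => i _; have := ltn_ord i; rewrite ltnS => lei.
  rewrite -(big_mkord xpredT (fun n => ('C(n, i) * 'C(a + b - n, a - i))%:R * g n)).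
  rewrite (big_cat_nat (n := i)) //=; last by lia.
  rewrite (big_cat_nat (m := i) (n := i + b.+1)) //=; [|by lia|by lia].
  rewrite [X in _ = X + _]big_nat_cond [X in _ = X + _]big1 ?add0r; last first.
    by move=> n /andP[/andP[_ lt] _]; rewrite bin_small // mul0r.
  rewrite [X in _ = _ + X]big_nat_cond [X in _ = _ + X]big1 ?addr0; last first.
    move=> n /andP[/andP[le lt] _].
    by rewrite ['C(a + b - n, _)]bin_small ?muln0 ?mul0r //; lia.
  rewrite -[X in index_iota X _]add0n big_addn addKn big_mkord; apply: eq_bigr => j _.
  have := ltn_ord j; rewrite ltnS => lej.
  congr ((_ * 'C(_, _))%:R * g _); try lia.
  by rewrite addnC.
rewrite exchange_big mulr_sumr; apply: eq_bigr => n _ /=.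
rewrite -mulr_suml; congr (_ * _).
rewrite -natr_sum binomial.Vandermonde; congr ('C(_, _)%:R); have := ltn_ord n; lia.
Qed.

Lemma binom_conv s a b : (2 <= s)%N ->
  \sum_(i < a.+1) \sum_(j < b.+1)
     ('C(i + j, i)%:R * wt s (i + j)) *
     ('C(a - i + (b - j), a - i)%:R * wt s (a - i + (b - j)))
  <= (2 ^ (s + 2))%:R * ('C(a + b, a)%:R * wt s (a + b)).
Proof.
move=> s2.
have -> : \sum_(i < a.+1) \sum_(j < b.+1)
     ('C(i + j, i)%:R * wt s (i + j)) *
     ('C(a - i + (b - j), a - i)%:R * wt s (a - i + (b - j))) =
   \sum_(i < a.+1) \sum_(j < b.+1)
     ('C(i + j, i) * 'C(a - i + (b - j), a - i))%:R *
      (wt s (i + j) * wt s (a + b - (i + j))).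
  apply: eq_bigr => i _; apply: eq_bigr => j _; rewrite natrM /=.
  have -> : (a - i + (b - j) = a + b - (i + j))%N.
    by have := ltn_ord i; have := ltn_ord j; lia.
  by ring.
rewrite (binom_regroup (fun n => wt s n * wt s (a + b - n))) mulrCA.
by apply: ler_wpM2l; [exact: ler0n | exact: wt_conv].
Qed.

End Weights.

(** * Majorant norms: products and derivatives *)

Section Bounds.
Variable K : numFieldType.
Notation T := (ser (ser (ser K))).
Notation zT := (zT K).
Notation wT := (wT K).
Notation vT := (vT K).
Implicit Types A B : T.
Variables (p l : K).
Hypotheses (p0 : 0 < p) (l0 : 0 < l).

(* Thanks to the binomial, [w d/dw] followed by an integration in z is bounded:
   it multiplies the coefficients by [b / (a + b + 1)] relatively to the majorant. *)
Definition mw (q : K) (s t a b c : nat) : K :=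
  'C(a + b, a)%:R * wt K s (a + b) * wt K t c * (p ^+ a * q ^+ b * l ^+ c).
Definition bd (q : K) (s t : nat) (C : K) A :=
  forall a b c, `|A a b c| <= C * mw q s t a b c.

Lemma mw_ge0 q s t a b c : 0 < q -> 0 <= mw q s t a b c.
Proof. by move=> q0; rewrite !mulr_ge0 ?exprn_ge0 ?ler0n ?wt_ge0 // ltW. Qed.

Section Fixed.
Variable q : K.
Hypothesis q0 : 0 < q.
Notation bd := (bd q).

Lemma bdW s t s' t' C C' A : (s' <= s)%N -> (t' <= t)%N -> 0 <= C -> C <= C' ->
  bd s t C A -> bd s' t' C' A.
Proof.
move=> les let' C0 CC' h a b c; apply: le_trans (h a b c) _.
apply: ler_pM => //; first exact: mw_ge0.
rewrite /mw; apply: ler_wpM2r.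
  by rewrite !mulr_ge0 ?exprn_ge0 // ltW.
apply: ler_pM; rewrite ?mulr_ge0 ?ler0n ?wt_ge0 ?wt_le //.
by apply: ler_wpM2l; rewrite ?ler0n ?wt_le.
Qed.

Lemma bdD s t C C' A B : bd s t C A -> bd s t C' B -> bd s t (C + C') (A + B).
Proof.
move=> hA hB a b c; rewrite c3D mulrDl; apply: le_trans (ler_normD _ _) _.
exact: lerD.
Qed.
Lemma bdN s t C A : bd s t C A -> bd s t C (- A).
Proof. by move=> h a b c; rewrite c3N normrN. Qed.
Lemma bd0 s t : bd s t 0 0.
Proof. by move=> a b c; rewrite c30 normr0 mul0r. Qed.
Definition KK (s : nat) : K := (2 ^ (s + 2))%:R.
Lemma KK_gt0 s : 0 < KK s. Proof. by rewrite ltr0n expn_gt0. Qed.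

(** The convolution of majorants factors into one in (z, w), bounded by [binom_conv], and one in
    zeta, bounded by [wt_conv]. *)
Lemma bdM s t C C' A B : (2 <= s)%N -> (2 <= t)%N -> 0 <= C -> 0 <= C' ->
  bd s t C A -> bd s t C' B -> bd s t (KK s * KK t * (C * C')) (A * B).
Proof.
move=> s2 t2 C0 C'0 hA hB a b c; rewrite c3M.
have le : `|\sum_(i < a.+1) \sum_(j < b.+1) \sum_(k < c.+1)
     A i j k * B (a - i)%N (b - j)%N (c - k)%N| <=
   \sum_(i < a.+1) \sum_(j < b.+1) \sum_(k < c.+1)
     (C * mw q s t i j k) * (C' * mw q s t (a - i) (b - j) (c - k)).
  apply: le_trans (ler_norm_sum _ _ _) _; apply: ler_sum => i _.
  apply: le_trans (ler_norm_sum _ _ _) _; apply: ler_sum => j _.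
  apply: le_trans (ler_norm_sum _ _ _) _; apply: ler_sum => k _.
  by rewrite normrM; apply: ler_pM.
apply: le_trans le _.
have -> : \sum_(i < a.+1) \sum_(j < b.+1) \sum_(k < c.+1)
     (C * mw q s t i j k) * (C' * mw q s t (a - i) (b - j) (c - k)) =
   (C * C') * (p ^+ a * q ^+ b * l ^+ c) *
   ((\sum_(i < a.+1) \sum_(j < b.+1)
     ('C(i + j, i)%:R * wt K s (i + j)) *
     ('C(a - i + (b - j), a - i)%:R * wt K s (a - i + (b - j)))) *
   (\sum_(k < c.+1) wt K t k * wt K t (c - k))).
  rewrite mulr_suml mulr_sumr; apply: eq_bigr => i _.
  rewrite mulr_suml mulr_sumr; apply: eq_bigr => j _.
  rewrite !mulr_sumr; apply: eq_bigr => k _.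
  have e x n (r : 'I_n.+1) : x ^+ n = x ^+ r * x ^+ (n - r) :> K.
    by rewrite -exprD subnKC // -ltnS.
  rewrite /mw (e p a i) (e q b j) (e l c k).
  move: (wt K _ _) (wt K _ _) (wt K _ _) (wt K _ _) => w1 w2 w3 w4.
  move: ('C(_, _)%:R) ('C(_, _)%:R) => b1 b2.
  by ring.
have -> : KK s * KK t * (C * C') * mw q s t a b c =
  (C * C') * (p ^+ a * q ^+ b * l ^+ c) *
  ((KK s * ('C(a + b, a)%:R * wt K s (a + b))) * (KK t * wt K t c)).
  by rewrite /mw; ring.
apply: ler_wpM2l; first by rewrite !mulr_ge0 ?exprn_ge0 // ltW.
apply: ler_pM.
- by apply: sumr_ge0 => i _; apply: sumr_ge0 => j _; rewrite !mulr_ge0 ?ler0n ?wt_ge0.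
- by apply: sumr_ge0 => i _; rewrite mulr_ge0 ?wt_ge0.
- exact: binom_conv.
- exact: wt_conv.
Qed.

Lemma bd_Dw s t C A : 0 <= C -> bd s.+1 t C A -> bd s t C (Dw A).
Proof.
move=> C0 h a b c; rewrite /Dw -mulr_natr normrM normr_nat.
apply: le_trans (ler_wpM2r (ler0n _ _) (h a b c)) _.
rewrite -mulrA; apply: ler_wpM2l => //; rewrite /mw.
have -> : 'C(a + b, a)%:R * wt K s.+1 (a + b) * wt K t c * (p ^+ a * q ^+ b * l ^+ c) * b%:R =
  (wt K s.+1 (a + b) * b%:R) * ('C(a + b, a)%:R * wt K t c * (p ^+ a * q ^+ b * l ^+ c)) by ring.
have -> : 'C(a + b, a)%:R * wt K s (a + b) * wt K t c * (p ^+ a * q ^+ b * l ^+ c) =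
  wt K s (a + b) * ('C(a + b, a)%:R * wt K t c * (p ^+ a * q ^+ b * l ^+ c)) by ring.
apply: ler_wpM2r; first by rewrite !mulr_ge0 ?exprn_ge0 ?ler0n ?wt_ge0 // ltW.
rewrite /wt expnS natrM invfM mulrAC ler_piMl ?invr_ge0 ?ler0n //.
by rewrite mulrC ler_pdivrMr ?ltr0n // mul1r ler_nat; lia.
Qed.

Lemma bd_dv s t C A : 0 <= C -> bd s t.+1 C A -> bd s t (C * l) (dv A).
Proof.
move=> C0 h a b c; rewrite /dv -mulr_natr normrM normr_nat.
apply: le_trans (ler_wpM2r (ler0n _ _) (h a b c.+1)) _.
rewrite -[leLHS]mulrA -[leRHS]mulrA; apply: ler_wpM2l => //; rewrite /mw exprS.
set X := 'C(_, _)%:R; set W := wt K s _.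
have -> : X * W * wt K t.+1 c.+1 * (p ^+ a * q ^+ b * (l * l ^+ c)) * c.+1%:R =
  (wt K t.+1 c.+1 * c.+1%:R) * (l * (X * W * (p ^+ a * q ^+ b * l ^+ c))) by ring.
have -> : l * (X * W * wt K t c * (p ^+ a * q ^+ b * l ^+ c)) =
  wt K t c * (l * (X * W * (p ^+ a * q ^+ b * l ^+ c))) by ring.
apply: ler_wpM2r; first by rewrite !mulr_ge0 ?exprn_ge0 ?ler0n ?wt_ge0 // ltW.
apply: le_trans (_ : wt K t c.+1 <= _); last first.
  have := @wt_comp K t 1 c c.+1; rewrite exp1n mul1r; apply; lia.
rewrite /wt expnS natrM invfM mulrAC ler_piMl ?invr_ge0 ?ler0n //.
by rewrite mulrC ler_pdivrMr ?ltr0n // mul1r ler_nat; lia.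
Qed.

(** The binomial turns the factor a + 1 of the derivative into the total degree a + b + 1, which one
    unit of s absorbs. *)
Lemma bd_dz s t C A : 0 <= C -> bd s.+1 t C A -> bd s t (C * p) (dz A).
Proof.
move=> C0 h a b c; rewrite /dz -mulr_natr normrM normr_nat.
apply: le_trans (ler_wpM2r (ler0n _ _) (h a.+1 b c)) _.
rewrite -[leLHS]mulrA -[leRHS]mulrA; apply: ler_wpM2l => //; rewrite /mw exprS.
set W := wt K t c; rewrite addSn.
have e : ('C((a + b).+1, a.+1)%:R * a.+1%:R : K) = (a + b).+1%:R * 'C(a + b, a)%:R.
  by rewrite -!natrM mulnC -mul_bin_diag.
have -> : 'C((a + b).+1, a.+1)%:R * wt K s.+1 (a + b).+1 * W *
  (p * p ^+ a * q ^+ b * l ^+ c) * a.+1%:R =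
  ('C((a + b).+1, a.+1)%:R * a.+1%:R) * (wt K s.+1 (a + b).+1 * W *
  (p * p ^+ a * q ^+ b * l ^+ c)) by ring.
rewrite e; set X := 'C(_, _)%:R.
have -> : (a + b).+1%:R * X * (wt K s.+1 (a + b).+1 * W * (p * p ^+ a * q ^+ b * l ^+ c)) =
  (wt K s.+1 (a + b).+1 * (a + b).+1%:R) * (p * (X * W * (p ^+ a * q ^+ b * l ^+ c))) by ring.
have -> : p * (X * wt K s (a + b) * W * (p ^+ a * q ^+ b * l ^+ c)) =
  wt K s (a + b) * (p * (X * W * (p ^+ a * q ^+ b * l ^+ c))) by ring.
apply: ler_wpM2r; first by rewrite !mulr_ge0 ?exprn_ge0 ?ler0n ?wt_ge0 // ltW.
apply: le_trans (_ : wt K s (a + b).+1 <= _); last first.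
  have := @wt_comp K s 1 (a + b) (a + b).+1; rewrite exp1n mul1r; apply; lia.
rewrite /wt expnS natrM invfM mulrAC ler_piMl ?invr_ge0 ?ler0n //.
by rewrite mulrC ler_pdivrMr ?ltr0n // mul1r ler_nat; lia.
Qed.

Lemma bd_slice s t n C A : 0 <= C -> bd s t C A -> bd s t (C * l ^+ n) (slice n A).
Proof.
move=> C0 h a b [|c]; last first.
  rewrite /slice /= normr0; apply: mulr_ge0; last exact: mw_ge0.
  by apply: mulr_ge0 => //; apply/exprn_ge0/ltW.
rewrite /slice /=; apply: le_trans (h a b n) _.
rewrite -[leRHS]mulrA; apply: ler_wpM2l => //; rewrite /mw expr0 mulr1.
set X := 'C(_, _)%:R; set W := wt K s _.
have -> : X * W * wt K t n * (p ^+ a * q ^+ b * l ^+ n) =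
  wt K t n * (l ^+ n * (X * W * (p ^+ a * q ^+ b))) by ring.
have -> : l ^+ n * (X * W * wt K t 0 * (p ^+ a * q ^+ b)) =
  wt K t 0 * (l ^+ n * (X * W * (p ^+ a * q ^+ b))) by ring.
apply: ler_wpM2r; first by rewrite !mulr_ge0 ?exprn_ge0 ?ler0n ?wt_ge0 // ltW.
have := @wt_comp K t 1 0 n; rewrite exp1n mul1r; apply; lia.
Qed.

End Fixed.
End Bounds.

(** * Second order remainder of a substitution *)

Section Remainder.
Variable K : numFieldType.
Notation T := (ser (ser (ser K))).
Notation zT := (zT K).
Notation wT := (wT K).
Notation vT := (vT K).
Variables (p l q be : K).
Hypotheses (p0 : 0 < p) (l0 : 0 < l) (q0 : 0 < q) (be0 : 0 <= be) (be1 : be <= 1).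
Implicit Types A B : T.

Definition KKK : K := KK K 3 * KK K 2.
Lemma KKK_gt0 : 0 < KKK. Proof. by rewrite mulr_gt0 ?KK_gt0. Qed.
Lemma KKK_ge1 : 1 <= KKK.
Proof. by rewrite /KKK /KK -natrM ler1n. Qed.
Hint Resolve KKK_gt0 : core.

(* Normalised so as to be submultiplicative. *)
Definition nb (C : K) A := bd p l q 3 2 (C / KKK) A.

Lemma nbW (C C' : K) A : 0 <= C -> C <= C' -> nb C A -> nb C' A.
Proof.
move=> C0 le; apply: bdW => //; first by rewrite divr_ge0 // ltW.
by rewrite ler_pM2r // invr_gt0.
Qed.
Lemma nbD (C C' : K) A B : nb C A -> nb C' B -> nb (C + C') (A + B).
Proof. by move=> hA hB; rewrite /nb mulrDl; apply: bdD. Qed.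
Lemma nb0 (C : K) : 0 <= C -> nb C 0.
Proof.
move=> C0; apply: (@nbW 0) => //; rewrite /nb mul0r; exact: bd0.
Qed.
Lemma nbM (C C' : K) A B : 0 <= C -> 0 <= C' -> nb C A -> nb C' B -> nb (C * C') (A * B).
Proof.
move=> C0 C'0 hA hB; rewrite /nb.
have -> : C * C' / KKK = KK K 3 * KK K 2 * ((C / KKK) * (C' / KKK)).
  by rewrite -/KKK; field; rewrite gt_eqF.
by apply: bdM => //; rewrite divr_ge0 // ltW.
Qed.
Lemma nb1 : nb KKK 1.
Proof.
rewrite /nb divff ?gt_eqF // => a b c; rewrite c31 normr_nat mul1r.
case: a b c => [|a] [|b] [|c] /=; rewrite ?mw_ge0 //.
by rewrite /mw /wt !exp1n !expr0 !invr1 !mulr1.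
Qed.

(* [A] is [A0] plus a first order part [A1] plus an error of size [be ^ 2]. *)
Definition Qn A A0 A1 (c : K) :=
  [/\ 0 <= c, nb c A0, nb (c * be) A1 & nb (c * be ^+ 2) (A - A0 - A1)].

Lemma Qn_mul A A0 A1 c B B0 B1 c' : Qn A A0 A1 c -> Qn B B0 B1 c' ->
  Qn (A * B) (A0 * B0) (A0 * B1 + A1 * B0) (6%:R * (c * c')).
Proof.
case=> c0 a0 a1 a2 [c'0 b0 b1 b2].
have be2 : 0 <= be ^+ 2 by apply: exprn_ge0.
have cc : 0 <= c * c' by apply: mulr_ge0.
have h x : 0 <= x -> x <= 6%:R * x by move=> x0; rewrite ler_peMl // ler1n.
split; first by rewrite mulr_ge0.
- by apply: nbW (nbM c0 c'0 a0 b0) => //; apply: h.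
- apply: nbW (nbD (nbM c0 _ a0 b1) (nbM _ c'0 a1 b0)); rewrite ?addr_ge0 ?mulr_ge0 //.
  have -> : c * (c' * be) + c * be * c' = 2%:R * (c * c') * be by ring.
  by rewrite !ler_wpM2r // ler_nat.
(* Six terms, each of size at most c c' [be]^2 because [be] <= 1: hence the constant 6. *)
have -> : A * B - A0 * B0 - (A0 * B1 + A1 * B0) =
  A0 * (B - B0 - B1) + (A - A0 - A1) * B0 + A1 * B1 + A1 * (B - B0 - B1)
  + (A - A0 - A1) * B1 + (A - A0 - A1) * (B - B0 - B1) by ring.
have b2le : be ^+ 2 <= be by rewrite expr2 ler_piMl.
have b22 : be ^+ 2 <= 1 by apply: le_trans b2le be1.
have -> : 6%:R * (c * c') * be ^+ 2 = c * c' * be ^+ 2 + c * c' * be ^+ 2 +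
  c * c' * be ^+ 2 + c * c' * be ^+ 2 + c * c' * be ^+ 2 + c * c' * be ^+ 2 by ring.
have ccb : 0 <= c * c' * be ^+ 2 by rewrite mulr_ge0.
repeat apply: nbD.
- by apply: nbW (nbM _ _ a0 b2); rewrite ?mulr_ge0 // mulrA.
- by apply: nbW (nbM _ _ a2 b0); rewrite ?mulr_ge0 // mulrAC.
- apply: nbW (nbM _ _ a1 b1); rewrite ?mulr_ge0 //.
  by have -> : c * be * (c' * be) = c * c' * be ^+ 2 by ring.
- apply: nbW (nbM _ _ a1 b2); rewrite ?mulr_ge0 //.
  have -> : c * be * (c' * be ^+ 2) = c * c' * be ^+ 2 * be by ring.
  by rewrite ler_piMr.
- apply: nbW (nbM _ _ a2 b1); rewrite ?mulr_ge0 //.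
  have -> : c * be ^+ 2 * (c' * be) = c * c' * be ^+ 2 * be by ring.
  by rewrite ler_piMr.
apply: nbW (nbM _ _ a2 b2); rewrite ?mulr_ge0 //.
have -> : c * be ^+ 2 * (c' * be ^+ 2) = c * c' * be ^+ 2 * be ^+ 2 by ring.
by rewrite ler_piMr.
Qed.

Lemma Qn_pow F z f (k : K) a : Qn F z f k ->
  Qn (F ^+ a) (z ^+ a) (z ^+ a.-1 *+ a * f) (KKK * (6%:R * k) ^+ a).
Proof.
move=> hF; have [k0 _ _ _] := hF; have KK0 := ltW KKK_gt0.
elim: a => [|a IH].
  rewrite !expr0 mulr1 mulr0n mul0r; split=> //; first exact: nb1.
    by apply: nb0; rewrite mulr_ge0.
  by rewrite subrr subr0; apply: nb0; rewrite mulr_ge0 ?exprn_ge0.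
have := Qn_mul hF IH.
have -> : 6%:R * (k * (KKK * (6%:R * k) ^+ a)) = KKK * (6%:R * k) ^+ a.+1.
  by rewrite exprS; ring.
have -> : z * (z ^+ a.-1 *+ a * f) + f * z ^+ a = z ^+ a.+1.-1 *+ a.+1 * f.
  case: a {IH} => [|a]; first by rewrite mulr0n mul0r mulr0 add0r mulr1n mulrC.
  by rewrite /= exprS; ring.
by rewrite -!exprS.
Qed.

Lemma Qn_monomial F G P f pp (k : K) a b c :
  Qn F zT f k -> Qn G 0 0 k -> Qn P vT pp k ->
  nb (36%:R * KKK ^+ 3 * (6%:R * k) ^+ (a + b + c) * be ^+ 2)
    (F ^+ a * (G ^+ b * P ^+ c) - zT ^+ a * (0 ^+ b * vT ^+ c) - linT a b c f pp).
Proof.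
move=> hF hG hP.
have := Qn_mul (Qn_pow a hF) (Qn_mul (Qn_pow b hG) (Qn_pow c hP)).
have -> : 6%:R * (KKK * (6%:R * k) ^+ a *
    (6%:R * (KKK * (6%:R * k) ^+ b * (KKK * (6%:R * k) ^+ c))))
 = 36%:R * KKK ^+ 3 * (6%:R * k) ^+ (a + b + c).
  by rewrite !exprD; move: (_ ^+ a) (_ ^+ b) (_ ^+ c) => *; ring.
case=> _ _ _; congr nb; congr (_ - _); rewrite /linT mulr0 mul0r addr0.
case: b => [|b]; first by rewrite !expr0 !mul1r /=; ring.
by rewrite exprS !mul0r !mulr0 addr0.
Qed.

Variables (Phi : T) (M R k : K).
Hypotheses (M0 : 0 <= M) (R0 : 0 <= R) (k0 : 0 <= k) (kR : 12%:R * k * R <= 1).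
Hypothesis PhiM : forall a b c, `|Phi a b c| <= M * R ^+ (a + b + c).

Lemma geom_half N : \sum_(a < N) (2%:R^-1 : K) ^+ a <= 2%:R.
Proof.
have h : (2%:R : K) != 0 by rewrite pnatr_eq0.
suff -> : \sum_(a < N) (2%:R^-1 : K) ^+ a = 2%:R - 2%:R * 2%:R^-1 ^+ N.
  by rewrite lerBlDr lerDl mulr_ge0 // exprn_ge0 // invr_ge0.
elim: N => [|N IH]; first by rewrite big_ord0 expr0 mulr1 subrr.
by rewrite big_ord_recr /= IH exprS; field.
Qed.

(** Here k bounds z and zeta and is small against the radius of convergence 1/R. Since 12 k R <= 1,
    the factors (6 k R)^n are at most 2^-n and the triple geometric sum is at most 8; with the 36 of
    [Qn_monomial] this gives 288. *)
Lemma comp_remainder F G P f pp :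
  van tdeg 1 F -> van tdeg 1 G -> van tdeg 1 P ->
  Qn F zT f k -> Qn G 0 0 k -> Qn P vT pp k ->
  nb (288%:R * M * KKK ^+ 3 * be ^+ 2)
    (comp Phi F G P - w0 Phi - (dz (w0 Phi) * f + dv (w0 Phi) * pp)).
Proof.
move=> tF tG tP hF hG hP i j n.
pose N := (i + j + n + 2)%N.
have ltN : (i + j + n < N)%N by rewrite /N; lia.
have ltN' : (i + j + n + 1 < N)%N by rewrite /N; lia.
have t0 : van tdeg 1 (0 : T) by [].
rewrite c3B [X in X - _]c3B -(lin_sum Phi f pp ltN') -{1}(comp_w0 Phi).
rewrite -(compNE Phi tF tG tP ltN) -(compNE Phi (@tdeg_zT K) t0 (@tdeg_vT K) ltN).
rewrite /compN -!c3B -!sumrB c3sum.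
pose m := mw p l q 3 2 i j n; have m0 : 0 <= m by apply: mw_ge0.
pose r := 2%:R^-1 : K.
pose Z := 36%:R * KKK ^+ 3 * be ^+ 2 / KKK * M * m.
have KK0 := ltW KKK_gt0.
have Z0 : 0 <= Z by rewrite /Z mulr_ge0 // !mulr_ge0 ?exprn_ge0 ?invr_ge0.
apply: le_trans (_ : \sum_(a < N) \sum_(b < N) \sum_(c < N)
   Z * (r ^+ a * (r ^+ b * r ^+ c)) <= _).
  apply: le_trans (ler_norm_sum _ _ _) _; apply: ler_sum => a _.
  rewrite -!sumrB c3sum.
  apply: le_trans (ler_norm_sum _ _ _) _; apply: ler_sum => b _.
  rewrite -!sumrB c3sum.
  apply: le_trans (ler_norm_sum _ _ _) _; apply: ler_sum => c _.
  rewrite -!mulrBr c3cst normrM.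
  have le1 := PhiM a b c; have le2 := Qn_monomial a b c hF hG hP i j n.
  apply: le_trans (ler_pM _ _ le1 le2) _ => //.
  have -> : M * R ^+ (a + b + c) * (36%:R * KKK ^+ 3 * (6%:R * k) ^+ (a + b + c)
     * be ^+ 2 / KKK * mw p l q 3 2 i j n) = Z * (6%:R * k * R) ^+ (a + b + c).
    rewrite [(6%:R * k * R) ^+ _]exprMn /Z /m.
    by move: (_ ^+ (a + b + c)) (_ ^+ (a + b + c)) => *; ring.
  apply: ler_wpM2l => //; rewrite -!exprD addnA.
  apply: lerXn2r; rewrite ?nnegrE ?invr_ge0 ?mulr_ge0 //.
  rewrite -(ler_pM2l (x := 2%:R)) ?ltr0n // mulfV ?pnatr_eq0 //.
  by have -> : 2%:R * (6%:R * k * R) = 12%:R * k * R by ring.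
have -> : \sum_(a < N) \sum_(b < N) \sum_(c < N) Z * (r ^+ a * (r ^+ b * r ^+ c))
  = Z * ((\sum_(a < N) r ^+ a) * ((\sum_(a < N) r ^+ a) * (\sum_(a < N) r ^+ a))).
  rewrite mulr_suml mulr_sumr; apply: eq_bigr => a _.
  rewrite mulr_suml !mulr_sumr; apply: eq_bigr => b _.
  by rewrite !mulr_sumr.
have -> : 288%:R * M * KKK ^+ 3 * be ^+ 2 / KKK * mw p l q 3 2 i j n =
   Z * (2%:R * (2%:R * 2%:R)) by rewrite /Z /m; ring.
have g := geom_half N; rewrite -/r in g.
have g0 : 0 <= \sum_(a < N) r ^+ a by apply: sumr_ge0 => a _; rewrite exprn_ge0 // invr_ge0.
apply: ler_wpM2l => //; apply: ler_pM => //; first by rewrite mulr_ge0.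
exact: ler_pM.
Qed.

End Remainder.

(** * Uniform invertibility of the resonance matrices *)

Section LinearBound.
Variable K : numFieldType.
Variable E : ser (ser (ser K)).
Hypothesis arch : forall x : K, exists n : nat, `|x| <= n%:R.
Hypothesis Lm_unit : forall k, (0 < k)%N -> Lm E k \in unitmx.
Notation Lm := (Lm E).

Lemma arch_seq (s : seq K) : exists n : nat, forall x, x \in s -> `|x| <= n%:R.
Proof.
elim: s => [|x s [n hn]]; first by exists 0%N.
have [m hm] := arch x; exists (m + n)%N => y; rewrite inE => /predU1P[->|/hn le].
  by apply: le_trans hm _; rewrite ler_nat leq_addr.
by apply: le_trans le _; rewrite ler_nat leq_addl.
Qed.

Lemma row_bound (y r u c g0 g1 g2 g3 y0 y1 y2 y3 : K) : 0 <= u ->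
  r = y + u * (g0 * y0 + g1 * y1 + g2 * y2 + g3 * y3) ->
  `|g0| <= c -> `|g1| <= c -> `|g2| <= c -> `|g3| <= c ->
  `|y| <= `|r| + u * (c * (`|y0| + `|y1| + `|y2| + `|y3|)).
Proof.
move=> u0 er h0 h1 h2 h3.
have -> : y = r - u * (g0 * y0 + g1 * y1 + g2 * y2 + g3 * y3) by rewrite er addrK.
apply: le_trans (ler_normB _ _) _; rewrite lerD2l normrM ger0_norm //.
apply: ler_wpM2l => //; rewrite !mulrDr.
have h (g z : K) : `|g| <= c -> `|g * z| <= c * `|z|.
  by move=> le; rewrite normrM; apply: ler_wpM2r.
do 3!(apply: le_trans (ler_normD _ _) _; apply: lerD; last exact: h).
exact: h.
Qed.

(* Diagonal dominance of [Lm k] after scaling by powers of [k]; the entry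
   [-2k] of the first row is of the same order but strictly triangular. *)
Lemma Lm_bound_large : exists k0 : nat, forall k (x : 'cV[K]_4) e, (k0 <= k)%N -> (0 < k)%N ->
  `|(Lm k *m x) 0 0| <= e -> `|(Lm k *m x) 1 0| <= e * k%:R ->
  `|(Lm k *m x) 2%:R 0| <= e -> `|(Lm k *m x) 3%:R 0| <= e * k%:R ->
  k%:R ^+ 2 * `|x 0 0| + k%:R * `|x 1 0| + k%:R ^+ 2 * `|x 2%:R 0| + k%:R * `|x 3%:R 0|
   <= 12%:R * e.
Proof.
pose a0 := E 0%N 0%N 2%N; pose a1 := E 1%N 0%N 2%N; pose a2 := E 2%N 0%N 2%N.
pose b0 := E 0%N 0%N 3%N; pose b1 := E 1%N 0%N 3%N; pose b2 := E 2%N 0%N 3%N.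
pose c0 := E 0%N 0%N 4%N; pose c1 := E 1%N 0%N 4%N.
have [n hn] := arch_seq [:: 1 - a0; a1; a2; b0; b1; b2; c0; c1; b0 * (a0 - 1)].
(* The remaining entries are at most 6 n and come with a factor 1/k, so d = 6 n S / k; k >= 72 n
   gives 12 d <= S, which closes the estimate S <= 6 e + 6 d. *)
exists (72 * n)%N => k x e lek k0.
rewrite !mul_mx4 !mxE /= -/a0 -/a1 -/a2 -/b0 -/b1 -/b2 -/c0 -/c1.
set x0 := x 0 0; set x1 := x 1 0; set x2 := x 2%:R 0; set x3 := x 3%:R 0.
set r0 := (X in `|X| <= _); move=> h0.
set r1 := (X in `|X| <= _); move=> h1.
set r2 := (X in `|X| <= _); move=> h2.
set r3 := (X in `|X| <= _); move=> h3.
have kk0 : 0 < k%:R :> K by rewrite ltr0n.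
have kn0 : k%:R != 0 :> K by rewrite gt_eqF.
pose u : K := k%:R^-1; have u0 : 0 <= u by rewrite invr_ge0 ltW.
have u1 : u <= 1 by rewrite invf_le1 // ler1n.
pose y0 := k%:R ^+ 2 * x0; pose y1 := k%:R * x1.
pose y2 := k%:R ^+ 2 * x2; pose y3 := k%:R * x3.
have ey0 : `|y0| = k%:R ^+ 2 * `|x0| by rewrite normrM ger0_norm // exprn_ge0.
have ey2 : `|y2| = k%:R ^+ 2 * `|x2| by rewrite normrM ger0_norm // exprn_ge0.
have ey1 : `|y1| = k%:R * `|x1| by rewrite normrM ger0_norm.
have ey3 : `|y3| = k%:R * `|x3| by rewrite normrM ger0_norm.
rewrite -ey0 -ey1 -ey2 -ey3; set S := _ + _ + _ + _.
have S0 : 0 <= S by rewrite !addr_ge0.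
have [ha0 ha1 ha2 hb0] : [/\ `|1 - a0| <= n%:R, `|a1| <= n%:R, `|a2| <= n%:R & `|b0| <= n%:R].
  by split; apply: hn; rewrite !inE eqxx ?orbT.
have [hb1 hb2 hc0 hc1] : [/\ `|b1| <= n%:R, `|b2| <= n%:R, `|c0| <= n%:R & `|c1| <= n%:R].
  by split; apply: hn; rewrite !inE eqxx ?orbT.
have hba : `|b0 * (a0 - 1)| <= n%:R by apply: hn; rewrite !inE eqxx ?orbT.
have ha0' : `|a0 - 1| <= n%:R by rewrite distrC.
have hu (z m : K) : `|z| <= m -> `|z * u| <= m.
  move=> le; rewrite normrM (ger0_norm u0); apply: le_trans le.
  by rewrite ler_piMr.
have hD (z z' m m' : K) : `|z| <= m -> `|z'| <= m' -> `|z + z'| <= m + m'.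
  by move=> hz hz'; apply: le_trans (ler_normD _ _) (lerD hz hz').
have hM j (z m : K) : `|z| <= m -> `|j%:R * z| <= j%:R * m.
  by move=> hz; rewrite normrM normr_nat ler_wpM2l.
have n0 : 0 <= n%:R :> K by [].
have wk m (z : K) : (m <= 6)%N -> `|z| <= m%:R * n%:R -> `|z| <= 6%:R * n%:R.
  by move=> lem hz; apply: le_trans hz _; rewrite ler_wpM2r // ler_nat.
have w1 (z : K) : `|z| <= n%:R -> `|z| <= 6%:R * n%:R.
  by move=> hz; apply: (wk 1%N) => //; rewrite mul1r.
have w33 (z : K) : `|z| <= 3%:R * n%:R + 3%:R * n%:R -> `|z| <= 6%:R * n%:R.
  by rewrite -mulrDl -natrD.
have w24 (z : K) : `|z| <= 2%:R * n%:R + 4%:R * n%:R -> `|z| <= 6%:R * n%:R.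
  by rewrite -mulrDl -natrD.
have w11 (z : K) : `|z| <= n%:R + n%:R -> `|z| <= 6%:R * n%:R.
  by move=> hz; apply: (wk 2) => //; apply: le_trans hz _; rewrite mulr_natl mulr2n.
have w12 (z : K) : `|z| <= n%:R + 2%:R * n%:R -> `|z| <= 6%:R * n%:R.
  have -> : n%:R + 2%:R * n%:R = 3%:R * n%:R :> K by ring.
  exact: wk.
have R0 := @row_bound (y0 - 2%:R * y3) r0 u (6%:R * n%:R) (1 - a0) (- (3%:R * b0))
  (- (a1 * u)) 0 y0 y1 y2 y3 u0.
have R1 := @row_bound (3%:R * y1) (r1 * u) u (6%:R * n%:R) (a1 * u)
  (3%:R * (1 - a0) + 3%:R * (b1 * u)) (2%:R * (a2 * u * u)) (a1 * u) y0 y1 y2 y3 u0.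
have R2 := @row_bound y2 r2 u (6%:R * n%:R) (2%:R * b0) (4%:R * c0)
  ((a0 - 1) + b1 * u) (- b0) y0 y1 y2 y3 u0.
have R3 := @row_bound y3 (r3 * u) u (6%:R * n%:R) (2%:R * (b1 * u))
  (2%:R * (b0 * (a0 - 1) * u) + 4%:R * (c1 * u)) (a1 * u + 2%:R * (b2 * u * u)) (a0 - 1)
  y0 y1 y2 y3 u0.
have {}R0 : `|y0 - 2%:R * y3| <= e + u * (6%:R * n%:R * S).
  apply: le_trans (R0 _ _ _ _ _) _; last by rewrite lerD2r.
  - by rewrite /r0 /y0 /y1 /y2 /y3 /u; field.
  - exact: w1.
  - by rewrite normrN; apply: (wk 3) => //; apply: (hM).
  - by rewrite normrN; apply: w1; apply: (hu).
  - by rewrite normr0 mulr_ge0.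
have ru (r : K) : `|r| <= e * k%:R -> `|r * u| <= e.
  move=> hr; rewrite normrM (ger0_norm u0); apply: le_trans (ler_wpM2r u0 hr) _.
  by rewrite mulfK.
have {}R1 : `|3%:R * y1| <= e + u * (6%:R * n%:R * S).
  apply: le_trans (R1 _ _ _ _ _) _; last by rewrite lerD2r; apply: ru.
  - by rewrite /r1 /y0 /y1 /y2 /y3 /u; field.
  - by apply: w1; apply: (hu).
  - by apply: w33; apply: (hD); apply: (hM) => //; apply: (hu).
  - by apply: (wk 2) => //; apply: (hM); apply: (hu); apply: (hu).
  - by apply: w1; apply: (hu).
have {}R2 : `|y2| <= e + u * (6%:R * n%:R * S).
  apply: le_trans (R2 _ _ _ _ _) _; last by rewrite lerD2r.
  - by rewrite /r2 /y0 /y1 /y2 /y3 /u; field.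
  - by apply: (wk 2) => //; apply: (hM).
  - by apply: (wk 4) => //; apply: (hM).
  - by apply: w11; apply: (hD) => //; apply: (hu).
  - by rewrite normrN; apply: w1.
have {}R3 : `|y3| <= e + u * (6%:R * n%:R * S).
  apply: le_trans (R3 _ _ _ _ _) _; last by rewrite lerD2r; apply: ru.
  - by rewrite /r3 /y0 /y1 /y2 /y3 /u; field.
  - by apply: (wk 2) => //; apply: (hM); apply: (hu).
  - by apply: w24; apply: (hD); apply: (hM); apply: (hu).
  - by apply: w12; apply: (hD); [apply: (hu) | apply: (hM); apply: (hu); apply: (hu)].
  - exact: w1.
set d := u * (6%:R * n%:R * S) in R0 R1 R2 R3.
(* The last row bounds y3, so the term -2 y3 can be separated from y0 at the cost of a factor 3; the
   four bounds then total 6 (e + d). *)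
have R0' : `|y0| <= e + d + 2%:R * (e + d).
  rewrite -[y0](subrK (2%:R * y3)); apply: le_trans (ler_normD _ _) _; apply: lerD => //.
  exact: hM.
have R1' : `|y1| <= e + d.
  apply: le_trans R1; rewrite [`|3%:R * y1|]normrM normr_nat ler_peMl // ler1n //.
have Sle : S <= 6%:R * e + 6%:R * d.
  have -> : 6%:R * e + 6%:R * d = (e + d + 2%:R * (e + d)) + (e + d) + (e + d) + (e + d) by ring.
  by rewrite /S; do 3!apply: lerD => //.
have dle : 12%:R * d <= S.
  have -> : 12%:R * d = (72 * n)%:R * u * S by rewrite /d natrM; ring.
  rewrite ler_piMl // ler_pdivrMr // mul1r ler_nat //.
rewrite -(lerD2r S); apply: le_trans (_ : 12%:R * e + 12%:R * d <= _); last by rewrite lerD2l.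
have -> : 12%:R * e + 12%:R * d = (6%:R * e + 6%:R * d) + (6%:R * e + 6%:R * d) by ring.
exact: lerD.
Qed.

(** Large k are covered by diagonal dominance, and each of the finitely many others contributes the
    size of its own inverse. The second and fourth entries of s may be k times larger: they come
    from z^1 coefficients, whose majorant has the binomial k + 1. *)
Lemma Lm_bound : exists2 C : K, 0 <= C & forall k (s : 'cV[K]_4) e, (0 < k)%N ->
  `|s 0 0| <= e -> `|s 1 0| <= e * k%:R -> `|s 2%:R 0| <= e -> `|s 3%:R 0| <= e * k%:R ->
  let x := invmx (Lm k) *m s in
  [/\ k%:R ^+ 2 * `|x 0 0| <= C * e, k%:R * `|x 1 0| <= C * e,
      k%:R ^+ 2 * `|x 2%:R 0| <= C * e & k%:R * `|x 3%:R 0| <= C * e].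
Proof.
have [k0 hk0] := Lm_bound_large.
(* Two powers of k for the weights of x, one for the bound e k on the entries of s. *)
pose Ck (k : nat) : K := k%:R ^+ 3 * \sum_(i < 4) \sum_(j < 4) `|invmx (Lm k) i j|.
have Ck0 k : 0 <= Ck k.
  by rewrite mulr_ge0 ?exprn_ge0 // sumr_ge0 // => i _; rewrite sumr_ge0.
exists (12%:R + \sum_(k < k0) Ck k).
  by rewrite addr_ge0 // sumr_ge0.
move=> k s e kpos s0 s1 s2 s3 x.
have e0 : 0 <= e by apply: le_trans s0.
have [lek|ltk] := leqP k0 k.
  have ex : Lm k *m x = s by rewrite /x mulKVmx // Lm_unit.
  have := hk0 k x e lek kpos; rewrite ex => /(_ s0 s1 s2 s3).
  set t0 := _ * `|x 0 0|; set t1 := _ * `|x 1 0|.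
  set t2 := _ * `|x 2%:R 0|; set t3 := _ * `|x 3%:R 0| => le.
  have [p0 p1 p2 p3] : [/\ 0 <= t0, 0 <= t1, 0 <= t2 & 0 <= t3].
    by split; rewrite mulr_ge0 ?exprn_ge0.
  have w (t : K) : t <= t0 + t1 + t2 + t3 -> t <= (12%:R + \sum_(k < k0) Ck k) * e.
    move=> ht; apply: le_trans ht _; apply: le_trans le _.
    by apply: ler_wpM2r => //; rewrite lerDl sumr_ge0.
  split; apply: w.
  - have -> : t0 + t1 + t2 + t3 = t0 + (t1 + t2 + t3) by ring.
    by rewrite lerDl !addr_ge0.
  - have -> : t0 + t1 + t2 + t3 = t1 + (t0 + t2 + t3) by ring.
    by rewrite lerDl !addr_ge0.
  - have -> : t0 + t1 + t2 + t3 = t2 + (t0 + t1 + t3) by ring.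
    by rewrite lerDl !addr_ge0.
  - have -> : t0 + t1 + t2 + t3 = t3 + (t0 + t1 + t2) by ring.
    by rewrite lerDl !addr_ge0.
have sb j : `|s j 0| <= e * k%:R.
  have ek : e <= e * k%:R by rewrite ler_peMr // ler1n.
  case: j => -[|[|[|[|//]]]] lt.
  - have -> : Ordinal lt = 0 by apply/val_inj.
    exact: le_trans ek.
  - by have -> : Ordinal lt = 1 by apply/val_inj.
  - have -> : Ordinal lt = 2%:R by apply/val_inj.
    exact: le_trans ek.
  - by have -> : Ordinal lt = 3%:R by apply/val_inj.
have xb i : k%:R ^+ 2 * `|x i 0| <= Ck k * e.
  have -> : Ck k * e = k%:R ^+ 2 * ((\sum_(i < 4) \sum_(j < 4) `|invmx (Lm k) i j|) * (e * k%:R)).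
    by rewrite /Ck; ring.
  apply: ler_wpM2l; first by rewrite exprn_ge0.
  rewrite mxE; apply: le_trans (ler_norm_sum _ _ _) _.
  rewrite [X in _ <= X * _](bigD1 i) //= mulrDl ler_wpDr //.
    by rewrite mulr_ge0 ?mulr_ge0 // sumr_ge0 // => ? _; rewrite sumr_ge0.
  rewrite mulr_suml; apply: ler_sum => j _; rewrite normrM.
  by apply: ler_wpM2l.
have wC (t : K) : t <= Ck k * e -> t <= (12%:R + \sum_(k < k0) Ck k) * e.
  move=> ht; apply: le_trans ht _; apply: ler_wpM2r => //.
  rewrite (bigD1 (Ordinal ltk)) //= ler_wpDl // lerDl sumr_ge0 // => ? _.
have kk i : k%:R * `|x i 0| <= k%:R ^+ 2 * `|x i 0|.
  by apply: ler_wpM2r => //; rewrite expr2 ler_peMl // ler1n.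
by split; apply: wC => //; apply: le_trans (kk _) _.
Qed.
End LinearBound.

(** * The fixed point map preserves small balls *)

Section Asymptotics.
Variable K : numFieldType.
Notation T := (ser (ser (ser K))).
Notation zT := (zT K).
Notation wT := (wT K).
Notation vT := (vT K).
Variables (p l : K).
Hypotheses (p0 : 0 < p) (l0 : 0 < l).
Variables (I : Type) (q be : I -> K).
Hypothesis q0 : forall i, 0 < q i.
Hypothesis be0 : forall i, 0 < be i.
Hypothesis be1 : forall i, be i <= 1.
Hypothesis qbe : forall i, (q i)^-1 <= be i ^+ 2.
Implicit Types A B : I -> T.
Notation bd := (bd p l).

(* [A = O(be ^ n)] for the majorants of type [(s, t)]; [C * be i <= 1] stands for
   taking [be i] small enough. *)
Definition bigO (s t n : nat) A := exists2 C, 0 <= C &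
  forall i, C * be i <= 1 -> bd (q i) s t (C * be i ^+ n) (A i).

Lemma beX_ge0 i n : 0 <= be i ^+ n. Proof. by apply/exprn_ge0/ltW. Qed.

Lemma le_small (C C' : K) i : C <= C' -> C' * be i <= 1 -> C * be i <= 1.
Proof. by move=> le; apply: le_trans; apply: ler_wpM2r => //; apply: ltW. Qed.

Lemma bigO_W s t n s' t' n' A : (s' <= s)%N -> (t' <= t)%N -> (n' <= n)%N ->
  bigO s t n A -> bigO s' t' n' A.
Proof.
move=> hs ht hn [C C0 h]; exists C => // i /h; apply: bdW => //.
  by rewrite mulr_ge0 ?beX_ge0.
by apply: ler_wpM2l => //; apply: ler_wiXn2l => //; apply: ltW.
Qed.

Lemma bigO_D s t n A B : bigO s t n A -> bigO s t n B -> bigO s t n (fun i => A i + B i).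
Proof.
move=> [C C0 hA] [C' C'0 hB]; exists (C + C'); first exact: addr_ge0.
move=> i small; rewrite mulrDl; apply: bdD; [apply: hA | apply: hB];
  by apply: le_small small; rewrite ?lerDl ?lerDr.
Qed.
Lemma bigO_N s t n A : bigO s t n A -> bigO s t n (fun i => - A i).
Proof. by move=> [C C0 hA]; exists C => // i small; apply/bdN/hA. Qed.
Lemma bigO_B s t n A B : bigO s t n A -> bigO s t n B -> bigO s t n (fun i => A i - B i).
Proof. by move=> hA hB; apply: bigO_D => //; apply: bigO_N. Qed.
Lemma bigO_0 s t n : bigO s t n (fun=> 0).
Proof. by exists 0 => // i _; rewrite mul0r; apply: bd0. Qed.
Lemma bigO_Mn s t n A k : bigO s t n A -> bigO s t n (fun i => A i *+ k).
Proof.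
move=> hA; elim: k => [|k IH].
  by under eq_fun do rewrite mulr0n; apply: bigO_0.
by under eq_fun do rewrite mulrS; apply: bigO_D.
Qed.
Lemma bigO_M s t n m A B : (2 <= s)%N -> (2 <= t)%N ->
  bigO s t n A -> bigO s t m B -> bigO s t (n + m) (fun i => A i * B i).
Proof.
move=> s2 t2 [C C0 hA] [C' C'0 hB].
have KK0 : 0 <= KK K s * KK K t by rewrite mulr_ge0 // ltW ?KK_gt0.
have CC0 : 0 <= KK K s * KK K t * (C * C') by rewrite !mulr_ge0.
exists (C + C' + KK K s * KK K t * (C * C')); first by rewrite !addr_ge0.
move=> i small.
have sA : C * be i <= 1 by apply: le_small small; rewrite -addrA lerDl addr_ge0.
have sB : C' * be i <= 1.
  by apply: le_small small; rewrite addrAC lerDr addr_ge0.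
have := bdM p0 l0 (q0 i) s2 t2 _ _ (hA i sA) (hB i sB).
rewrite !mulr_ge0 ?beX_ge0 // => /(_ isT isT).
apply: bdW => //; first by rewrite !mulr_ge0 ?beX_ge0 // ltW ?KK_gt0.
have -> : KK K s * KK K t * (C * be i ^+ n * (C' * be i ^+ m)) =
  KK K s * KK K t * (C * C') * (be i ^+ n * be i ^+ m) by ring.
rewrite -exprD; apply: ler_wpM2r; first exact: beX_ge0.
by rewrite lerDr addr_ge0.
Qed.
Lemma bigO_Dw s t n A : bigO s.+1 t n A -> bigO s t n (fun i => Dw (A i)).
Proof.
move=> [C C0 hA]; exists C => // i small; apply: (bd_Dw p0 l0 (q0 i)) (hA i small).
by rewrite mulr_ge0 ?beX_ge0.
Qed.
Lemma bigO_dz s t n A : bigO s.+1 t n A -> bigO s t n (fun i => dz (A i)).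
Proof.
move=> [C C0 hA]; exists (C + C * p).
  by rewrite addr_ge0 // mulr_ge0 // ltW.
move=> i small; have Cp : 0 <= C * p by rewrite mulr_ge0 // ltW.
have := bd_dz p0 l0 (q0 i) _ (hA i (le_small _ small)).
rewrite lerDl Cp mulr_ge0 ?beX_ge0 // => /(_ isT isT).
apply: bdW => //; first by rewrite !mulr_ge0 ?beX_ge0 // ltW.
by rewrite mulrAC ler_wpM2r ?beX_ge0 // lerDr.
Qed.
Lemma bigO_dv s t n A : bigO s t.+1 n A -> bigO s t n (fun i => dv (A i)).
Proof.
move=> [C C0 hA]; exists (C + C * l).
  by rewrite addr_ge0 // mulr_ge0 // ltW.
move=> i small; have Cp : 0 <= C * l by rewrite mulr_ge0 // ltW.
have := bd_dv p0 l0 (q0 i) _ (hA i (le_small _ small)).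
rewrite lerDl Cp mulr_ge0 ?beX_ge0 // => /(_ isT isT).
apply: bdW => //; first by rewrite !mulr_ge0 ?beX_ge0 // ltW.
by rewrite mulrAC ler_wpM2r ?beX_ge0 // lerDr.
Qed.
Lemma bigO_slice s t n j A : bigO s t n A -> bigO s t n (fun i => slice j (A i)).
Proof.
move=> [C C0 hA]; exists (C + C * l ^+ j).
  by rewrite addr_ge0 // mulr_ge0 // exprn_ge0 // ltW.
move=> i small; have Cp : 0 <= C * l ^+ j by rewrite mulr_ge0 // exprn_ge0 // ltW.
have := bd_slice p0 l0 (q0 i) j _ (hA i (le_small _ small)).
rewrite lerDl Cp mulr_ge0 ?beX_ge0 // => /(_ isT isT).
apply: bdW => //; first by rewrite !mulr_ge0 ?beX_ge0 // exprn_ge0 // ltW.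
by rewrite mulrAC ler_wpM2r ?beX_ge0 // lerDr.
Qed.
Lemma bigO_cst s t (A0 : T) (C : K) :
  0 <= C -> (forall i, bd (q i) s t C A0) -> bigO s t 0 (fun=> A0).
Proof. by move=> C0 h; exists C => // i _; rewrite expr0 mulr1. Qed.

Lemma bd_monomial q' s t a b c (A : T) : 0 < q' ->
  (forall i j k, `|A i j k| <= [&& i == a, j == b & k == c]%N%:R) ->
  bd q' s t (mw p l q' s t a b c)^-1 A.
Proof.
move=> q'0 h i j k; apply: le_trans (h i j k) _.
have m0 a' b' c' : 0 < mw p l q' s t a' b' c'.
  by rewrite !mulr_gt0 ?exprn_gt0 ?wt_gt0 // ltr0n bin_gt0 leq_addr.
case: eqP => [->|_] /=; last by rewrite mulr_ge0 ?invr_ge0 // ltW.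
case: eqP => [->|_] /=; last by rewrite mulr_ge0 ?invr_ge0 // ltW.
case: eqP => [->|_] /=; last by rewrite mulr_ge0 ?invr_ge0 // ltW.
by rewrite mulVf // gt_eqF.
Qed.
Lemma mw_b0 q' s t a c : mw p l q' s t a 0 c = mw p l 1 s t a 0 c.
Proof. by rewrite /mw !expr0. Qed.
Lemma mw_gt0 q' s t a b c : 0 < q' -> 0 < mw p l q' s t a b c.
Proof. by move=> q'0; rewrite !mulr_gt0 ?exprn_gt0 ?wt_gt0 // ltr0n bin_gt0 leq_addr. Qed.

Lemma bigO_monomial s t a c (A0 : T) :
  (forall i j k, `|A0 i j k| <= [&& i == a, j == 0 & k == c]%N%:R) -> bigO s t 0 (fun=> A0).
Proof.
move=> h; apply: (@bigO_cst _ _ _ (mw p l 1 s t a 0 c)^-1).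
  by rewrite invr_ge0 ltW // mw_gt0.
by move=> i; rewrite -(mw_b0 (q i)); apply: bd_monomial.
Qed.
Lemma bigO_1 s t : bigO s t 0 (fun=> 1).
Proof. by apply: (@bigO_monomial _ _ 0 0) => i j k; rewrite c31 normr_nat. Qed.
Lemma bigO_v s t : bigO s t 0 (fun=> vT).
Proof. by apply: (@bigO_monomial _ _ 0 1) => i j k; rewrite vTE normr_nat. Qed.
(** The majorant bounds w by a multiple of 1/q, and [qbe] makes this of second order. *)
Lemma bigO_w s t : bigO s t 2 (fun=> wT).
Proof.
exists (mw p l 1 s t 0 1 0)^-1; first by rewrite invr_ge0 ltW // mw_gt0.
move=> i _.
have := @bd_monomial (q i) s t 0 1 0 wT (q0 i).
have -> : (mw p l (q i) s t 0 1 0) = mw p l 1 s t 0 1 0 * q i.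
  by rewrite /mw !expr1 expr0; ring.
rewrite invfM => h; apply: bdW (h _) => //.
- by rewrite mulr_ge0 ?invr_ge0 // ltW // mw_gt0.
- by apply: ler_wpM2l => //; rewrite invr_ge0 ltW // mw_gt0.
by move=> a b c; rewrite wTE normr_nat.
Qed.

Variable E : T.
Hypothesis Lm_unit : forall k, (0 < k)%N -> Lm E k \in unitmx.
Hypothesis arch : forall x : K, exists n : nat, `|x| <= n%:R.
Notation mu := (mu E).
Notation lin_p := (lin_p E).
Notation lin_f := (lin_f E).
Notation KKK := (KKK K).

Variables (M R k : K).
Hypotheses (M0 : 0 <= M) (R0 : 0 <= R) (k0 : 0 < k) (kR : 12%:R * k * R <= 1).
Hypothesis PsiM : forall a b c, `|Psi E a b c| <= M * R ^+ (a + b + c).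
Hypothesis z_small : forall i, bd (q i) 3 2 (k / KKK) zT.
Hypothesis v_small : forall i, bd (q i) 3 2 (k / KKK) vT.
Hypothesis mu_O : bigO 4 3 0 (fun=> mu).

Lemma bigO_comp_remainder (f g r : I -> T) :
  (forall i, van wdeg 1 (f i)) -> (forall i, van wdeg 1 (g i)) -> (forall i, van wdeg 1 (r i)) ->
  bigO 3 2 1 f -> bigO 3 2 2 g -> bigO 3 2 1 r ->
  bigO 3 2 2 (fun i => comp (Psi E) (zT + f i) (g i) (vT + r i) - mu - (dz mu * f i + dv mu * r i)).
Proof.
move=> vf vg vr [c1 c10 hf] [c2 c20 hg] [c3 c30 hr].
have KK0 := KKK_gt0 K; have KK1 := ltW KK0; have k1 := ltW k0.
pose c := c1 + c2 + c3; have cge0 : 0 <= c by rewrite !addr_ge0.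
(* [comp_remainder] is applied with [C * be] for [be]. The last summand makes k C / [KKK] at least
   c, as [Qn] requires for f and r; C >= 1 then covers g, where C occurs squared. *)
pose C := 1 + c + c * KKK / k.
have cK0 : 0 <= c * KKK / k by rewrite divr_ge0 // mulr_ge0.
have C0 : 0 <= C by rewrite !addr_ge0.
have C1 : 1 <= C by rewrite /C -addrA lerDl addr_ge0.
have cC : c <= C by rewrite /C addrAC lerDr addr_ge0.
pose D := 288%:R * M * KKK ^+ 3 * C ^+ 2 / KKK.
have D0 : 0 <= D by rewrite /D divr_ge0 // !mulr_ge0 // ?exprn_ge0.
exists (C + D); first by rewrite addr_ge0.
move=> i small.
have sC : C * be i <= 1 by apply: le_small small; rewrite lerDl.
have sc (x : K) : x <= c -> x * be i <= 1.
  by move=> le; apply: le_small sC; apply: le_trans cC.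
have [l1 l2 l3] : [/\ c1 <= c, c2 <= c & c3 <= c].
  split; rewrite /c; first by rewrite -addrA lerDl addr_ge0.
    by rewrite addrAC lerDr addr_ge0.
  by rewrite lerDr addr_ge0.
have cb0 : 0 <= C * be i by rewrite mulr_ge0 // ltW.
have ck (x : K) : x <= c -> x <= k * C / KKK.
  move=> le; apply: le_trans le _; rewrite ler_pdivlMr // mulrC -ler_pdivrMl //.
  by rewrite mulrCA mulrA mulrC mulrA /C lerDr addr_ge0.
have b2 := beX_ge0 i 2.
have hQf : Qn p l (q i) (C * be i) (zT + f i) zT (f i) k.
  split=> //; first exact: z_small.
    have := hf i (sc _ l1); rewrite expr1; apply: bdW => //.
      by rewrite mulr_ge0 // ltW.
    by rewrite mulrA mulrAC; apply: ler_wpM2r; [apply: ltW | apply: ck].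
  by rewrite addKl subrr; apply: nb0; rewrite // mulr_ge0 // ?exprn_ge0.
have hQr : Qn p l (q i) (C * be i) (vT + r i) vT (r i) k.
  split=> //; first exact: v_small.
    have := hr i (sc _ l3); rewrite expr1; apply: bdW => //.
      by rewrite mulr_ge0 // ltW.
    by rewrite mulrA mulrAC; apply: ler_wpM2r; [apply: ltW | apply: ck].
  by rewrite addKl subrr; apply: nb0; rewrite // mulr_ge0 // ?exprn_ge0.
have hQg : Qn p l (q i) (C * be i) (g i) 0 0 k.
  split=> //; first by apply: nb0.
    by apply: nb0; rewrite // mulr_ge0.
  rewrite !subr0; have := hg i (sc _ l2); apply: bdW => //.
    by rewrite mulr_ge0.
  have -> : k * (C * be i) ^+ 2 / KKK = (k * C / KKK * C) * be i ^+ 2 by ring.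
  apply: ler_wpM2r => //; apply: le_trans (ck _ l2) _.
  by rewrite ler_peMr // divr_ge0 // mulr_ge0.
have t1 (A : T) : van wdeg 1 A -> van tdeg 1 (zT + A).
  by move=> vA; apply: vanD; [apply: tdeg_zT | apply: van_tdeg].
have t2 (A : T) : van wdeg 1 A -> van tdeg 1 (vT + A).
  by move=> vA; apply: vanD; [apply: tdeg_vT | apply: van_tdeg].
have := comp_remainder p0 l0 (q0 i) cb0 sC M0 R0 k1 kR PsiM (t1 _ (vf i))
  (van_tdeg (vg i)) (t2 _ (vr i)) hQf hQg hQr.
rewrite /nb -/mu; apply: bdW => //.
  by rewrite divr_ge0 // !mulr_ge0 // ltW.
have -> : 288%:R * M * KKK ^+ 3 * (C * be i) ^+ 2 / KKK = D * be i ^+ 2 by rewrite /D; ring.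
by apply: ler_wpM2r => //; rewrite lerDr.
Qed.

Lemma le_sum4 (a b c d : K) : 0 <= a -> 0 <= b -> 0 <= c -> 0 <= d ->
  [/\ a <= a + b + c + d, b <= a + b + c + d, c <= a + b + c + d & d <= a + b + c + d].
Proof.
move=> a0 b0 c0 d0; split; last by rewrite lerDr !addr_ge0.
- by rewrite -!addrA lerDl !addr_ge0.
- by rewrite -!addrA addrCA lerDl !addr_ge0.
- by rewrite addrAC lerDr !addr_ge0.
Qed.

Lemma bigO_M0 s t n A B : (2 <= s)%N -> (2 <= t)%N ->
  bigO s t n A -> bigO s t 0 B -> bigO s t n (fun i => A i * B i).
Proof. by move=> s2 t2 hA hB; rewrite -[n]addn0; apply: bigO_M. Qed.

Lemma bigO_dl n f : bigO 5 3 n f -> bigO 4 3 n (fun i => dl (f i)).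
Proof.
move=> hf; apply: bigO_D; first exact: bigO_dz.
by apply: (bigO_M (n := 0)) => //; [apply: bigO_v | apply: bigO_Dw].
Qed.

Lemma bigO_lin_p n A : bigO 4 3 n A -> bigO 3 2 n (fun i => lin_p (A i)).
Proof.
move=> hA; have W s t B : (3 <= s)%N -> (2 <= t)%N -> bigO s t n B -> bigO 3 2 n B.
  by move=> hs ht; apply: bigO_W.
have hm : bigO 3 2 0 (fun=> mu) by apply: bigO_W mu_O.
apply: bigO_B; last first.
  apply: bigO_M0 => //; first exact: W hA.
  by apply: (bigO_W (s := 4) (t := 2) (n := 0)) => //; apply: bigO_dv.
apply: bigO_D; last first.
  apply: (bigO_M (n := 0)) => //; first exact: bigO_v.
  by apply: (W 3 3) => //; apply: bigO_Dw.
apply: bigO_D; last by apply: (W 3 3) => //; apply: bigO_dz.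
apply: (bigO_M (n := 0)) => //.
by apply: (W 4 2) => //; apply: bigO_dv.
Qed.

Lemma bigO_lin_f n f : bigO 5 3 n f -> bigO 3 2 n (fun i => lin_f (f i)).
Proof.
move=> hf; have hm : bigO 3 2 0 (fun=> mu) by apply: bigO_W mu_O.
apply: bigO_D; apply: bigO_M0 => //.
- by apply: bigO_W (bigO_dl hf).
- by apply: bigO_W hf.
by apply: (bigO_W (s := 3) (t := 3) (n := 0)) => //; apply: bigO_dz.
Qed.

Lemma bigO_ell n f h : bigO 5 3 n f -> bigO 5 3 n h -> bigO 4 3 n (fun i => ell (f i) (h i)).
Proof.
move=> hf hh; apply: bigO_D; first exact: bigO_dz.
apply: (bigO_M (n := 0)) => //; first exact: bigO_v.
apply: bigO_B; first by apply: bigO_B; [apply: bigO_Dw | apply: bigO_dz].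
by apply: (bigO_M (n := 0)) => //; [apply: bigO_v | apply: bigO_Dw].
Qed.

(** The analogue of [bigO] for Cauchy data: q^b [wt] s b is the majorant [mw] at a = c = 0. *)
Definition Oseq (s n : nat) (x : I -> nat -> K) := exists2 C, 0 <= C &
  forall i, C * be i <= 1 -> forall b, (0 < b)%N ->
    `|x i b| <= C * be i ^+ n * (q i ^+ b * wt K s b).

(** Because (a+1)(a+2) 'C(a+b+2, a+2) = (a+b+1)(a+b+2) 'C(a+b, a), integrating twice in z gains two
    units of s in the total degree, which pays even for w-derivatives. For x1 the exponent 4
    suffices, as the binomial at a = 1 is b + 1. The exponent 3 for zeta is free, the result being
    zeta-free. *)
Lemma bd_integ (q' C0 C1 C2 d2 d3 : K) t x0 x1 g : 0 <= d2 -> 0 <= d3 ->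
  (forall n, wt K 5 n <= d2 * wt K 5 n.+1) -> (forall n, wt K 5 n <= d3 * wt K 5 n.+2) ->
  0 < q' -> 0 <= C0 -> 0 <= C1 -> 0 <= C2 ->
  (forall b, (0 < b)%N -> `|x0 b| <= C0 * (q' ^+ b * wt K 5 b)) ->
  (forall b, (0 < b)%N -> `|x1 b| <= C1 * (q' ^+ b * wt K 4 b)) ->
  bd q' 3 t C2 g ->
  bd q' 5 3 (C0 + C1 * d2 / p + C2 * d3 / p ^+ 2) (integ x0 x1 g).
Proof.
move=> d20 d30 hd2 hd3 q'0 C00 C10 C20 h0 h1 hg.
pose C := C0 + C1 * d2 / p + C2 * d3 / p ^+ 2.
have t1 : 0 <= C1 * d2 / p by rewrite divr_ge0 ?mulr_ge0 // ltW.
have t2 : 0 <= C2 * d3 / p ^+ 2 by rewrite divr_ge0 ?mulr_ge0 ?exprn_ge0 // ltW.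
have Cge0 : 0 <= C by rewrite !addr_ge0.
have [L0 L1 L2] : [/\ C0 <= C, C1 * d2 / p <= C & C2 * d3 / p ^+ 2 <= C].
  split; rewrite /C; first by rewrite -addrA lerDl addr_ge0.
    by rewrite addrAC lerDr addr_ge0.
  by rewrite lerDr addr_ge0.
rewrite -/C => a b c; have mw0 := mw_ge0 p0 l0 5 3 a b c q'0.
rewrite /integ; case: ifP => [_|/negbT]; first by rewrite normr0 mulr_ge0.
rewrite negb_or negbK -lt0n => /andP[/eqP-> b0] {c mw0}.
case: a => [|[|a]].
- apply: le_trans (h0 b b0) _; apply: ler_pM => //.
    by rewrite mulr_ge0 ?wt_ge0 // ?exprn_ge0 // ltW.
  by rewrite /mw bin0 /wt !exp1n !expr0 invr1 !mul1r !mulr1 mulrC.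
- apply: le_trans (h1 b b0) _.
  apply: le_trans (_ : (C1 * d2 / p) * mw p l q' 5 3 1 b 0 <= _); last first.
    by apply: ler_wpM2r => //; apply: mw_ge0.
  rewrite /mw bin1 add1n /wt !exp1n invr1 expr1 expr0 !mulr1.
  have -> : C1 * d2 / p * (b.+1%:R * (b.+2 ^ 5)%:R^-1 * (p * q' ^+ b)) =
    C1 * (q' ^+ b * (b.+1%:R * (d2 * (b.+2 ^ 5)%:R^-1))).
    by move: (b.+1%:R) ((b.+2 ^ 5)%:R^-1) => *; field; rewrite gt_eqF.
  apply: ler_wpM2l => //; apply: ler_wpM2l; first by rewrite ?exprn_ge0 // ltW.
  apply: le_trans (_ : b.+1%:R * (b.+1 ^ 5)%:R^-1 <= _).
    rewrite [(b.+1 ^ 5)%N]expnS natrM invfM mulrA mulfV ?mul1r //.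
    by rewrite pnatr_eq0.
  by apply: ler_wpM2l => //; apply: hd2.
apply: le_trans (_ : (C2 * d3 / p ^+ 2) * mw p l q' 5 3 a.+2 b 0 <= _); last first.
  by apply: ler_wpM2r => //; apply: mw_ge0.
rewrite normrM normfV normr_nat ler_pdivrMr ?ltr0n ?muln_gt0 //.
apply: le_trans (hg a b 0%N) _.
rewrite /mw !expr0 !mulr1 -![_ * wt K _ 0]mulrA.
have -> : wt K t 0 = 1 by rewrite /wt exp1n invr1.
have -> : wt K 3 0 = 1 by rewrite /wt exp1n invr1.
rewrite !mulr1 !addSn.
have eb : ((a.+1 * a.+2)%:R * 'C((a + b).+2, a.+2)%:R : K) =
    ((a + b).+1 * (a + b).+2)%:R * 'C(a + b, a)%:R.
  rewrite -!natrM; congr (_%:R).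
  have e1 := mul_bin_diag (a + b).+2 a.+1; have e2 := mul_bin_diag (a + b).+1 a.
  by rewrite -mulnA -e1 mulnCA -e2 mulnA [(_.+2 * _)%N]mulnC.
set n := (a + b)%N in eb *.
have -> : C2 * d3 / p ^+ 2 * ('C(n.+2, a.+2)%:R * wt K 5 n.+2 * (p ^+ a.+2 * q' ^+ b))
    * (a.+1 * a.+2)%:R =
  C2 * (d3 * wt K 5 n.+2) / p ^+ 2 *
    (((a.+1 * a.+2)%:R * 'C(n.+2, a.+2)%:R) * (p ^+ a.+2 * q' ^+ b)).
  by move: ((a.+1 * a.+2)%:R) ('C(_, _)%:R) (p ^+ a.+2) => *; ring.
rewrite eb !exprS.
have -> : C2 * (d3 * wt K 5 n.+2) / (p * (p * p ^+ 0)) *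
   ((n.+1 * n.+2)%:R * 'C(n, a)%:R * (p * (p * p ^+ a) * q' ^+ b)) =
  C2 * ('C(n, a)%:R * ((n.+1 * n.+2)%:R * (d3 * wt K 5 n.+2)) * (p ^+ a * q' ^+ b)).
  move: ((n.+1 * n.+2)%:R) ('C(_, _)%:R) (p ^+ a) => *.
  by rewrite expr0; field; rewrite gt_eqF.
apply: ler_wpM2l => //; apply: ler_wpM2r; first by rewrite mulr_ge0 // ?exprn_ge0 // ltW.
apply: ler_wpM2l => //.
apply: le_trans (_ : (n.+1 * n.+2)%:R * wt K 5 n <= _); last first.
  by apply: ler_wpM2l => //; apply: hd3.
rewrite /wt ler_pdivlMr ?ltr0n ?expn_gt0 //.
rewrite [(n.+1 ^ 5)%N](_ : _ = (n.+1 ^ 2 * n.+1 ^ 3)%N); last by rewrite -expnD.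
rewrite natrM mulrCA mulVf ?mulr1 ?pnatr_eq0 ?expn_eq0 // ler_nat.
by rewrite -mulnn leq_mul2l leqnSn orbT.
Qed.

Lemma bigO_integ n t (x0 x1 : I -> nat -> K) g : Oseq 5 n x0 -> Oseq 4 n x1 -> bigO 3 t n g ->
  bigO 5 3 n (fun i => integ (x0 i) (x1 i) (g i)).
Proof.
move=> [C0 C00 h0] [C1 C10 h1] [C2 C20 h2].
have [d2 d20 hd2] : exists2 d : K, 0 <= d & forall m, wt K 5 m <= d * wt K 5 m.+1.
  by exists (2 ^ 5)%:R => [|m]; [exact: ler0n | apply: wt_comp; lia].
have [d3 d30 hd3] : exists2 d : K, 0 <= d & forall m, wt K 5 m <= d * wt K 5 m.+2.
  by exists (3 ^ 5)%:R => [|m]; [exact: ler0n | apply: wt_comp; lia].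
have t1 : 0 <= C1 * d2 / p by rewrite divr_ge0 ?mulr_ge0 // ltW.
have t2 : 0 <= C2 * d3 / p ^+ 2 by rewrite divr_ge0 ?mulr_ge0 ?exprn_ge0 // ltW.
pose D := C0 + C1 * d2 / p + C2 * d3 / p ^+ 2.
have D0 : 0 <= D by rewrite !addr_ge0.
pose C := D + C0 + C1 + C2.
exists C; first by rewrite !addr_ge0.
move=> i small; have sm (x : K) : x <= C -> x * be i <= 1 by move=> le; apply: le_small small.
have [LD L0 L1 L2] := le_sum4 D0 C00 C10 C20; rewrite -/C in LD L0 L1 L2.
have bn := beX_ge0 i n.
have := bd_integ d20 d30 hd2 hd3 (q0 i) (mulr_ge0 C00 bn) (mulr_ge0 C10 bn) (mulr_ge0 C20 bn)
  (h0 i (sm _ L0)) (h1 i (sm _ L1)) (h2 i (sm _ L2)).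
apply: bdW => //.
  by rewrite !addr_ge0 ?divr_ge0 ?mulr_ge0 ?exprn_ge0 // ltW.
have -> : C0 * be i ^+ n + C1 * be i ^+ n * d2 / p + C2 * be i ^+ n * d3 / p ^+ 2
  = D * be i ^+ n by rewrite /D; ring.
exact: ler_wpM2r.
Qed.
Lemma wt_shift s r k1 : (0 < k1)%N ->
  wt K s k1 <= (2 ^ r)%:R * k1%:R ^+ r * wt K (s + r) k1.
Proof.
move=> kpos; rewrite /wt ler_pdivlMr ?ltr0n ?expn_gt0 // expnD natrM mulrA.
rewrite mulVf ?mul1r ?pnatr_eq0 ?expn_eq0 // -natrX -natrM ler_nat -expnMn.
by case: r => // r; rewrite leq_exp2r //; lia.
Qed.

Lemma bigO_sol_cauchy n S : bigO 3 2 n S ->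
  [/\ Oseq 5 n (fun i b => sol_cauchy E (S i) b 0 0),
      Oseq 4 n (fun i b => sol_cauchy E (S i) b 1 0),
      Oseq 5 n (fun i b => sol_cauchy E (S i) b 2%:R 0) &
      Oseq 4 n (fun i b => sol_cauchy E (S i) b 3%:R 0)].
Proof.
move=> [C C0 hS]; have [CL CL0 hL] := Lm_bound arch Lm_unit.
pose b0 := E 0%N 0%N 3%N; pose c0 := E 0%N 0%N 4%N.
(* One summand for each entry of [cauchy_rhs]. The factor 2 p belongs to the z^1 coefficients, where
   b + 1 <= 2 b. *)
pose G := l ^+ 2 + l ^+ 3 + (2%:R * p * l ^+ 2 + 3%:R * `|b0| + 2%:R * l)
  + (2%:R * p * l ^+ 3 + 4%:R * `|c0| + `|b0| * l).
have lp := ltW l0; have pp := ltW p0.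
have G0 : 0 <= G by rewrite !addr_ge0 ?mulr_ge0 ?exprn_ge0.
pose D := C + 4%:R * CL * G * C.
have X0 : 0 <= 4%:R * CL * G * C by rewrite !mulr_ge0.
have D0 : 0 <= D by rewrite addr_ge0.
have main i : D * be i <= 1 -> forall b, (0 < b)%N ->
   [/\ `|sol_cauchy E (S i) b 0 0| <= D * be i ^+ n * (q i ^+ b * wt K 5 b),
       `|sol_cauchy E (S i) b 1 0| <= D * be i ^+ n * (q i ^+ b * wt K 4 b),
       `|sol_cauchy E (S i) b 2%:R 0| <= D * be i ^+ n * (q i ^+ b * wt K 5 b) &
       `|sol_cauchy E (S i) b 3%:R 0| <= D * be i ^+ n * (q i ^+ b * wt K 4 b)].
  move=> small b bpos.
  have {}hS := hS i (le_small (_ : C <= D) small).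
  rewrite lerDl in hS; have {}hS := hS X0.
  have bn := beX_ge0 i n; have qb : 0 <= q i ^+ b by rewrite exprn_ge0 // ltW.
  pose A0 := C * be i ^+ n * (q i ^+ b * wt K 3 b).
  have A00 : 0 <= A0 by rewrite !mulr_ge0 ?wt_ge0.
  have wt1 c : wt K 2 c <= 1 by rewrite invf_le1 ?ler1n ?ltr0n ?expn_gt0.
  have lc c : 0 <= l ^+ c by rewrite exprn_ge0.
  have hS0 c : `|S i 0%N b c| <= A0 * l ^+ c.
    apply: le_trans (hS 0%N b c) _; rewrite /mw bin0 add0n expr0 !mul1r.
    have -> : C * be i ^+ n * (wt K 3 b * wt K 2 c * (q i ^+ b * l ^+ c)) =
      A0 * l ^+ c * wt K 2 c by rewrite /A0; ring.
    by rewrite ler_piMr // mulr_ge0.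
  have hS1 c : `|S i 1%N b c| <= A0 * (2%:R * p * l ^+ c * b%:R).
    apply: le_trans (hS 1%N b c) _; rewrite /mw bin1 add1n expr1.
    have -> : C * be i ^+ n * (b.+1%:R * wt K 3 b.+1 * wt K 2 c * (p * q i ^+ b * l ^+ c)) =
      C * be i ^+ n * q i ^+ b * p * l ^+ c * (b.+1%:R * wt K 3 b.+1 * wt K 2 c).
      by move: (b.+1%:R) => x; ring.
    have -> : A0 * (2%:R * p * l ^+ c * b%:R) =
      C * be i ^+ n * q i ^+ b * p * l ^+ c * ((2 * b)%:R * wt K 3 b).
      by rewrite natrM /A0; ring.
    apply: ler_wpM2l; first by rewrite !mulr_ge0.
    apply: le_trans (_ : b.+1%:R * wt K 3 b.+1 <= _).
      by rewrite ler_piMr // mulr_ge0 // wt_ge0.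
    apply: ler_pM; [exact: ler0n | exact: wt_ge0 | | exact: wt_anti].
    by rewrite ler_nat mul2n -addnn -addn1 leq_add2l.
  pose e := A0 * G.
  have b1 : 1 <= b%:R :> K by rewrite ler1n.
  have up (x : K) : 0 <= x -> x <= x * b%:R by move=> x0; rewrite ler_peMr.
  have eb (x : K) : 0 <= x -> x <= G -> A0 * x <= e by move=> _ le; apply: ler_wpM2l.
  pose G3 := 2%:R * p * l ^+ 2 + 3%:R * `|b0| + 2%:R * l.
  pose G4 := 2%:R * p * l ^+ 3 + 4%:R * `|c0| + `|b0| * l.
  have [g1 g2 g3 g4] : [/\ 0 <= l ^+ 2, 0 <= l ^+ 3, 0 <= G3 & 0 <= G4].
    by split; rewrite ?addr_ge0 ?mulr_ge0.
  have GE : G = l ^+ 2 + l ^+ 3 + G3 + G4 by [].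
  have [G1le G2le G3le G4le] := le_sum4 g1 g2 g3 g4; rewrite -GE in G1le G2le G3le G4le.
  have hM (x y m1 m2 : K) : `|x| <= m1 -> `|y| <= m2 -> `|x * y| <= m1 * m2.
    by move=> hx hy; rewrite normrM; apply: ler_pM.
  have s0 : `|cauchy_rhs E (S i) b 0 0| <= e.
    by rewrite mxE /=; apply: le_trans (hS0 2%N) _; apply: eb.
  have s2 : `|cauchy_rhs E (S i) b 2%:R 0| <= e.
    by rewrite mxE /= normrN; apply: le_trans (hS0 3%N) _; apply: eb.
  have s1 : `|cauchy_rhs E (S i) b 1 0| <= e * b%:R.
    rewrite mxE /=.
    apply: le_trans (_ : A0 * (2%:R * p * l ^+ 2 * b%:R) + 3%:R * `|b0| * (A0 * l ^+ 0)
       + 2%:R * b%:R * (A0 * l ^+ 1) <= _).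
      apply: le_trans (ler_normD _ _) _; apply: lerD.
        apply: le_trans (ler_normB _ _) _; rewrite normrN; apply: lerD => //.
        by apply: (hM); rewrite // normrM normr_nat.
      by apply: (hM); rewrite // normrM !normr_nat.
    rewrite expr0 expr1 mulr1.
    apply: le_trans (_ : A0 * (G3 * b%:R) <= _).
      have -> : A0 * (G3 * b%:R) = A0 * (2%:R * p * l ^+ 2 * b%:R)
        + 3%:R * `|b0| * A0 * b%:R + 2%:R * b%:R * (A0 * l) by rewrite /G3; ring.
      by rewrite lerD2r lerD2l; apply: up; rewrite !mulr_ge0 ?wt_ge0.
    by rewrite mulrA ler_wpM2r // eb.
  have s3 : `|cauchy_rhs E (S i) b 3%:R 0| <= e * b%:R.
    rewrite mxE /=.
    apply: le_trans (_ : A0 * (2%:R * p * l ^+ 3 * b%:R) + 4%:R * `|c0| * (A0 * l ^+ 0)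
       + `|b0| * (A0 * l ^+ 1) <= _).
      apply: le_trans (ler_normB _ _) _; apply: lerD; last exact: hM.
      apply: le_trans (ler_normB _ _) _; rewrite normrN; apply: lerD => //.
      by apply: (hM); rewrite // normrM normr_nat.
    rewrite expr0 expr1 mulr1.
    apply: le_trans (_ : A0 * (G4 * b%:R) <= _).
      have -> : A0 * (G4 * b%:R) = A0 * (2%:R * p * l ^+ 3 * b%:R)
        + 4%:R * `|c0| * A0 * b%:R + `|b0| * (A0 * l) * b%:R by rewrite /G4; ring.
      by apply: lerD; [rewrite lerD2l|]; apply: up; rewrite !mulr_ge0 ?wt_ge0.
    by rewrite mulrA ler_wpM2r // eb.
  have [o0 o1 o2 o3] := hL b (cauchy_rhs E (S i) b) e bpos s0 s1 s2 s3.
  have bp r : 0 < b%:R ^+ r :> K by rewrite exprn_gt0 // ltr0n.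
  (* A factor b^r is worth r units of s by [wt_shift]: two for h and f, one for h_z and f_z. *)
  have fin r (x : K) : (r <= 2)%N -> b%:R ^+ r * `|x| <= CL * e ->
      `|x| <= D * be i ^+ n * (q i ^+ b * wt K (3 + r) b).
    move=> r2 hx; rewrite -(ler_pM2l (bp r)); apply: le_trans hx _.
    apply: le_trans (_ : CL * G * C * (be i ^+ n * q i ^+ b) * wt K 3 b <= _).
      by rewrite /e /A0 [leLHS](_ : _ = CL * G * C * (be i ^+ n * q i ^+ b) * wt K 3 b) //; ring.
    apply: le_trans (_ : CL * G * C * (be i ^+ n * q i ^+ b) *
       (4%:R * b%:R ^+ r * wt K (3 + r) b) <= _).
      apply: ler_wpM2l; first by rewrite !mulr_ge0.
      apply: le_trans (wt_shift 3 r bpos) _.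
      apply: ler_wpM2r; first exact: wt_ge0.
      apply: ler_wpM2r; first exact: ltW.
      rewrite ler_nat.
      by rewrite -[4%N]/(2 ^ 2)%N leq_pexp2l.
    have -> : CL * G * C * (be i ^+ n * q i ^+ b) * (4%:R * b%:R ^+ r * wt K (3 + r) b) =
      b%:R ^+ r * ((4%:R * CL * G * C) * (be i ^+ n * (q i ^+ b * wt K (3 + r) b))) by ring.
    apply: ler_wpM2l; first exact: ltW.
    rewrite -[leRHS]mulrA; apply: ler_wpM2r; last by rewrite /D lerDr.
    by rewrite !mulr_ge0 ?wt_ge0.
  split; [exact: (fin 2) o0 | apply: (fin 1%N) => // | exact: (fin 2) o2 | apply: (fin 1%N) => //].
  by split; exists D => // i small b bpos; case: (main i small b bpos).
Qed.

Lemma bigO_sol_h n S : bigO 3 2 n S -> bigO 5 3 n (fun i => sol_h E (S i)).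
Proof. by move=> hS; have [x0 x1 _ _] := bigO_sol_cauchy hS; apply: bigO_integ hS. Qed.

Lemma bigO_sol_fzz n S : bigO 3 2 n S -> bigO 3 2 n (fun i => sol_fzz E (S i)).
Proof.
move=> hS; have hh := bigO_sol_h hS; have hd := bigO_dz hh.
have hm : bigO 3 2 0 (fun=> mu2 E).
  by apply: (bigO_slice 2); apply: bigO_W mu_O.
apply: bigO_B; last exact: (bigO_slice 1).
apply: bigO_B; apply: bigO_Mn.
  by apply: (bigO_W (s := 3) (t := 3) (n := n)) => //; apply: bigO_Dw.
by apply: (bigO_M (n := 0)) => //; apply: bigO_W hd.
Qed.

Lemma bigO_sol_f n S : bigO 3 2 n S -> bigO 5 3 n (fun i => sol_f E (S i)).
Proof.
move=> hS; have [_ _ x2 x3] := bigO_sol_cauchy hS; have hg := bigO_sol_fzz hS.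
by apply: (bigO_integ (t := 2)).
Qed.

(** The exponents follow the derivatives: f and h gain two over the remainder, [ell] gives one back
    for p, [lin_p] a second one, and one unit of t, for m. *)
Definition in_ball (q' b : K) (y : quad K) :=
  [/\ bd q' 5 3 b (qf y), bd q' 5 3 b (qh y), bd q' 4 3 b (qp y) & bd q' 3 2 b (qm y)].

Variable y : I -> quad K.
Hypothesis y_van : forall i, vanq 1 (y i).
Hypothesis y_ball : forall i, in_ball (q i) (be i) (y i).

Lemma bigO_ball : [/\ bigO 5 3 1 (fun i => qf (y i)), bigO 5 3 1 (fun i => qh (y i)),
  bigO 4 3 1 (fun i => qp (y i)) & bigO 3 2 1 (fun i => qm (y i))].
Proof.
by split; exists 1 => // i _; rewrite mul1r expr1; case: (y_ball i).
Qed.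

Lemma bigO_rem_p : bigO 4 3 2 (fun i => rem_p (y i)).
Proof.
have [hf hh hp hm] := bigO_ball; have hd := bigO_dl hf.
have hh' : bigO 4 3 1 (fun i => qh (y i)) by apply: bigO_W hh.
have hhd : bigO 4 3 2 (fun i => qh (y i) * dl (qf (y i))) by apply: (bigO_M (n := 1) (m := 1)).
apply: bigO_N; apply: bigO_D; first by apply: bigO_M0 => //; apply: bigO_v.
apply: (bigO_M (n := 1) (m := 1)) => //; apply: bigO_D; first exact: bigO_D.
by apply: bigO_W hhd.
Qed.

Lemma bigO_rem_m : bigO 3 2 2 (fun i => rem_m E (y i)).
Proof.
have [hf hh hp hm] := bigO_ball; have hd := bigO_dl hf.
have hf' : bigO 3 2 1 (fun i => qf (y i)) by apply: bigO_W hf.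
have hp' : bigO 3 2 1 (fun i => qp (y i)) by apply: bigO_W hp.
have hh' : bigO 3 2 1 (fun i => qh (y i)) by apply: bigO_W hh.
have hd' : bigO 3 2 1 (fun i => dl (qf (y i))) by apply: bigO_W hd.
have h1 : bigO 3 2 0 (fun=> 1) by apply: bigO_1.
have hw : bigO 3 2 2 (fun i => wT * (1 + qh (y i))).
  apply: bigO_M0 => //; first exact: bigO_w.
  by apply: bigO_D => //; apply: bigO_W hh'.
have hrem : bigO 3 2 2 (fun i => qcomp E (y i) - mu - (dz mu * qf (y i) + dv mu * qp (y i))).
  apply: bigO_comp_remainder => // i; case: (y_van i) => // vf vh vp vm.
  by apply: vanMl; [apply: wdeg_add | apply: wdeg_wT].
have hmz : bigO 3 2 0 (fun=> dz mu).
  by apply: (bigO_W (s := 3) (t := 3) (n := 0)) => //; apply: bigO_dz.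
have hmv : bigO 3 2 0 (fun=> dv mu).
  by apply: (bigO_W (s := 4) (t := 2) (n := 0)) => //; apply: bigO_dv.
have hlin : bigO 3 2 1 (fun i => dz mu * qf (y i) + dv mu * qp (y i)).
  by apply: bigO_D; apply: (bigO_M (n := 0)).
have hq : bigO 3 2 1 (fun i => qcomp E (y i) - mu).
  have := bigO_D (bigO_W (leqnn _) (leqnn _) (leqnSn 1) hrem) hlin.
  by under eq_fun do rewrite subrK.
have -> : (fun i => rem_m E (y i)) = (fun i =>
  (qcomp E (y i) - mu - (dz mu * qf (y i) + dv mu * qp (y i)))
  + dl (qf (y i)) * (qcomp E (y i) - mu) - qm (y i) * dv (qp (y i))).
  by apply: funext => i; rewrite /rem_m opprD !addrA.
apply: bigO_B; last first.
  apply: (bigO_M (n := 1) (m := 1)) => //.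
  by apply: (bigO_W (s := 4) (t := 2) (n := 1)) => //; apply: bigO_dv.
apply: bigO_D => //; exact: (bigO_M (n := 1) (m := 1)).
Qed.

Lemma bigO_rem_tot : bigO 3 2 2 (fun i => rem_tot E (y i)).
Proof. by apply: bigO_B; [apply: bigO_rem_m | apply: bigO_lin_p; apply: bigO_rem_p]. Qed.

(** Every component of the image is O([be]^2), hence at most [be] once C [be] <= 1. *)
Lemma step_in_ball : exists2 C, 0 <= C &
  forall i, C * be i <= 1 -> in_ball (q i) (be i) (step E (y i)).
Proof.
have hS := bigO_rem_tot; have hf := bigO_sol_f hS; have hh := bigO_sol_h hS.
have hl := bigO_ell hf hh.
have hp := bigO_D hl bigO_rem_p; have hm := bigO_B hS (bigO_B (bigO_lin_p hl) (bigO_lin_f hf)).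
case: hf hh hp hm => [C1 C10 h1] [C2 C20 h2] [C3 C30 h3] [C4 C40 h4].
pose C := C1 + C2 + C3 + C4; exists C; first by rewrite !addr_ge0.
move=> i small.
have [L1 L2 L3 L4] := le_sum4 C10 C20 C30 C40; rewrite -/C in L1 L2 L3 L4.
have fin s t c (A : T) : 0 <= c -> c * be i <= 1 ->
    bd (q i) s t (c * be i ^+ 2) A -> bd (q i) s t (be i) A.
  move=> c0 cb; apply: bdW => //; first by rewrite mulr_ge0 // beX_ge0.
  by rewrite expr2 mulrA ler_piMl // ltW.
split.
- by apply: (fin _ _ C1) => //; [|apply: h1]; apply: le_small small.
- by apply: (fin _ _ C2) => //; [|apply: h2]; apply: le_small small.
- by apply: (fin _ _ C3) => //; [|apply: h3]; apply: le_small small.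
- by apply: (fin _ _ C4) => //; [|apply: h4]; apply: le_small small.
Qed.

End Asymptotics.

(** * Convergence of the limit series *)

Section Convergence.
Variable K : numFieldType.
Notation T := (ser (ser (ser K))).
Notation zT := (zT K).
Notation wT := (wT K).
Notation vT := (vT K).
Implicit Types A B : T.

Definition conv A := exists M r : K, 0 < r /\ forall a b c, `|A a b c| <= M * r ^+ (a + b + c).

Lemma conv_nneg A : conv A ->
  exists M r : K, [/\ 0 <= M, 1 <= r & forall a b c, `|A a b c| <= M * r ^+ (a + b + c)].
Proof.
move=> [M [r [r0 h]]]; have M0 : 0 <= M.
  by have := h 0%N 0%N 0%N; rewrite expr0 mulr1; apply: le_trans.
exists M, (r + 1); split=> //; first by rewrite lerDr ltW.
move=> a b c; apply: le_trans (h a b c) _; apply: ler_wpM2l => //.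
by apply: lerXn2r; rewrite ?nnegrE ?addr_ge0 ?lerDl // ltW.
Qed.

Lemma convD A B : conv A -> conv B -> conv (A + B).
Proof.
move=> /conv_nneg[M [r [M0 r1 h]]] /conv_nneg[M' [r' [M'0 r'1 h']]].
have r0 : 0 < r by apply: lt_le_trans r1.
have r'0 : 0 < r' by apply: lt_le_trans r'1.
exists (M + M'), (r + r'); split; first exact: addr_gt0.
move=> a b c; rewrite c3D mulrDl; apply: le_trans (ler_normD _ _) _; apply: lerD.
  apply: le_trans (h a b c) _; apply: ler_wpM2l => //.
  by apply: lerXn2r; rewrite ?nnegrE ?addr_ge0 ?lerDl // ltW.
apply: le_trans (h' a b c) _; apply: ler_wpM2l => //.
by apply: lerXn2r; rewrite ?nnegrE ?addr_ge0 ?lerDr // ltW.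
Qed.
Lemma convN A : conv A -> conv (- A).
Proof. by move=> [M [r [r0 h]]]; exists M, r; split=> // a b c; rewrite c3N normrN. Qed.

Lemma conv_w A : conv A -> conv (wT * A).
Proof.
move=> /conv_nneg[M [r [M0 r1 h]]]; have r0 : 0 < r by apply: lt_le_trans r1.
exists M, r; split=> // a [|b] c; rewrite c3w.
  by rewrite normr0 mulr_ge0 // exprn_ge0 // ltW.
apply: le_trans (h a b c) _; apply: ler_wpM2l => //.
by rewrite addnS addSn exprS ler_peMl // exprn_ge0 // ltW.
Qed.

Lemma conv_le1 A : (forall a b c, `|A a b c| <= 1) -> conv A.
Proof. by move=> h; exists 1, 1; split=> // a b c; rewrite expr1n mulr1. Qed.
Lemma conv_w0 A : conv A -> conv (w0 A).
Proof.
move=> /conv_nneg[M [r [M0 r1 h]]]; have r0 : 0 < r by apply: lt_le_trans r1.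
exists M, r; split=> // a b c; rewrite /w0; case: eqP => [->|_]; first exact: h.
by rewrite normr0 mulr_ge0 // exprn_ge0 // ltW.
Qed.

(** The weights are at most 1 and the binomial at most 2^(a + b), which the factor 2 in r
    absorbs. *)
Lemma bd_conv p l q s t C A : 0 < p -> 0 < l -> 0 < q -> 0 <= C -> bd p l q s t C A -> conv A.
Proof.
move=> p0 l0 q0 C0 h; pose r := 2%:R * (p + q + l).
have p1 := ltW p0; have l1 := ltW l0; have q1 := ltW q0.
exists C, r; split; first by rewrite mulr_gt0 ?addr_gt0.
move=> a b c; apply: le_trans (h a b c) _; apply: ler_wpM2l => //; rewrite /mw.
have wl s' n : wt K s' n <= 1 by rewrite invf_le1 ?ler1n ?ltr0n ?expn_gt0.
have r0 : 0 <= p + q + l by rewrite !addr_ge0.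
have lex x n : 0 <= x -> x <= p + q + l -> x ^+ n <= (p + q + l) ^+ n.
  by move=> x0 le; apply: lerXn2r; rewrite ?nnegrE.
apply: le_trans (_ : (2%:R ^+ (a + b)) * (p + q + l) ^+ (a + b + c) <= _); last first.
  rewrite /r exprMn; apply: ler_wpM2r; first by rewrite exprn_ge0.
  by rewrite [X in _ <= X]exprD ler_peMr ?exprn_ge0 // exprn_ege1 // ler1n.
apply: ler_pM.
- by rewrite !mulr_ge0 ?wt_ge0.
- by rewrite !mulr_ge0 ?exprn_ge0.
- rewrite -mulrA; apply: le_trans (_ : 'C(a + b, a)%:R * 1 <= _).
    apply: ler_wpM2l => //; rewrite -[X in _ <= X]mulr1; apply: ler_pM; rewrite ?wt_ge0 //.
  rewrite mulr1 -natrX ler_nat -[2%N]/(1 + 1)%N expnDn.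
  by rewrite (bigD1 (inord a)) //= inordK ?ltnS ?leq_addr // !exp1n !muln1 leq_addr.
rewrite !exprD; apply: ler_pM; rewrite ?mulr_ge0 ?exprn_ge0 //.
  apply: ler_pM; rewrite ?exprn_ge0 //; apply: lex => //.
    by rewrite -addrA lerDl addr_ge0.
  by rewrite addrAC lerDr addr_ge0.
by apply: lex => //; rewrite lerDr addr_ge0.
Qed.

Variable E : T.
Hypothesis Lm_unit : forall k, (0 < k)%N -> Lm E k \in unitmx.
Hypothesis arch : forall x : K, exists n : nat, `|x| <= n%:R.
Hypothesis E_conv : conv E.

Lemma Psi_conv : conv (Psi E).
Proof.
apply: convD => //; apply: convN; apply: conv_le1 => a b c.
by rewrite c3v; case: c => [|c]; rewrite ?normr0 // vTE normr_nat; case: andP => //.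
Qed.

Lemma limq_ball : exists p l q b : K,
  [/\ 0 < p, 0 < l, 0 < q & 0 < b /\ in_ball p l q b (limq E)].
Proof.
have [M [R [M0 R1 hM]]] := conv_nneg Psi_conv.
have R0 : 0 < R by apply: lt_le_trans R1.
have KK0 := KKK_gt0 K; have KK1 := KKK_ge1 K.
pose k : K := (12%:R * R)^-1.
have k0 : 0 < k by rewrite invr_gt0 mulr_gt0.
have kR : 12%:R * k * R <= 1 by rewrite mulrAC divff // gt_eqF // mulr_gt0.
(* With this p, used for l too, k / [KKK] is 8 / p: exactly what z needs for s = 3, and more than
   the 4 / p of zeta for t = 2. Moreover p >= 16 R, and (n + 1)^4 <= 16^n bounds [mu] for the
   exponents 4 and 3. *)
pose p : K := 96%:R * KKK K * R.
have p0 : 0 < p by rewrite !mulr_gt0.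
have p16 : 16%:R * R <= p.
  apply: ler_wpM2r; first exact: ltW.
  rewrite -[X in X <= _]mulr1; apply: ler_pM => //; rewrite ?ler_nat //.
have kp : k / KKK K = 8%:R / p.
  by rewrite /k /p; field; rewrite !gt_eqF.
have zs q : 0 < q -> bd p p q 3 2 (k / KKK K) zT.
  move=> q0; apply: (bdW (C := (mw p p q 3 2 1 0 0)^-1) p0 p0 q0 (leqnn _) (leqnn _)).
  - by rewrite invr_ge0 mw_ge0.
  - rewrite kp /mw !expr0 expr1 !mulr1 bin1 /wt exp1n invr1 mulr1 mul1r.
    by rewrite invfM invrK.
  - by apply: bd_monomial => // a b c; rewrite zTE normr_nat.
have vs q : 0 < q -> bd p p q 3 2 (k / KKK K) vT.
  move=> q0; apply: (bdW (C := (mw p p q 3 2 0 0 1)^-1) p0 p0 q0 (leqnn _) (leqnn _)).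
  - by rewrite invr_ge0 mw_ge0.
  - rewrite kp /mw !expr0 expr1 !mul1r ?bin0 /wt ?exp1n ?invr1 ?mul1r ?mulr1.
    rewrite invfM invrK; apply: ler_wpM2r; first by rewrite invr_ge0 ltW.
    by rewrite ler_nat.
  - by apply: bd_monomial => // a b c; rewrite vTE normr_nat.
have pw (n s : nat) : (s <= 4)%N -> R ^+ n <= wt K s n * p ^+ n.
  move=> s4; rewrite /wt mulrC ler_pdivlMr ?ltr0n ?expn_gt0 //.
  apply: le_trans (_ : (16%:R * R) ^+ n <= _); last first.
    by apply: lerXn2r; rewrite // nnegrE ltW // mulr_gt0.
  rewrite exprMn mulrC; apply: ler_wpM2r; first by rewrite exprn_ge0 // ltW.
  rewrite -natrX ler_nat; apply: leq_trans (_ : n.+1 ^ 4 <= _)%N; first exact: leq_pexp2l.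
  by rewrite -[16%N]/(2 ^ 4)%N -expnM mulnC expnM leq_exp2r // ltn_expl.
have hmu q : 0 < q -> bd p p q 4 3 M (mu E).
  move=> q0 a b c; rewrite /mu /w0; case: eqP => [->|_]; last first.
    by rewrite normr0 mulr_ge0 // mw_ge0.
  apply: le_trans (hM a 0%N c) _; apply: ler_wpM2l => //.
  rewrite /mw !addn0 binn expr0 mul1r mulr1 exprD.
  have -> : wt K 4 a * wt K 3 c * (p ^+ a * p ^+ c) =
    (wt K 4 a * p ^+ a) * (wt K 3 c * p ^+ c) by ring.
  by apply: ler_pM; rewrite ?exprn_ge0 ?pw // ltW.
(* The family consists of all triples (q, b, y) with y in the ball of radius b. The constant C of
   [step_in_ball] is thus uniform, and b may be chosen after it. *)
pose J := {x : K * K * quad K | [/\ 0 < x.1.1, 0 < x.1.2, x.1.2 <= 1, (x.1.1)^-1 <= x.1.2 ^+ 2 &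
  vanq 1 x.2 /\ in_ball p p x.1.1 x.1.2 x.2]}.
pose q (i : J) := (sval i).1.1; pose be (i : J) := (sval i).1.2.
have q0 i : 0 < q i by case: (svalP i).
have be0 i : 0 < be i by case: (svalP i).
have be1 i : be i <= 1 by case: (svalP i).
have qbe i : (q i)^-1 <= be i ^+ 2 by case: (svalP i).
have hmuO : bigO p p q be 4 3 0 (fun=> mu E).
  by apply: (bigO_cst _ M0) => i; apply: hmu.
have yv (i : J) : vanq 1 (sval i).2 by have [_ _ _ _ [h _]] := svalP i.
have yb (i : J) : in_ball p p (q i) (be i) (sval i).2 by have [_ _ _ _ [_ h]] := svalP i.
have [C C0 hC] := step_in_ball p0 p0 q0 be0 be1 qbe Lm_unit arch M0 (ltW R0) k0 kR hM
  (fun i => zs _ (q0 i)) (fun i => vs _ (q0 i)) hmuO yv yb.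
(* With [q = b ^ -2] the series [w] has size [O(b ^ 2)]. *)
pose b := (C + 1)^-1; pose q1 : K := (b ^+ 2)^-1.
have b0 : 0 < b by rewrite invr_gt0 ltr_wpDl.
have b1 : b <= 1 by rewrite invf_le1 ?lerDr // ltr_wpDl.
have q10 : 0 < q1 by rewrite invr_gt0 exprn_gt0.
have Cb : C * b <= 1 by rewrite ler_pdivrMr ?ltr_wpDl // mul1r lerDl.
have ball n : in_ball p p q1 b (iterq E n).
  elim: n => [|n IH].
    by split=> x y z; rewrite /= c30 normr0 (mulr_ge0 (ltW b0)) ?mw_ge0.
  have h : [/\ 0 < q1, 0 < b, b <= 1, q1^-1 <= b ^+ 2 &
    vanq 1 (iterq E n) /\ in_ball p p q1 b (iterq E n)].
    by split=> //; [rewrite invrK | split=> //; apply: iterq_van].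
  exact: (hC (exist _ (q1, b, iterq E n) h) Cb).
exists p, p, q1, b; split=> //; split=> //.
have lim (P : quad K -> T) s t : (forall n, van wdeg n (P (limq E) - P (iterq E n))) ->
   (forall n, bd p p q1 s t b (P (iterq E n))) -> bd p p q1 s t b (P (limq E)).
  move=> cl hb a j c; have /eqP := cl j.+1 a j c (ltnSn j).
  by rewrite c3B subr_eq0 => /eqP->; apply: hb.
split; apply: lim => n; try (by case: (limq_close E n)); by case: (ball n).
Qed.

Lemma limq_conv : [/\ conv (qf (limq E)), conv (qh (limq E)) & conv (qm (limq E))].
Proof.
have [p [l [q [b [p0 l0 q0 [b0 [h1 h2 _ h4]]]]]]] := limq_ball.
by split; [apply: bd_conv h1 | apply: bd_conv h2 | apply: bd_conv h4] => //; apply: ltW.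
Qed.

End Convergence.

(** * Morphisms are fixed points *)

Section Interface.
Variable R : realType.
Notation K := (R[i]).
Notation T := (ser (ser (ser K))).
Notation zT := (zT K).
Notation wT := (wT K).
Notation vT := (vT K).
Implicit Types A B F G P N E Phi : T.

Lemma fps_zE : fps_z R = zT.
Proof. by apply: c3P => a b c; rewrite zTE /fps_z; case: ifP. Qed.
Lemma fps_wE : fps_w R = wT.
Proof. by apply: c3P => a b c; rewrite wTE /fps_w; case: ifP. Qed.
Lemma fps_zetaE : fps_zeta R = vT.
Proof. by apply: c3P => a b c; rewrite vTE /fps_zeta; case: ifP. Qed.
Lemma fps_mulE A B : fps_mul A B = A * B.
Proof. by apply: c3P => a b c; rewrite c3M. Qed.
Lemma fps_addE A B : fps_add A B = A + B. Proof. by []. Qed.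
Lemma fps_subE A B : fps_sub A B = A - B. Proof. by []. Qed.
Lemma fps_expE A n : fps_exp A n = A ^+ n.
Proof.
elim: n => [|n IH]; last by rewrite exprS -IH -fps_mulE.
by apply: c3P => a b c; rewrite expr0 c31 /= /fps_const; case: ifP.
Qed.
Lemma fps_compE Phi F G P : fps_comp Phi F G P = comp Phi F G P.
Proof.
apply: c3P => i j k; rewrite /fps_comp /comp /compN c3sum; apply: eq_bigr => a _.
rewrite c3sum; apply: eq_bigr => b _; rewrite c3sum; apply: eq_bigr => c _.
by rewrite c3cst !fps_mulE !fps_expE.
Qed.
Lemma ode_fieldE Phi A : ode_field Phi A = dz A + vT * Dw A + (Phi - vT * vT) * dv A.
Proof.
rewrite /ode_field !fps_mulE fps_subE !fps_addE fps_wE fps_zetaE.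
have -> : fps_dw A = dw A by [].
by rewrite -wT_dw addrA [wT * vT]mulrC -mulrA.
Qed.

Lemma vvE a b c : (vT * vT) a b c = [&& a == 0, b == 0 & c == 2]%N%:R.
Proof. by rewrite c3v; case: c => [|c]; rewrite ?vTE ?andbF // eqSS. Qed.

Lemma comp_Psi E F G P : van tdeg 1 F -> van tdeg 1 G -> van tdeg 1 P ->
  comp (Psi E) F G P = comp E F G P - P * P.
Proof.
move=> tF tG tP; apply: c3P => i j k.
(* The cutoff is at least 3, so that the monomial zeta^2 is always among the terms. *)
pose N := (i + j + k).+2; have ltN : (i + j + k < N.+1)%N by rewrite /N; lia.
rewrite c3B -!(compNE _ tF tG tP ltN).
suff -> : (P * P) i j k = compN (vT * vT) N.+1 F G P i j k.
  rewrite /compN !c3sum -sumrB; apply: eq_bigr => a _.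
  rewrite !c3sum -sumrB; apply: eq_bigr => b _.
  rewrite !c3sum -sumrB; apply: eq_bigr => c _.
  by rewrite !c3cst -mulrBl.
rewrite /compN c3sum big_ord_recl [X in _ + X]big1 ?addr0 => [|a _]; last first.
  rewrite c3sum big1 // => b _; rewrite c3sum big1 // => c _.
  by rewrite c3cst vvE mul0r.
rewrite c3sum big_ord_recl [X in _ + X]big1 ?addr0 => [|b _]; last first.
  by rewrite c3sum big1 // => c _; rewrite c3cst vvE mul0r.
rewrite c3sum 3!big_ord_recl [X in _ + (_ + (_ + X))]big1 ?addr0 => [|c _]; last first.
  by rewrite c3cst vvE mul0r.
by rewrite !c3cst !vvE /= !mul0r !add0r mul1r !expr0 !mul1r expr2.
Qed.

Lemma complex_arch (x : K) : exists n : nat, `|x| <= n%:R.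
Proof.
rewrite normc_def; set r := Num.sqrt _; exists (Num.bound r).
have -> : (Num.bound r)%:R = ((Num.bound r)%:R)%:C%C :> K by rewrite rmorph_nat.
by rewrite lecR ltW // archi_boundP // sqrtr_ge0.
Qed.

Lemma Lm_res E k : Lm E k = res_matrix E k. Proof. by []. Qed.

Lemma nonres_unit E : nonresonant E -> forall k, (0 < k)%N -> Lm E k \in unitmx.
Proof.
move=> nr k k0; rewrite Lm_res unitmxE unitfE -det_tr; apply/negP => /det0P[v v0 e].
move/negP: v0; apply; apply/eqP; apply: trmx_inj; rewrite trmx0; apply: (nr k k0).
by apply: trmx_inj; rewrite trmx_mul trmxK e trmx0.
Qed.
(** The second form is the equation for P with the common factor w cancelled; both forms have the
    same difference of sides. *)
Lemma solution_alg (f h p : T) : p = ell f h - (h * dl f * vT + (h + dl f + h * dl f) * p) <->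
  (1 + dl f) * ((1 + h) * (vT + p)) = dz h + vT * (1 + h + Dw h).
Proof.
have e : (1 + dl f) * ((1 + h) * (vT + p)) - (dz h + vT * (1 + h + Dw h)) =
  p - (ell f h - (h * dl f * vT + (h + dl f + h * dl f) * p)) by rewrite /ell /dl; ring.
split=> [ep|eq]; apply/eqP; rewrite -subr_eq0; first by rewrite e {1}ep subrr.
by rewrite -e eq subrr.
Qed.

Lemma dz_zT f : dz (zT + f) = 1 + dz f.
Proof.
rewrite dzD; congr (_ + _); apply: c3P => a b c; rewrite /dz zTE c31 eqSS.
by case: a => [|a]; rewrite ?mulr1n //= mul0rn.
Qed.
Lemma Dw_zT : Dw zT = 0.
Proof. by apply: c3P => a [|b] c; rewrite /Dw ?mulr0n // zTE andbF mul0rn. Qed.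
Lemma dv_zT : dv zT = 0.
Proof. by apply: c3P => a b c; rewrite /dv zTE !andbF mul0rn. Qed.
Lemma dz_vT0 : dz vT = 0.
Proof. by apply: c3P => a b c; rewrite /dz vTE mul0rn. Qed.
Lemma Dw_vT0 : Dw vT = 0.
Proof. by apply: c3P => a [|b] c; rewrite /Dw ?mulr0n // vTE andbF mul0rn. Qed.
Lemma dv_vT1 : dv vT = 1.
Proof.
apply: c3P => a b c; rewrite /dv vTE c31 eqSS.
by case: a => [|a]; case: b => [|b]; case: c => [|c]; rewrite //= ?mul0rn.
Qed.
Lemma Dw_1 : Dw (1 : T) = 0.
Proof. by apply: c3P => a [|b] c; rewrite /Dw ?mulr0n // c31 andbF mul0rn. Qed.
Lemma dz_1 : dz (1 : T) = 0.
Proof. by apply: c3P => a b c; rewrite /dz c31 mul0rn. Qed.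
Lemma dz_w A : dz (wT * A) = wT * dz A.
Proof. by apply: c3P => a [|b] c; rewrite c3w /dz c3w ?mul0rn. Qed.
Lemma Dw_w A : Dw (wT * A) = wT * (A + Dw A).
Proof. by apply: c3P => a [|b] c; rewrite c3w /Dw c3w ?mul0rn // mulrS. Qed.
Lemma dv_w A : dv (wT * A) = wT * dv A.
Proof. by apply: c3P => a [|b] c; rewrite c3w /dv c3w ?mul0rn. Qed.
Lemma zf_1 : zeta_free (1 : T).
Proof. by move=> a b [|c] // _; rewrite c31 !andbF. Qed.

Lemma field_F N f : zeta_free f -> ode_field N (zT + f) = 1 + dl f :> T.
Proof.
move=> zf; rewrite ode_fieldE dz_zT DwD Dw_zT dvD dv_zT (dv_zf zf) /dl; ring.
Qed.
Lemma field_G N h : zeta_free h ->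
  ode_field N (wT * (1 + h)) = wT * (dz h + vT * (1 + h + Dw h)) :> T.
Proof.
move=> zh; rewrite ode_fieldE dz_w Dw_w dv_w dzD dz_1 DwD Dw_1.
by rewrite (dv_zf (zfD zf_1 zh)); ring.
Qed.
Lemma field_P N p : ode_field N (vT + p) =
  dz p + vT * Dw p + (N - vT * vT) * (1 + dv p) :> T.
Proof. by rewrite ode_fieldE dzD dz_vT0 DwD Dw_vT0 dvD dv_vT1; ring. Qed.

Lemma G_alg (g0 g : T) : wT * (1 + (g0 + g)) = wT + (wT * g0 + wT * g).
Proof. by ring. Qed.

Definition normal_of E (y : quad K) : T := mu E + qm y + vT * vT.
Definition map_F (y : quad K) : T := zT + qf y.
Definition map_G (y : quad K) : T := wT * (1 + qh y).

Lemma eq2_alg E N f h p : let C := comp (Psi E) (zT + f) (wT * (1 + h)) (vT + p) in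
  let m := N - vT * vT - mu E in
  (m + lin_p E p - lin_f E f = (C - mu E - dz (mu E) * f - dv (mu E) * p)
     + dl f * (C - mu E) - m * dv p) <->
  dz p + vT * Dw p + (N - vT * vT) * (1 + dv p) = (1 + dl f) * C.
Proof.
move=> C m; rewrite /lin_p /lin_f /m.
move: C (mu E) (dz (mu E)) (dv (mu E)) (dl f) (dv p) (dz p) (Dw p).
move=> C mu' mz mv d pv pz pw {m}.
have e : N - vT * vT - mu' + (mu' * pv + pz + vT * pw - p * mv) - (d * mu' + f * mz)
  - (C - mu' - mz * f - mv * p + d * (C - mu') - (N - vT * vT - mu') * pv) =
  pz + vT * pw + (N - vT * vT) * (1 + pv) - (1 + d) * C by ring.
split=> eq; apply/eqP; rewrite -subr_eq0; first by rewrite -e eq subrr.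
by rewrite e eq subrr.
Qed.

Lemma Hom_of_solution E y : (forall a b c, (c < 2)%N -> E a b c = 0) ->
  solution E y -> in_D1 (normal_of E y) /\ ode_Hom (normal_of E y) E (map_F y) (map_G y).
Proof.
case: y => f h p m E_low; rewrite /normal_of /map_F /map_G /=.
case=> /=; rewrite /rem_p /rem_m /qcomp /= => -[/= vf vh vp vm] [zf zh] ep em [low low'].
split.
  split=> [a b c c2|j j0].
    rewrite !c3D low // addr0 vvE (_ : (c == 2) = false) ?andbF ?addr0 /=; last lia.
    by rewrite /mu /w0 Psi_low // if_same.
  have e a c : (a < 2)%N -> (2 <= c < 4)%N -> (mu E + m + vT * vT) a j c = 0.
    move=> a2 c2; rewrite !c3D low' // vvE /mu /w0.
    by case: j j0 => // j _; rewrite /= andbF !addr0.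
  by split; apply: e.
split.
  split; first by move=> a b [|c] c0 //; rewrite c3D zTE zf // !andbF addr0.
  split.
    move=> a b c c0; rewrite c3w; case: b => // b.
    by rewrite c3D zf_1 // zh // addr0.
  (* The restriction of h to z = 0; the rest of h is divisible by z w, as g must be. *)
  pose g0 : T := fun a b c => if a == 0%N then h a b c else 0.
  exists f, g0, (h - g0); split.
  - split=> //; split.
      move=> a b c; rewrite /g0; case: a => [|a] //= c0; first by apply: zh.
    by move=> a b c c0; rewrite c3B /g0 zh // if_same subrr.
  - by rewrite fps_addE fps_zE.
  - rewrite !fps_addE !fps_mulE fps_wE -[in LHS](subrK g0 h) [h - g0 + g0]addrC.
    exact: G_alg.
  - by split; [|split]; [apply: vf | apply: vf | apply: vh].
  - move=> a b c /orP[/eqP->|/eqP->]; rewrite c3B /g0 /= ?subrr //.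
    by rewrite vh // if_same subrr.
have tF : van tdeg 1 (zT + f) by apply: vanD; [apply: tdeg_zT | apply: van_tdeg].
have tP : van tdeg 1 (vT + p) by apply: vanD; [apply: tdeg_vT | apply: van_tdeg].
have tG : van tdeg 1 (wT * (1 + h)).
  by apply: van_tdeg; apply: vanMl; [apply: wdeg_add | apply: wdeg_wT].
exists (vT + p); split.
- by rewrite c3D vp // vTE addr0.
- rewrite field_F // field_G // !fps_mulE -((solution_alg f h p).1 ep).
  by rewrite -mulrA mulrCA.
- rewrite field_F // field_P !fps_mulE fps_subE fps_compE -comp_Psi //.
  apply: (eq2_alg E (mu E + m + vT * vT) f h p).1.
  by rewrite [mu E + m + _ - _ - _](_ : _ = m) //; ring.
Qed.

(* At w = 0 the first equation reads [(1 + f_z) P = zeta]; the zeta^1 part of the second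
   one is then [P_z = 0], so [f_z = 0] and [P = zeta] there, and [N = Psi] at w = 0. *)
Lemma solution_of_eqs E N f h P : (forall a b c, (c < 2)%N -> E a b c = 0) -> in_D1 N ->
  zeta_free f -> zeta_free h -> van wdeg 1 h ->
  f 0%N 0%N 0%N = 0 -> f 1%N 0%N 0%N = 0 -> P 0%N 0%N 0%N = 0 ->
  (1 + dl f) * ((1 + h) * P) = dz h + vT * (1 + h + Dw h) ->
  dz P + vT * Dw P + (N - vT * vT) * dv P =
    (1 + dl f) * comp (Psi E) (zT + f) (wT * (1 + h)) P ->
  solution E (Quad f h (P - vT) (N - vT * vT - mu E)).
Proof.
move=> E_low [N_low N_norm] zf zh vh f0 f1 P0 eq1 eq2; have wa := wdeg_add.
have t1 (X : T) : X 0%N 0%N 0%N = 0 -> van tdeg 1 X.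
  move=> X0 a b c; rewrite /tdeg ltnS leqn0 !addn_eq0.
  by move=> /andP[/andP[/eqP-> /eqP->] /eqP->].
have tF : van tdeg 1 (zT + f) by apply: t1; rewrite c3D zTE f0 addr0.
have tP : van tdeg 1 P by apply: t1.
have wG : van wdeg 1 (wT * (1 + h)) by apply: vanMl => //; apply: wdeg_wT.
have tG := van_tdeg wG.
have vD A : van wdeg 1 (Dw A) by move=> a [|b] c // _; rewrite /Dw mulr0n.
have hV : van wdeg 1 ((1 + dz f) * P - vT).
  have -> : (1 + dz f) * P - vT = dz h + vT * (h + Dw h)
      - vT * Dw f * ((1 + h) * P) - (1 + dz f) * (h * P).
    apply/eqP; rewrite -subr_eq0 -[X in _ == X](subrr (dz h + vT * (1 + h + Dw h))) -{1}eq1.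
    by rewrite /dl; apply/eqP; ring.
  apply: vanB; last by apply: vanMr => //; apply: vanMl.
  apply: vanB; last by apply: vanMl => //; apply: vanMr.
  by apply: vanD; [apply: van_dz | apply: vanMr => //; apply: vanD].
have zdf : zeta_free (dz f) by apply: zf_dz.
have cP a c : P a 0%N c + \sum_(i < a.+1) dz f i 0%N 0%N * P (a - i)%N 0%N c = vT a 0%N c.
  have /eqP := hV a 0%N c isT; rewrite c3B subr_eq0 mulrDl mul1r c3D => /eqP <-.
  congr (_ + _); rewrite c3M; apply: eq_bigr => i _.
  rewrite big_ord1 big_ord_recl big1 => [|j _]; first by rewrite addr0 /= !subn0.
  by rewrite zdf ?mul0r.
have df0 : dz f 0%N 0%N 0%N = 0 by rewrite /dz f1 mul0rn.
(* By f_z(0, 0) = 0 the term [i = 0] of [cP] drops out, leaving a recursion on earlier coefficients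
   of P. *)
have Pn1 c : c != 1%N -> forall a, P a 0%N c = 0.
  move=> c1; apply: ltn_ind => a IH; have := cP a c.
  rewrite big_ord_recl df0 mul0r add0r big1 ?addr0 => [->|i _].
    by rewrite vTE (negPf c1) !andbF.
  by rewrite IH ?mulr0 //= /bump; have := ltn_ord i; lia.
have P01 : P 0%N 0%N 1%N = 1.
  by have := cP 0%N 1%N; rewrite big_ord1 df0 mul0r addr0 vTE.
have N_low2 : van vwdeg 2 (N - vT * vT).
  move=> a b c; rewrite /vwdeg => lt; rewrite c3B N_low; last by lia.
  by rewrite vvE (_ : (c == 2%N) = false) ?andbF ?subr0 //; lia.
(* In the second equation at w = 0, N - zeta^2 and the substituted [Psi] both start at zeta^2, so
   the zeta^1 coefficient reduces to P_z = 0. *)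
have Pa1 a : P a.+1 0%N 1%N = 0.
  have z1 : ((N - vT * vT) * dv P) a 0%N 1%N = 0.
    exact: (vanMl vwdeg_add (dv P) N_low2 (isT : (vwdeg a 0 1 < 2)%N)).
  have z2 : ((1 + dl f) * comp (Psi E) (zT + f) (wT * (1 + h)) P) a 0%N 1%N = 0.
    apply: (vanMr vwdeg_add (n := 2)) => //; apply: comp_low => [||a' b' c'].
    - exact: Psi_low.
    - by move=> a' b' c'; rewrite /vwdeg => lt; apply: wG; rewrite /wdeg; lia.
    rewrite /vwdeg ltnS leqn0 => lt.
    have [-> ->] : b' = 0%N /\ c' = 0%N by split; lia.
    exact: Pn1.
  move: z2; rewrite -eq2 !c3D z1 addr0 c3v /Dw mulr0n addr0 /dz.
  by move/eqP; rewrite mulrn_eq0 /= => /eqP.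
have vp : van wdeg 1 (P - vT).
  move=> a b c; rewrite /wdeg ltnS leqn0 => /eqP->; rewrite c3B vTE /=.
  case: (eqVneq c 1%N) => [->|c1]; last by rewrite Pn1 // !andbF subr0.
  by case: a => [|a]; rewrite ?P01 ?Pa1 subrr.
(* With P = zeta modulo w, the relation (1 + f_z) P = zeta leaves f_z zeta = 0 modulo w. *)
have vdf : van wdeg 1 (dz f * vT).
  have -> : dz f * vT = ((1 + dz f) * P - vT) - (1 + dz f) * (P - vT) by ring.
  by apply: vanB => //; apply: vanMr.
have vf : van wdeg 1 f.
  move=> a b c; rewrite /wdeg ltnS leqn0 => /eqP->.
  case: c => [|c]; last by rewrite zf.
  case: a => [|a]; first exact: f0.
  have := vdf a 0%N 1%N isT; rewrite mulrC c3v /dz.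
  by move/eqP; rewrite mulrn_eq0 /= => /eqP.
pose p : T := P - vT; have eP : P = vT + p by rewrite /p; ring.
have vp' : van wdeg 1 p by [].
have edz : dz P = dz p by rewrite [in LHS]eP dzD dz_vT0 add0r.
have edD : Dw P = Dw p by rewrite [in LHS]eP DwD Dw_vT0 add0r.
have edv : dv P = 1 + dv p by rewrite [in LHS]eP dvD dv_vT1.
pose m : T := N - vT * vT - mu E.
have vC := comp_wcongr (Psi E) wG (_ : van wdeg 1 (zT + f - zT)) vp tF tP.
rewrite addKl in vC; have {}vC := vC vf.
have vm : van wdeg 1 m.
  have vdl := van_dl vf.
  have -> : m = (comp (Psi E) (zT + f) (wT * (1 + h)) P - mu E)
    + dl f * comp (Psi E) (zT + f) (wT * (1 + h)) P - dz p - vT * Dw P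
    - (N - vT * vT) * dv p.
    rewrite edz edv in eq2; rewrite /m.
    move: eq2; move: (comp _ _ _ _) (dz p) (Dw P) (dv p) (dl f) (mu E) (N - vT * vT).
    move=> C pz pw pv d mu' X.
    move=> eq2; apply/eqP; rewrite -subr_eq0.
    rewrite -[X in _ == X](subrr ((1 + d) * C)) -{1}eq2; apply/eqP; ring.
  do ![apply: vanB]; last by apply: vanMr => //; apply: van_dv.
  - by apply: vanD => //; apply: vanMl.
  - exact: van_dz.
  - exact: vanMr.
have eN : N = mu E + m + vT * vT by rewrite /m; ring.
split=> //=.
- by apply/solution_alg; rewrite -eP.
- by apply/eq2_alg; rewrite -/p -eP -eq2 edz edD edv.
split=> [a b c c2|a b c a2 c2].
  rewrite /m !c3B N_low // vvE /mu /w0 Psi_low // if_same.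
  by rewrite (_ : (c == 2%N) = false) ?andbF ?subr0 //; lia.
case: (posnP b) => [->|b0]; first exact: vm.
have [n1 n2 n3 n4] := N_norm b b0.
rewrite /m !c3B vvE /mu /w0 (gtn_eqF b0) ?andbF ?subr0 //=.
by case: a a2 => [|[|//]] _; case: c c2 => [|[|[|[|//]]]].
Qed.

Lemma solution_of_Hom E N F G : (forall a b c, (c < 2)%N -> E a b c = 0) ->
  in_D1 N -> ode_Hom N E F G ->
  exists y, [/\ solution E y, N = normal_of E y, F = map_F y & G = map_G y].
Proof.
move=> E_low [N_low N_norm] [[zF [zG [f [g0 [g [[zf [wg0 zg] eF eG [f0 [f1 g00]] gv]]]]]]]].
case=> P [P0 eq1 eq2].
pose h : T := (g0 : T) + g; have wa := wdeg_add.
have zh : zeta_free h.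
  by apply: zfD => // a b c c0; apply: wg0; rewrite c0 orbT.
have vh : van wdeg 1 h.
  move=> a b c; rewrite /wdeg ltnS leqn0 => /eqP->; rewrite /h c3D gv ?orbT // addr0.
  case: a => [|a]; last exact: wg0.
  by case: c => [|c] //; apply: wg0.
have {}eF : F = zT + f by rewrite eF fps_zE.
have {}eG : G = wT * (1 + h) by rewrite eG !fps_addE !fps_mulE fps_wE /h G_alg.
rewrite eF eG in eq1 eq2 *.
rewrite field_F // field_G // !fps_mulE in eq1.
have {}eq1 : (1 + dl f) * ((1 + h) * P) = dz h + vT * (1 + h + Dw h).
  by apply: wT_inj; rewrite -eq1; ring.
have t1 (X : T) : X 0%N 0%N 0%N = 0 -> van tdeg 1 X.
  move=> X0 a b c; rewrite /tdeg ltnS leqn0 !addn_eq0.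
  by move=> /andP[/andP[/eqP-> /eqP->] /eqP->].
have tF : van tdeg 1 (zT + f) by apply: t1; rewrite c3D zTE f0 addr0.
have tP : van tdeg 1 P by apply: t1.
have tG : van tdeg 1 (wT * (1 + h)).
  by apply: van_tdeg; apply: vanMl => //; apply: wdeg_wT.
rewrite field_F // fps_compE fps_subE !fps_mulE -comp_Psi // ode_fieldE in eq2.
exists (Quad (f : T) h ((P : T) - vT) ((N : T) - vT * vT - mu E)); split=> //.
  exact: solution_of_eqs.
by rewrite /normal_of /=; ring.
Qed.
End Interface.

Theorem theorem5p2 (R : realType) (E : fps R) :
  in_E1 E -> nonresonant E ->
  exists N : fps R,
    [/\ in_D1 N,
        (* the normal form is unique among normal forms admitting a morphism to E *)
        (forall N' : fps R, in_D1 N' -> (exists F G, ode_Hom N' E F G) -> N' = N),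
        (* there is exactly one normalizing transformation N -> E *)
        (exists F G, ode_Hom N E F G /\
           forall F' G', ode_Hom N E F' G' -> F' = F /\ G' = G)
      & (* convergence *)
        ode_convergent E ->
          ode_convergent N /\
          forall F G, ode_Hom N E F G -> fps_convergent F /\ fps_convergent G].
Proof.
move=> E_low nr; have unit_Lm := nonres_unit nr.
have sol := limq_solution E_low unit_Lm; set y := limq E in sol.
have [D1 hom] := Hom_of_solution E_low sol.
(* Normal form and map are components of one solution y, so both uniqueness claims follow at once.
   Convergence follows too, since any morphism is built from the limit of the iteration. *)
have uniq N' F G : in_D1 N' -> ode_Hom N' E F G ->
    [/\ N' = normal_of E y, F = map_F y & G = map_G y].
  move=> D1' hom'; have [y' [sol' -> -> ->]] := solution_of_Hom E_low D1' hom'.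
  by rewrite (solution_uniq E_low unit_Lm sol' sol).
exists (normal_of E y); split=> //.
- by move=> N' D1' [F [G hom']]; case: (uniq N' F G D1' hom').
- exists (map_F y), (map_G y); split=> // F G hom'.
  by case: (uniq _ F G D1 hom').
move=> cE; have [cf ch cm] := limq_conv unit_Lm (@complex_arch R) cE.
have c1 (A : ser (ser (ser R[i]))) : (forall a b c, A a b c = 0 \/ A a b c = 1) -> conv A.
  by move=> h; apply: conv_le1 => a b c; case: (h a b c) => ->; rewrite ?normr0 ?normr1.
split.
  apply: convD; last by apply: c1 => a b c; rewrite vvE; case: [&& _, _ & _]; [right|left].
  by apply: convD cm; apply/conv_w0/Psi_conv.
move=> F G hom'; have [_ -> ->] := uniq _ F G D1 hom'; split.
  by apply: convD cf; apply: c1 => a b c; rewrite zTE; case: [&& _, _ & _]; [right|left].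
apply: conv_w; apply: convD ch; apply: c1 => a b c; rewrite c31.
by case: [&& _, _ & _]; [right|left].
Qed.
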